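(* Let $a\in L^{N/2}(\mathbb{R}^N)$, $a\ge 0$, $a\ne 0$, $\lim_{|x|\to\infty}a(x)=0$, and let $b\in L^{\infty}(\mathbb{R}^N)$, $b\ge 0$, $b\ne 0$, $\lim_{|x|\to\infty}b(x)=0$. If $\bar\lambda\in\mathbb{R}^+$ is such that $m_{\bar\lambda}=m_\infty$, then for all $\lambda>\bar\lambda$ one has $m_\lambda=m_\infty$ and, moreover, $m_\lambda$ is not achieved (i.e. there is no $u\in\mathcal{N}_\lambda$ with $I_\lambda(u)=m_\lambda$).
   Context: $N\ge 2$ is an integer; $p>1$, and $p<\frac{N+2}{N-2}$ if $N\ge 3$; $a_\infty>0$ and $b_\infty>0$ are constants; $\mathbb{R}^+=[0,+\infty)$. On $H^1(\mathbb{R}^N)$, $$I_\lambda(u)=\frac12\int_{\mathbb{R}^N}|\nabla u|^2+(a_\infty+\lambda a(x))u^2-\frac1{p+1}\int_{\mathbb{R}^N}(b_\infty+b(x))|u|^{p+1},$$ $$I_\infty(u)=\frac12\int_{\mathbb{R}^N}|\nabla u|^2+a_\infty u^2-\frac1{p+1}\int_{\mathbb{R}^N}b_\infty|u|^{p+1},$$ $\mathcal{N}_\lambda=\{u\in H^1(\mathbb{R}^N)\setminus\{0\}: I_\lambda'(u)[u]=0\}$, $\mathcal{N}_\infty=\{u\in H^1(\mathbb{R}^N)\setminus\{0\}: I_\infty'(u)[u]=0\}$, $m_\lambda=\inf_{\mathcal{N}_\lambda}I_\lambda$ and $m_\infty=\inf_{\mathcal{N}_\infty}I_\infty$. *)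

(* Defs.v *)
From HB Require Import structures.
From mathcomp Require Import all_boot all_order all_algebra.
From mathcomp Require Import all_classical all_reals all_analysis.

Set Implicit Arguments.
Unset Strict Implicit.
Unset Printing Implicit Defensive.

Import Order.TTheory GRing.Theory Num.Theory.
Import numFieldNormedType.Exports.

Local Open Scope classical_set_scope.
Local Open Scope ring_scope.

Definition measure_rV_display : measure_display -> measure_display.
Proof. exact. Qed.

(* As for [n.-tuple T]: the sigma-algebra on ['rV[T]_n] is generated by the
   coordinate functions. *)
Section measurable_rV.
Context {d : measure_display} {T : sigmaRingType d}.
Variable n : nat.

Let coors : 'I_n -> 'rV[T]_n -> T := fun i x => x ord0 i.

Let rV_set0 : g_sigma_preimage coors set0.
Proof. exact: sigma_algebra0. Qed.

Let rV_setC A : g_sigma_preimage coors A -> g_sigma_preimage coors (~` A).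
Proof. exact: sigma_algebraC. Qed.

Let rV_bigcup (F : _^nat) : (forall i, g_sigma_preimage coors (F i)) ->
  g_sigma_preimage coors (\bigcup_i (F i)).
Proof. exact: sigma_algebra_bigcup. Qed.

HB.instance Definition _ := @isMeasurable.Build (measure_rV_display d)
  'rV[T]_n (g_sigma_preimage coors) rV_set0 rV_setC rV_bigcup.

End measurable_rV.

Section measurable_rV_lemmas.
Context {d : measure_display} {T : measurableType d}.

Lemma measurable_coord_rV n (i : 'I_n) :
  measurable_fun [set: 'rV[T]_n] (fun x : 'rV[T]_n => x ord0 i).
Proof.
move=> _ Y mY; rewrite setTI; apply: sub_sigma_algebra => /=.
rewrite -bigcup_seq/=; exists i => /=; first by rewrite mem_index_enum.
by exists Y => //; rewrite setTI.
Qed.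

Lemma measurable_fun_coord_rV d1 (T1 : measurableType d1) n
    (f : T1 -> 'rV[T]_n) :
  (forall i, measurable_fun [set: T1] (fun x => f x ord0 i)) ->
  measurable_fun [set: T1] f.
Proof.
move=> mf _ A mA; rewrite setTI.
have : g_sigma_preimage (fun i x => f x ord0 i) `<=` measurable.
  apply: smallest_sub; first exact: sigma_algebra_measurable.
  rewrite -bigcup_seq/= => B [i _ [C mC <-]]; rewrite setTI.
  by rewrite -[_ @^-1` _]setTI; exact: mf.
apply.
rewrite (_ : (fun i => _) = (fun i => (fun x : 'rV[T]_n => x ord0 i) \o f))//.
by rewrite g_sigma_preimage_comp; exists A => //; rewrite setTI.
Qed.

End measurable_rV_lemmas.

(* Lebesgue measure on ['rV[R]_n]: the image of the product of [lebesgue_measure]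
   and of the [n]-dimensional measure under [R * R^n ~ R^(n+1)]. *)
Section lebesgue_rV.
Context {R : realType}.

Definition cons_rV n (x : measurableTypeR R * 'rV[R]_n) : 'rV[R]_n.+1 :=
  row_mx (const_mx x.1 : 'rV_1) x.2.

Lemma cons_rV0 n (x : measurableTypeR R * 'rV[R]_n) : cons_rV x ord0 ord0 = x.1.
Proof.
transitivity (row_mx (const_mx x.1 : 'rV_1) x.2 ord0 (lshift n ord0)).
  by congr (row_mx _ _ _ _); apply: val_inj.
by rewrite row_mxEl mxE.
Qed.

Lemma cons_rVS n (x : measurableTypeR R * 'rV[R]_n) (j : 'I_n) :
  cons_rV x ord0 (lift ord0 j) = x.2 ord0 j.
Proof.
rewrite -(row_mxEr (const_mx x.1 : 'rV_1) x.2).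
by congr (row_mx _ _ _ _); apply: val_inj.
Qed.

Lemma measurable_cons_rV n : measurable_fun setT (@cons_rV n).
Proof.
apply: measurable_fun_coord_rV => i; case: (unliftP ord0 i) => [j ->|->].
  rewrite (_ : (fun x => _) = (fun y : 'rV[R]_n => y ord0 j) \o snd).
    exact: (measurableT_comp (measurable_coord_rV j) measurable_snd).
  by apply/funext => x; rewrite cons_rVS.
rewrite (_ : (fun x => _) = fst); last first.
  by apply/funext => x; rewrite cons_rV0.
exact: (@measurable_fst _ _ (measurableTypeR R) 'rV[R]_n).
Qed.

Section step.
Variables (n : nat) (mu : {sigma_finite_measure set 'rV[R]_n -> \bar R}).

Definition lebesgue_cons : set 'rV[R]_n.+1 -> \bar R :=
  pushforward (@lebesgue_measure R \x mu)%E (@cons_rV n).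

Let lebesgue_cons0 : lebesgue_cons set0 = 0%E.
Proof. by rewrite /lebesgue_cons /pushforward preimage_set0 measure0. Qed.

Let lebesgue_cons_ge0 A : (0 <= lebesgue_cons A)%E.
Proof. by rewrite /lebesgue_cons /pushforward measure_ge0. Qed.

Let lebesgue_cons_sigma_additive : semi_sigma_additive lebesgue_cons.
Proof.
exact: (@measure_semi_sigma_additive _ _ _
  (measure_function_pushforward__canonical__measure_function_Measure
    (@lebesgue_measure R \x mu)%E (@measurable_cons_rV n))).
Qed.

HB.instance Definition _ := isMeasure.Build _ _ _
  lebesgue_cons lebesgue_cons0 lebesgue_cons_ge0 lebesgue_cons_sigma_additive.

Let lebesgue_cons_sigma_finite : sigma_finite setT lebesgue_cons.
Proof.
have /sigma_finiteP[F [TF ndF Foo]] := sigma_finiteT (@lebesgue_measure R).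
have /sigma_finiteP[G [TG ndG Goo]] := sigma_finiteT mu.
pose g (x : 'rV[R]_n.+1) : measurableTypeR R * 'rV[R]_n :=
  (x ord0 ord0, \row_j x ord0 (lift ord0 j)).
have mg : measurable_fun setT g.
  apply: measurable_fun_pair; first exact: measurable_coord_rV.
  apply: measurable_fun_coord_rV => i.
  rewrite (_ : (fun x => _) = (fun x : 'rV[R]_n.+1 => x ord0 (lift ord0 i))).
    exact: measurable_coord_rV.
  by apply/funext => x; rewrite mxE.
have gK : cancel (@cons_rV n) g.
  move=> [x y]; rewrite /g cons_rV0; congr pair.
  by apply/rowP => j; rewrite mxE cons_rVS.
exists (fun k => g @^-1` (F k `*` G k)) => [|k].
  apply/esym/seteqP; split => // x _.
  have [k _ Fk] : (\bigcup_k F k) (g x).1 by rewrite -TF.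
  have [l _ Gl] : (\bigcup_k G k) (g x).2 by rewrite -TG.
  exists (maxn k l) => //; split.
  - by move: Fk; exact/subsetPset/ndF/leq_maxl.
  - by move: Gl; exact/subsetPset/ndG/leq_maxr.
have [mF Fk] := Foo k; have [mG Gk] := Goo k.
split; first by rewrite -[_ @^-1` _]setTI; apply: mg => //; exact: measurableX.
rewrite /lebesgue_cons /pushforward -comp_preimage.
rewrite (_ : g \o _ = id); last by apply/funext => x /=; rewrite gK.
by rewrite preimage_id product_measure1E// lte_mul_pinfty// ge0_fin_numE.
Qed.

HB.instance Definition _ := @Measure_isSigmaFinite.Build _ _ _
  lebesgue_cons lebesgue_cons_sigma_finite.

End step.

Fixpoint lebesgue_rV n : {sigma_finite_measure set 'rV[R]_n -> \bar R} :=
  if n is m.+1 then lebesgue_cons (lebesgue_rV m) else \d_(0 : 'rV[R]_0).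

End lebesgue_rV.
Arguments lebesgue_rV : clear implicits.

Section sobolev.
Context {R : realType} {N : nat}.
Implicit Types (u v g f phi : 'rV[R]_N -> R) (i : 'I_N).

Local Notation mu := (lebesgue_rV R N).

Definition partial i f : 'rV[R]_N -> R := fun x => 'D_(delta_mx ord0 i) f x.

Definition smooth f := forall s : seq 'I_N,
  let h := foldr partial f s in
  continuous h /\ forall i x, derivable h x (delta_mx ord0 i).

Definition test_function phi :=
  smooth phi /\ compact (closure [set x | phi x != 0]).

Definition weak_partial_of i u g := forall phi, test_function phi ->
  (\int[mu]_x (u x * partial i phi x)%:E =
   - \int[mu]_x (g x * phi x)%:E)%E.

(* Elements of H^1 (and of L^p) are represented by Borel functions, to be
   identified when they are equal almost everywhere. *)
Definition H1 u := u \in Lfun mu 2%:E /\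
  forall i, exists g, g \in Lfun mu 2%:E /\ weak_partial_of i u g.

(* A weak partial derivative is unique up to a null set, so that the choice
   made here has no influence on the integrals below. *)
Definition weak_partial i u : 'rV[R]_N -> R :=
  xget (cst 0) [set g | g \in Lfun mu 2%:E /\ weak_partial_of i u g].

Definition sqr_grad u : 'rV[R]_N -> R :=
  fun x => \sum_(i < N) weak_partial i u x ^+ 2.

Definition ae_zero f := \forall x \ae mu, f x = 0.

Definition ae_nonneg f := \forall x \ae mu, 0 <= f x.

(* [`|x|] is the sup norm, which yields the same limits at infinity as the
   Euclidean one. *)
Definition ae_vanishing_at_infinity f := forall e : R, 0 < e ->
  exists r : R, \forall x \ae mu, r <= `|x| -> `|f x| <= e.

(* [J] has derivative [l] at [u] in the direction [v]. *)
Definition has_directional_derivative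
    (J : ('rV[R]_N -> R) -> \bar R) u v (l : R) :=
  let Juv (t : R) := J (fun x => u x + t * v x) in
  (\forall t \near (0 : R), Juv t \is a fin_num) /\
  is_derive (0 : R) (1 : R) (fun t => fine (Juv t)) l.

(* The term [V * u ^+ 2] need not be integrable for [u] in [H^1(R^2)] and [V - c]
   in [L^1(R^2)], whence the values in [\bar R]. *)
Definition energy (p : R) (V W : 'rV[R]_N -> R) u : \bar R :=
  (2^-1%:E * \int[mu]_x (sqr_grad u x + V x * u x ^+ 2)%:E
   - (p + 1)^-1%:E * \int[mu]_x (W x * `|u x| `^ (p + 1))%:E)%E.

Definition nehari (J : ('rV[R]_N -> R) -> \bar R) : set ('rV[R]_N -> R) :=
  [set u | [/\ H1 u, ~ ae_zero u & has_directional_derivative J u u 0]].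

Definition nehari_level (J : ('rV[R]_N -> R) -> \bar R) : \bar R :=
  ereal_inf [set J u | u in nehari J].

Definition I_lambda (p a_infty b_infty : R) (a b : 'rV[R]_N -> R) (lambda : R) :=
  energy p (fun x => a_infty + lambda * a x) (fun x => b_infty + b x).

Definition I_infty (p a_infty b_infty : R) : ('rV[R]_N -> R) -> \bar R :=
  energy p (cst a_infty) (cst b_infty).

End sobolev.
Arguments I_infty {R} N p a_infty b_infty.

(* Main.v *)
(* Projecting a point of a Nehari set with parameter [lambda] on that of a smaller
   parameter lowers its energy, whence [m_lambda >= m_lambda_bar = m_infty].
   Conversely, a point of the Nehari set at infinity can be translated so that [a]
   hardly sees it, because the average over translations of the potential term is
   as small as one likes; hence [m_lambda <= m_infty].

   Let [u] achieve [m_lambda] for some [lambda > lambda_bar].  The projection on the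
   Nehari set of [lambda_bar] gives [m_lambda_bar < m_lambda] unless [a u^2 = 0]
   almost everywhere, so [u] vanishes on a set [Z] of positive measure.  Comparing
   [u] with [sqrt (u^2 + d^2) - d + t phi], [phi >= 0], for [d] and then [t] small,
   shows that [- Delta |u| + a_infty |u| >= 0] in the sense of distributions: the
   weight [b_infty + b] is nonnegative, and the terms in [a] are of order [t^2].  The
   strong maximum principle then gives [u = 0].  For that principle, the averages of
   a nonnegative supersolution [v] against a cut-off heat kernel of width [1 / k]
   increase with [k].  As [v] has an [L^2] gradient and vanishes on [Z], their
   integral over [Z] is [O(1 / k)], so it is zero for every [k], and [v] vanishes
   around almost every point of [Z], at any distance. *)
Require Import Defs.
From HB Require Import structures.
From mathcomp Require Import all_boot all_order all_algebra.
From mathcomp Require Import all_classical all_reals all_analysis.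
From mathcomp Require Import measurable_realfun lebesgue_integral_under ring lra.

Set Implicit Arguments.
Unset Strict Implicit.
Unset Printing Implicit Defensive.

Import Order.TTheory GRing.Theory Num.Theory.
Import numFieldNormedType.Exports.

Local Open Scope classical_set_scope.
Local Open Scope ring_scope.

(** * Lebesgue measure on R^n *)

(** Along a ray the energy is [c^2 A / 2 - c^(p+1) B / (p+1)]. Hence a Nehari set is given by
    [A = B < +oo], and there the energy is a fixed positive multiple of [A]: projections are
    compared through the two numbers [A] and [B] alone.

    No Euler-Lagrange equation is derived for a minimizer. The sign of one linear form is enough,
    and since the competitor lies above the regularised [|u|], the nonlinear term needs only
    monotonicity and a limit in [d]. The regularisation replaces [|u|] because its derivative is
    Lipschitz: the chain rule then follows from difference quotients and the estimate [int (u(x + h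
    e_i) - u(x))^2 <= h^2 int g^2], with [g] the weak derivative. The same estimate yields the
    [O(1 / k)] of the maximum principle.

    In that principle the supersolution may be paired with test functions only, so the Gaussian has
    to be cut off. As a product of functions of one variable its derivatives stay explicit: the
    cut-off costs at most 9 per coordinate in the zero-order term, whatever [k], and a factor
    [exp (- B tau)] absorbs this together with [a_infty]. *)

Section lebesgue_shift.
Context {R : realType}.

Lemma measurable_addr (c : R) : measurable_fun [set: R] (fun x : R => x + c).
Proof. exact: measurable_funD. Qed.

(** Both measures agree on the half-open intervals []a, b]], which determine [lebesgue_measure]. *)
Lemma lebesgue_measure_shift (c : R) (A : set R) : measurable A ->
  pushforward lebesgue_measure ((fun x => x + c) : R -> measurableTypeR R) A
  = lebesgue_measure A.
Proof.
move=> mA; apply/esym.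
pose m := measure_function_pushforward__canonical__measure_function_Measure
  (@lebesgue_measure R) (measurable_addr c : measurable_fun setT ((fun x => x + c) : measurableTypeR R -> measurableTypeR R)).
rewrite (@lebesgue_measure_unique R m)// => _ [[a b]] _ <-.
rewrite /m/= /pushforward.
rewrite (_ : _ @^-1` _ = `]a - c, b - c]%classic); last first.
  by apply/seteqP; split => x /=; rewrite !in_itv/= ltrBlDr lerBrDr.
rewrite !lebesgue_measure_itv/= !lte_fin ltrD2r; case: ifPn => //.
by rewrite !EFinB => _; rewrite -!EFinB; congr (_%:E); ring.
Qed.

Lemma ge0_integral_shift (c : R) (f : R -> \bar R) : measurable_fun setT f ->
  (forall x, 0 <= f x)%E ->
  (\int[lebesgue_measure]_x f (x + c)%R = \int[lebesgue_measure]_x f x)%E.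
Proof.
move=> mf f0.
have mc : measurable_fun setT ((fun x => x + c) : measurableTypeR R -> measurableTypeR R).
  exact: measurable_addr.
have := @ge0_integral_pushforward _ _ _ _ _ _ mc (@lebesgue_measure R) setT f measurableT mf.
move=> H; rewrite -[LHS]H//.
by apply: eq_measure_integral => A mA _; exact: lebesgue_measure_shift.
Qed.

End lebesgue_shift.

Section rV.
Context {R : realType}.
Local Notation mu n := (lebesgue_rV R n).

(** The induction step behind translation invariance and the product bound: [lebesgue_rV n.+1] is
    the image of a product measure, so Tonelli peels off the first coordinate. *)
Lemma ge0_integral_rVS n (f : 'rV[R]_n.+1 -> \bar R) : measurable_fun setT f ->
  (forall x, 0 <= f x)%E ->
  (\int[mu n.+1]_x f x =
   \int[lebesgue_measure]_s \int[mu n]_x f (cons_rV (s, x)))%E.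
Proof.
move=> mf f0.
have := @ge0_integral_pushforward _ _ _ _ _ _ (@measurable_cons_rV R n)
  (@lebesgue_measure R \x mu n)%E setT f measurableT mf.
move=> /(_ (fun x _ => f0 x)) H; rewrite [LHS]H/= preimage_setT.
rewrite fubini_tonelli1//.
by apply: measurableT_comp => //; exact: measurable_cons_rV.
Qed.

Lemma integral_rV0 (f : 'rV[R]_0 -> \bar R) : (\int[mu 0]_x f x = f 0%R)%E.
Proof.
rewrite (_ : f = cst (f 0%R)); last first.
  by apply/funext => x; rewrite (_ : x = 0)//; apply/rowP => -[].
by rewrite integral_cst//= diracT mule1.
Qed.

Local Opaque lebesgue_rV.

Lemma measurable_rV_add n (y : 'rV[R]_n) :
  measurable_fun [set: 'rV[R]_n] (fun x : 'rV[R]_n => x + y).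
Proof.
apply: measurable_fun_coord_rV => i.
rewrite (_ : (fun x => _) = (fun x : 'rV[R]_n => x ord0 i + y ord0 i)); last first.
  by apply/funext => x; rewrite mxE.
by apply: measurable_funD => //; exact: measurable_coord_rV.
Qed.

Lemma ge0_integral_rV_shift n (y : 'rV[R]_n) (f : 'rV[R]_n -> \bar R) :
  measurable_fun setT f -> (forall x, 0 <= f x)%E ->
  (\int[mu n]_x f (x + y)%R = \int[mu n]_x f x)%E.
Proof.
elim: n => [|n IH] in y f *.
  by move=> mf f0; rewrite !integral_rV0; congr f; apply/rowP => -[].
move=> mf f0; rewrite (ge0_integral_rVS mf f0) (@ge0_integral_rVS _ (fun x => f (x + y)) _ (fun x => f0 _)); last first.
  by apply: measurableT_comp => //; exact: measurable_rV_add.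
pose y' : 'rV[R]_n := \row_j y ord0 (lift ord0 j).
have E s x : cons_rV (s, x) + y = cons_rV (s + y ord0 ord0, x + y').
  apply/rowP => i; rewrite mxE; case: (unliftP ord0 i) => [j ->|->].
    by rewrite !cons_rVS !mxE.
  by rewrite !cons_rV0.
have mfc : measurable_fun setT (f \o @cons_rV R n).
  by apply: measurableT_comp => //; exact: measurable_cons_rV.
under eq_integral => s _.
  under eq_integral do rewrite E.
  rewrite (IH y' (fun x => f (cons_rV (s + y ord0 ord0, x))))//; last first.
    by apply: (measurableT_comp mfc); exact: pair1_measurable.
  over.
apply: (@ge0_integral_shift R (y ord0 ord0) (fun s => \int[mu n]_x f (cons_rV (s, x)))%E).
  exact: (@measurable_fun_fubini_tonelli_F _ _ _ _ R (mu n) _ mfc (fun x => f0 _)).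
by move=> s; exact: integral_ge0.
Qed.

(** Upper bounds suffice for both uses: indicators of intervals, for the finite measure of cubes,
    and Gaussians, in the strong maximum principle. *)
Lemma integral_rV_prod_le n (f : 'I_n -> R -> R) (c : 'I_n -> R) :
  (forall i, measurable_fun setT (f i)) -> (forall i x, 0 <= f i x) ->
  (forall i, (\int[lebesgue_measure]_x (f i x)%:E <= (c i)%:E)%E) ->
  (\int[mu n]_x (\prod_i f i (x ord0 i))%:E <= (\prod_i c i)%:E)%E.
Proof.
elim: n => [|n IH] in f c *.
  by move=> mf f0 fc; rewrite integral_rV0 !big_ord0.
move=> mf f0 fc.
rewrite (@ge0_integral_rVS _ (fun x => (\prod_i f i (x ord0 i))%:E)); last 2 first.
- apply/measurable_EFinP.
  under eq_fun do rewrite -[\prod_i _]/(\prod_(i <- index_enum 'I_n.+1) _).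
  apply: measurable_prod => i _; apply: measurableT_comp => //; exact: measurable_coord_rV.
- by move=> x; rewrite lee_fin prodr_ge0.
rewrite big_ord_recl.
apply: (@le_trans _ _ (\int[lebesgue_measure]_s ((f ord0 s)%:E * (\prod_(i < n) c (lift ord0 i))%:E))%E).
  apply: ge0_le_integral => //.
  - by move=> s _; apply: integral_ge0 => x _; rewrite lee_fin prodr_ge0.
  - apply: (@measurable_fun_fubini_tonelli_F _ _ _ _ R (mu n)
      (fun x => (\prod_i f i (cons_rV x ord0 i))%:E)); last first.
      by move=> x; rewrite lee_fin prodr_ge0.
    apply/measurable_EFinP; apply: measurable_prod => i _.
    apply: (measurableT_comp (mf i)).
    by apply: (measurableT_comp (measurable_coord_rV i)); exact: measurable_cons_rV.
  - rewrite [X in measurable_fun _ X](_ : _ = EFin \o (fun x => f ord0 x * \prod_(i < n) c (lift ord0 i)))//.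
    by apply/measurable_EFinP; apply: measurable_funM; [exact: mf|exact: measurable_cst].
  move=> s _.
  under eq_integral => x _.
    rewrite big_ord_recl cons_rV0 EFinM/=.
    under eq_bigr do rewrite cons_rVS/=.
    over.
  rewrite ge0_integralZl//; last 3 first.
  - apply/measurable_EFinP; apply: measurable_prod => i _.
    by apply: (measurableT_comp (mf _)); exact: measurable_coord_rV.
  - by move=> x _; rewrite lee_fin prodr_ge0.
  - by rewrite lee_fin.
  by rewrite lee_wpmul2l ?lee_fin//; exact: (IH (fun i => f (lift ord0 i)) (fun i => c (lift ord0 i))).
have c0 i : 0 <= c i.
  by rewrite -lee_fin (le_trans _ (fc i))//; apply: integral_ge0 => x _; rewrite lee_fin.
rewrite ge0_integralZr//; last 3 first.
- by apply/measurable_EFinP; exact: mf.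
- by move=> x _; rewrite lee_fin.
- by rewrite lee_fin prodr_ge0.
by rewrite EFinM lee_wpmul2r// lee_fin prodr_ge0.
Qed.

(** For [0 <= M] this is a closed ball of the sup norm ([cube_norm]). The coordinatewise form writes
    its indicator as a product, to which [integral_rV_prod_le] applies. *)
Definition cube n (M : R) : set 'rV[R]_n := [set x | forall i, `|x ord0 i| <= M].

Lemma measurable_cube n M : measurable (@cube n M).
Proof.
rewrite (_ : @cube n M = \bigcap_(i in [set: 'I_n]) ((fun x : 'rV[R]_n => x ord0 i) @^-1` `[- M, M]%classic)); last first.
  apply/seteqP; split => [x Hx i _/=|x Hx i].
    by rewrite in_itv/= -ler_norml.
  by have /= := Hx i I; rewrite in_itv/= -ler_norml.
apply: fin_bigcap_measurable => // i _; rewrite -[X in measurable X]setTI.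
by apply: measurable_coord_rV => //; exact: measurable_itv.
Qed.

Lemma cube_finite n M : (mu n (@cube n M) < +oo)%E.
Proof.
pose f : R -> R := \1_(`[- M, M]%classic).
have E : (\1_(@cube n M) : 'rV[R]_n -> R) = fun x => \prod_i f (x ord0 i).
  apply/funext => x; rewrite indicE; case: (boolP (x \in @cube n M)) => [|/negP H].
    rewrite inE => H; rewrite big1// => i _; rewrite /f indicE mem_set//=.
    by rewrite in_itv/= -ler_norml.
  have [i Hi] : exists i, ~ `|x ord0 i| <= M.
    by apply: contra_notP H => /forallNP H; rewrite inE => i; apply: contrapT.
  rewrite (bigD1 i)//= {1}/f indicE memNset ?mul0r//=.
  by rewrite in_itv/= -ler_norml.
rewrite -[X in mu n X]setIT -(integral_indic (mu n) measurableT (@measurable_cube n M)).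
under eq_integral do rewrite E.
pose c : R := fine (@lebesgue_measure R `[- M, M]%classic).
apply: (@le_lt_trans _ _ (\prod_(i < n) c)%:E); last exact: ltry.
apply: (@integral_rV_prod_le _ (fun=> f) (fun=> c)) => [i|i x|i].
- exact: measurable_indic.
- by rewrite /f indicE.
rewrite integral_indic// setIT fineK// lebesgue_measure_itv/=.
by case: ifPn.
Qed.

Lemma cubeT n : \bigcup_k @cube n k%:R = setT.
Proof.
apply/seteqP; split => // x _.
exists (Num.truncn (\sum_i `|x ord0 i|)).+1 => //= i.
apply: (@le_trans _ _ (\sum_i `|x ord0 i|)).
  by rewrite (bigD1 i)//= lerDl sumr_ge0.
by rewrite ltW// truncnS_gt// sumr_ge0.
Qed.

(** The measurable sets are generated by the coordinates, so an open set has to be exhibited as a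
    countable union of boxes: those with rational centre and radius [1 / (k + 1)] that it
    contains. *)
Lemma open_measurable_rV n (U : set 'rV[R]_n) : open U -> measurable U.
Proof.
move=> oU.
pose Q (z : 'rV[rat]_n * nat) : set 'rV[R]_n :=
  [set x | forall i, `|x ord0 i - ratr (z.1 ord0 i)| < z.2.+1%:R^-1].
have mQ z : measurable (Q z).
  rewrite (_ : Q z = \bigcap_(i in [set: 'I_n])
    ((fun x : 'rV[R]_n => x ord0 i) @^-1` (ball (ratr (z.1 ord0 i) : R) z.2.+1%:R^-1))); last first.
    apply/seteqP; split => [x Hx i _/=|x Hx i]; first by rewrite /ball/= distrC.
    by have := Hx i I; rewrite /= /ball/= distrC.
  apply: fin_bigcap_measurable => // i _; rewrite -[X in measurable X]setTI.
  apply: measurable_coord_rV => //; exact: measurable_ball.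
have -> : U = \bigcup_z (if `[< Q z `<=` U >] then Q z else set0).
  apply/seteqP; split => [x Ux|x [z _]]; last by case: ifPn => // /asboolP; apply.
  have : nbhs x U by exact: open_nbhs_nbhs.
  move=> /nbhs_ballP[e /= e0 eU].
  (* The factor 2: points of the box are compared with [x] through its rational centre. *)
  have [k ke] : exists k, 2 * k.+1%:R^-1 < e.
    exists (Num.truncn (2 / e)).
    by rewrite ltr_pdivrMr// mulrC -ltr_pdivrMr// truncnS_gt// divr_ge0// ltW.
  have H i : exists q : rat, `|x ord0 i - ratr q| < k.+1%:R^-1.
    have [q] := rat_in_itvoo (x := x ord0 i - k.+1%:R^-1) (y := x ord0 i + k.+1%:R^-1) ltac:(by rewrite ltrD2l gtrN ?invr_gt0).
    rewrite in_itv/= => /andP[q1 q2]; exists q; by rewrite distrC ltr_norml ltrBlDl q2 ltrBrDl q1.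
  have [q Hq] := choice H.
  have Qx : Q (\row_i q i, k) x by move=> i /=; rewrite mxE; exact: Hq.
  exists (\row_i q i, k) => //; case: ifPn => // /asboolP; case => y Qy.
  apply: eU; split => // i j; rewrite ord1 /ball/=.
  have := Qx j; have := Qy j; rewrite /= mxE => H1 H2.
  apply: lt_trans ke; rewrite mulrDl mul1r.
  rewrite -(subrK (ratr (q j)) (x ord0 j)) -addrA.
  rewrite (le_lt_trans (ler_normD _ _))//.
  by rewrite ltrD// distrC.
by apply: countable_bigcupT_measurable => // z; case: ifPn.
Qed.

Lemma continuous_measurable_rV n (f : 'rV[R]_n -> R) : continuous f ->
  measurable_fun setT f.
Proof.
move=> cf; apply: (measurability _ (RGenOpens.measurableE R)).
move=> _ [_ [a [b ->] <-]]; apply: measurableI => //; apply: open_measurable_rV.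
by apply: open_comp => // x _; exact: cf.
Qed.

Lemma pushforward_rV_shift n (y : 'rV[R]_n) A : measurable A ->
  mu n ((fun x => x + y) @^-1` A) = mu n A.
Proof.
move=> mA.
rewrite -[X in mu n X = _]setIT -[in RHS](setIT A).
rewrite -!integral_indic//; last first.
  by rewrite -[X in measurable X]setTI; apply: measurable_rV_add.
rewrite -(@ge0_integral_rV_shift _ y (fun x => (\1_A x)%:E))//.
by apply/measurable_EFinP; exact: measurable_indic.
Qed.

Lemma ae_shift n (y : 'rV[R]_n) (P : 'rV[R]_n -> Prop) :
  (\forall x \ae mu n, P x) -> \forall x \ae mu n, P (x + y).
Proof.
move=> [A [mA A0 PA]]; exists ((fun x => x + y) @^-1` A); split.
- by rewrite -[X in measurable X]setTI; apply: measurable_rV_add.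
- by rewrite pushforward_rV_shift.
- by move=> x /= nP; apply: PA.
Qed.

Lemma integrable_shift n (y : 'rV[R]_n) (f : 'rV[R]_n -> R) :
  (mu n).-integrable setT (EFin \o f) ->
  (mu n).-integrable setT (EFin \o (fun x => f (x + y))).
Proof.
move=> /integrableP[mf fi]; apply/integrableP; split.
  by apply: measurableT_comp mf _; exact: measurable_rV_add.
rewrite (@ge0_integral_rV_shift _ y (fun x => `|(f x)%:E|%E))//.
exact: measurableT_comp.
Qed.

Lemma integral_shift n (y : 'rV[R]_n) (f : 'rV[R]_n -> R) :
  measurable_fun setT f ->
  (\int[mu n]_x (f (x + y))%:E = \int[mu n]_x (f x)%:E)%E.
Proof.
move=> mf; rewrite integralE [RHS]integralE.
have mfE : measurable_fun setT (EFin \o f) by apply/measurable_EFinP.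
have H1 := @ge0_integral_rV_shift _ y _ (measurable_funepos mfE) (funepos_ge0 _).
have H2 := @ge0_integral_rV_shift _ y _ (measurable_funeneg mfE) (funeneg_ge0 _).
by congr (_ - _)%E; [rewrite -[RHS]H1|rewrite -[RHS]H2]; apply: eq_integral => x _; rewrite ?funeposE ?funenegE.
Qed.

End rV.

(** * Smooth functions with compact support *)

Section smooth1.
Context {R : realType}.
Implicit Types (f g : R -> R).

(** Derivatives are given as witnesses instead of by iterating [derive1], so that closure under
    sums, products and composition is a plain induction on [n]. *)
Fixpoint n_derivable n f : Prop := if n is m.+1 then
  exists f' : R -> R, (forall x : R, is_derive x (1 : R) f (f' x)) /\ n_derivable m f'
  else True.

Definition smooth1 f := forall n, n_derivable n f.

Lemma n_derivable_ext n f g : f =1 g -> n_derivable n f -> n_derivable n g.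
Proof. by move=> /funext ->. Qed.

Lemma n_derivableW n f : n_derivable n.+1 f -> n_derivable n f.
Proof.
elim: n f => // n IH f [f' [Df Hf']]; exists f'; split => //; exact: IH.
Qed.

Lemma is_derive1_fun f f' : (forall x : R, is_derive x (1 : R) f (f' x)) -> derive1 f = f'.
Proof. by move=> H; apply/funext => x; rewrite derive1E; exact: (@derive_val _ _ _ _ _ _ _ (H x)). Qed.

Lemma smooth1_derive f : smooth1 f -> smooth1 (derive1 f).
Proof. by move=> sf n; have [f' [Df nf']] := sf n.+1; rewrite (is_derive1_fun Df). Qed.

Lemma smooth1_is_derive f (x : R) : smooth1 f -> is_derive x (1 : R) f (derive1 f x).
Proof. by move=> sf; have [f' [Df _]] := sf 1%N; rewrite (is_derive1_fun Df). Qed.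

Lemma is_derive_continuous f (df : R -> R) :
  (forall x : R, is_derive x (1 : R) f (df x)) -> continuous f.
Proof.
move=> Df x; apply/differentiable_continuous/derivable1_diffP.
exact: (@ex_derive _ _ _ _ _ _ _ (Df x)).
Qed.

Lemma smooth1_continuous f : smooth1 f -> continuous f.
Proof. by move=> sf; have [f' [Df _]] := sf 1%N; exact: is_derive_continuous Df. Qed.

Lemma n_derivable_cst n c : n_derivable n (cst c).
Proof.
elim: n c => // n IH c; exists (cst 0); split => // x; exact: is_derive_cst.
Qed.

Lemma n_derivableD n f g : n_derivable n f -> n_derivable n g ->
  n_derivable n (fun x => f x + g x).
Proof.
elim: n f g => // n IH f g [f' [Df nf]] [g' [Dg ng]].
exists (fun x => f' x + g' x); split; last exact: IH.
by move=> x; have := Df x; have := Dg x => ? ?; exact: is_deriveD.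
Qed.

Lemma n_derivableM n f g : n_derivable n f -> n_derivable n g ->
  n_derivable n (fun x => f x * g x).
Proof.
elim: n f g => // n IH f g nf1 ng1.
have nf0 := n_derivableW nf1; have ng0 := n_derivableW ng1.
case: nf1 => f' [Df nf]; case: ng1 => g' [Dg ng].
exists (fun x => f x * g' x + g x * f' x); split.
  by move=> x; have := Df x; have := Dg x => ? ?; exact: is_deriveM.
by apply: n_derivableD; exact: IH.
Qed.

Lemma n_derivable_comp_affine n f c d : n_derivable n f ->
  n_derivable n (fun x => f (c * x + d)).
Proof.
elim: n f => // n IH f [f' [Df nf]].
exists (fun x => f' (c * x + d) * c); split; last first.
  by apply: n_derivableM; [exact: IH|exact: n_derivable_cst].
move=> x; apply: (@is_derive1_comp _ f (fun x => c * x + d)).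
have -> : (fun x => c * x + d) = (c \*: id + cst d) by [].
by apply: is_derive_eq; rewrite /GRing.scale/= mulr1 addr0.
Qed.

Lemma n_derivable_id n : n_derivable n (@id R).
Proof.
case: n => // n; exists (cst 1); split => [x|]; first exact: is_derive_id.
exact: n_derivable_cst.
Qed.

Lemma n_derivable_expR n f : n_derivable n f -> n_derivable n (expR \o f).
Proof.
elim: n f => // n IH f nf1; have nf0 := n_derivableW nf1.
case: nf1 => f' [Df nf]; exists (fun x => expR (f x) * f' x); split.
  by move=> x; have := Df x => ?; exact: is_derive1_comp.
by apply: n_derivableM => //; exact: IH.
Qed.

(* [flat 0] is the standard smooth function that is flat at the origin; the
   family is closed under differentiation up to linear combinations. *)
Definition flat k (t : R) : R := if 0 < t then t^-1 ^+ k * expR (- t^-1) else 0.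

Lemma flat_ge0 k t : 0 <= flat k t.
Proof.
by rewrite /flat; case: ifPn => // t0; rewrite mulr_ge0 ?expR_ge0// exprn_ge0// invr_ge0 ltW.
Qed.

Lemma flat_gt0 k t : 0 < t -> 0 < flat k t.
Proof. by move=> t0; rewrite /flat t0 mulr_gt0 ?expR_gt0// exprn_gt0// invr_gt0. Qed.

Lemma flat_le0 k t : t <= 0 -> flat k t = 0.
Proof. by rewrite /flat leNgt => /negbTE ->. Qed.

Lemma flat0_le1 t : flat 0 t <= 1.
Proof.
rewrite /flat; case: ifPn => // t0.
by rewrite expr0 mul1r -expR0 ler_expR oppr_le0 invr_ge0 ltW.
Qed.

(** [expR t^-1] dominates the term of order [k + 2] of its series. A bound by [t ^ 2] is what makes
    the difference quotient of [flat k] at 0 tend to 0. *)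
Lemma flat_le_sqr k t : 0 <= t -> flat k t <= k.+2`!%:R * t ^+ 2.
Proof.
rewrite le_eqVlt => /predU1P[<-|t0]; first by rewrite flat_le0// expr0n mulr0.
rewrite /flat t0 expRN ler_pdivrMr ?expR_gt0//.
have := @expR_ge1Dxn R t^-1 k.+1; rewrite invr_ge0 (ltW t0) => /(_ isT) H.
have {}H : t^-1 ^+ k.+2 <= k.+2`!%:R * expR t^-1.
  rewrite mulrC -ler_pdivrMr ?ltr0n ?fact_gt0//.
  by apply: le_trans H; rewrite lerDr.
have -> : t^-1 ^+ k = t ^+ 2 * t^-1 ^+ k.+2.
  have t2 : t ^+ 2 * t^-1 ^+ 2 = 1 by rewrite exprVn mulfV// expf_neq0// gt_eqF.
  have -> : t^-1 ^+ k.+2 = t^-1 ^+ 2 * t^-1 ^+ k by rewrite -exprD.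
  by rewrite mulrA t2 mul1r.
by rewrite -[leRHS]mulrA [leRHS]mulrCA ler_pM2l// exprn_gt0.
Qed.

(** The product rule for [t > 0], a locally zero function for [t < 0], and [flat_le_sqr] at the
    origin, where the right-hand side is 0 as well. *)
Lemma is_derive_flat k (t : R) : is_derive t (1 : R) (flat k) (- k%:R * flat k.+1 t + flat k.+2 t).
Proof.
have [t0|t0|<-] := ltgtP 0 t.
- have ti : is_derive t (1 : R) (fun x : R => x^-1) (- t ^- 2).
    have := @is_deriveV R id t 1 1 (lt0r_neq0 t0) _.
    by rewrite /GRing.scale/= mulr1; apply; exact: is_derive_id.
  pose g : R -> R := ((fun x : R => x^-1) ^+ k) * (expR \o (- (fun x : R => x^-1))).
  have Dg : is_derive t (1 : R) g (- k%:R * flat k.+1 t + flat k.+2 t).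
    apply: is_derive_eq; rewrite /flat t0 /GRing.scale/= !fctE.
    case: k {g} => [|k]; rewrite ?expr0 ?mul0r ?mulr0 ?addr0 ?add0r.
      by rewrite mul1r -exprVn; ring.
    by rewrite /= -!exprVn !exprS; ring.
  apply: (@near_eq_is_derive R R R g) => //; near=> x.
  rewrite /g/= /flat ifT; last by near: x; exact: lt_nbhsr.
  by rewrite /= !fctE.
- rewrite !flat_le0 ?ltW// mulr0 addr0.
  have D0 : is_derive t (1 : R) (cst 0) (0 : R) by exact: is_derive_cst.
  apply: (@near_eq_is_derive R R R (cst 0)) => //.
  near=> x; rewrite flat_le0//; apply: ltW; near: x; exact: lt_nbhsl.
rewrite !flat_le0// mulr0 addr0.
suff H : (fun h : R => h^-1 *: (flat k (h *: 1 + 0) - flat k 0)) @ 0^' --> (0 : R).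
  by apply: DeriveDef; [apply/cvg_ex; exists 0|exact: cvg_lim].
apply/cvgrPdist_le => e e0.
near=> h; rewrite /GRing.scale/= mulr1 addr0 (flat_le0 _ (lexx 0)) subr0 sub0r normrN normrM normfV.
have h0 : h != 0 by near: h; exact: nbhs_dnbhs_neq.
rewrite ler_pdivrMl ?normr_gt0//.
have [hn|hp] := leP h 0; first by rewrite flat_le0// normr0 mulr_ge0 // ltW.
rewrite ger0_norm ?flat_ge0// (le_trans (flat_le_sqr _ (ltW hp)))//.
rewrite (gtr0_norm hp) expr2 mulrA mulrC ler_wpM2l ?(ltW hp)//.
rewrite -ler_pdivlMl ?ltr0n ?fact_gt0//.
rewrite -(gtr0_norm hp); near: h.
apply: dnbhs0_le; rewrite mulr_gt0// invr_gt0 ltr0n fact_gt0//.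
Unshelve. all: by end_near. Qed.

Lemma n_derivable_flat n k : n_derivable n (flat k).
Proof.
elim: n k => // n IH k.
exists (fun t => - k%:R * flat k.+1 t + flat k.+2 t); split.
  by move=> x; exact: is_derive_flat.
apply: n_derivableD; last exact: IH.
by apply: n_derivableM; [exact: n_derivable_cst|exact: IH].
Qed.

End smooth1.

(** * Products of functions of one variable *)

Section product_functions.
Context {R : realType} {N : nat}.
Implicit Types (h : 'I_N -> R -> R).

(** The basic test functions, bumps and cut-off Gaussians, have this form: a partial derivative
    changes a single factor, so smoothness and Laplacians are computed in one variable. *)
Definition prodf h : 'rV[R]_N -> R := fun x => \prod_i h i (x ord0 i).

Definition subst_fun h j (g : R -> R) : 'I_N -> R -> R :=
  fun i => if i == j then g else h i.

Lemma continuous_prodf h : (forall i, continuous (h i)) -> continuous (prodf h).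
Proof.
move=> ch; rewrite /prodf.
have : forall s : seq 'I_N, continuous (fun x : 'rV[R]_N => \prod_(i <- s) h i (x ord0 i)).
  elim=> [|i s IH] x.
    rewrite (_ : (fun x : 'rV[R]_N => _) = cst 1); first exact: cst_continuous.
    by apply/funext => y; rewrite big_nil.
  rewrite (_ : (fun x : 'rV[R]_N => _) = (fun x : 'rV[R]_N => h i (x ord0 i)) *
     (fun x : 'rV[R]_N => \prod_(i <- s) h i (x ord0 i))); last first.
    by apply/funext => y; rewrite big_cons.
  apply: continuousM; last exact: IH.
  apply: (@continuous_comp _ _ _ (fun x : 'rV[R]_N => x ord0 i) (h i) x).
    exact: coord_continuous.
  exact: ch.
exact.
Qed.

Lemma prodf_line h j (t : R) x :
  prodf h (t *: delta_mx ord0 j + x) =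
  h j (t + x ord0 j) * \prod_(i | i != j) h i (x ord0 i).
Proof.
rewrite /prodf (bigD1 j)//= !mxE !eqxx mulr1; congr (_ * _).
by apply: eq_bigr => i ij; rewrite !mxE eqxx/= (negbTE ij) mulr0 add0r.
Qed.

Lemma prodf_subst h j g x :
  prodf (subst_fun h j g) x = g (x ord0 j) * \prod_(i | i != j) h i (x ord0 i).
Proof.
rewrite /prodf (bigD1 j)//= /subst_fun eqxx; congr (_ * _).
by apply: eq_bigr => i /negbTE ->.
Qed.

Lemma prodfD1 h j x :
  prodf h x = h j (x ord0 j) * \prod_(i | i != j) h i (x ord0 i).
Proof. by rewrite /prodf (bigD1 j). Qed.

Lemma is_derive_prodf h j g x : (forall t : R, is_derive t (1 : R) (h j) (g t)) ->
  is_derive x (delta_mx ord0 j) (prodf h) (prodf (subst_fun h j g) x).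
Proof.
move=> Dh; pose C := \prod_(i | i != j) h i (x ord0 i).
have [dh hE] := Dh (x ord0 j).
have H : (fun t : R => t^-1 *: ((prodf h) (t *: delta_mx ord0 j + x) - prodf h x)) @ 0^'
    --> (prodf (subst_fun h j g) x : R).
  rewrite prodf_subst -/C.
  have -> : (fun t : R => t^-1 *: ((prodf h) (t *: delta_mx ord0 j + x) - prodf h x)) =
     (fun t : R => t^-1 *: (h j (t *: 1 + x ord0 j) - h j (x ord0 j)) * C).
    apply/funext => t; rewrite prodf_line (prodfD1 _ j) -/C -mulrBl.
    by rewrite /GRing.scale/= mulr1 mulrA.
  by apply: cvgMl; rewrite -hE; exact: dh.
by apply: DeriveDef; [apply/cvg_ex; eexists; exact: H|exact: cvg_lim].
Qed.

Lemma partial_prodf h j : (forall t : R, derivable (h j) t (1 : R)) ->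
  partial j (prodf h) = prodf (subst_fun h j (derive1 (h j))).
Proof.
move=> Dh; apply/funext => x; rewrite /partial.
apply: (@derive_val _ _ _ _ _ _ _ (@is_derive_prodf h j _ x _)) => t.
by rewrite derive1E; exact: derivableP.
Qed.

Lemma smooth_prodf h : (forall i, smooth1 (h i)) -> smooth (prodf h).
Proof.
move=> sh s.
(* Iterated partial derivatives of a product of smooth functions are again such products; this form
   survives the induction on [s]. *)
suff [h' [sh' ->]] : exists h', (forall i, smooth1 (h' i)) /\ foldr partial (prodf h) s = prodf h'.
  split; first by apply: continuous_prodf => i; exact: smooth1_continuous.
  move=> i x; apply: (@ex_derive _ _ _ _ _ _ _ (@is_derive_prodf h' i _ x _)) => t.
  exact: smooth1_is_derive.
elim: s => [|j s [h' [sh' IH]]] /=; first by exists h.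
rewrite IH partial_prodf; last first.
  by move=> t; exact: (@ex_derive _ _ _ _ _ _ _ (smooth1_is_derive t (sh' j))).
exists (subst_fun h' j (derive1 (h' j))); split => // i; rewrite /subst_fun.
by case: ifPn => // _; exact: smooth1_derive.
Qed.

Lemma closed_cube M : closed (@cube R N M).
Proof.
rewrite (_ : cube M = \bigcap_(i in [set: 'I_N])
    ((fun x : 'rV[R]_N => x ord0 i) @^-1` `[- M, M]%classic)); last first.
  apply/seteqP; split => [x Hx i _/=|x Hx i].
    by rewrite in_itv/= -ler_norml.
  by have /= := Hx i I; rewrite in_itv/= -ler_norml.
apply: closed_bigI => i _; apply: closed_comp => //; last exact: interval_closed.
by move=> x _; exact: coord_continuous.
Qed.

Lemma cube_norm M (x : 'rV[R]_N) : 0 <= M -> cube M x <-> `|x| <= M.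
Proof.
move=> M0; split => [Mx|xM i].
  rewrite [leLHS]/Num.Def.normr/= mx_normrE; apply/bigmax_leP; split => // -[i j] _ /=.
  by rewrite ord1.
apply: le_trans xM; rewrite [leRHS]/Num.Def.normr/= mx_normrE.
by apply/bigmax_geP; right => /=; exists (ord0, i).
Qed.

Lemma compact_closure_cube (A : set 'rV[R]_N) M : 0 <= M -> A `<=` cube M ->
  compact (closure A).
Proof.
move=> M0 AM; apply: bounded_closed_compact; last exact: closed_closure.
have AM' : closure A `<=` @cube R N M.
  by move: (@closed_cube M) => /closure_id ->; exact: closure_subset.
exists M; split; first exact: num_real.
by move=> y My x /AM' /(cube_norm _ M0) H; apply: le_trans H (ltW My).
Qed.

Lemma test_prodf h M : (forall i, smooth1 (h i)) ->
  (forall i t, M < `|t| -> h i t = 0) -> test_function (prodf h).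
Proof.
move=> sh hM; split; first exact: smooth_prodf.
apply: (@compact_closure_cube _ `|M|); first exact: normr_ge0.
move=> x /= /eqP hx i; rewrite leNgt; apply/negP => Mx; apply: hx.
by rewrite (prodfD1 _ i) hM ?mul0r// (le_lt_trans (ler_norm M)).
Qed.

End product_functions.

(** * The fundamental lemma of the calculus of variations *)

Section fundamental_lemma.
Context {R : realType} {N : nat}.
Local Notation mu := (lebesgue_rV R N).

Definition open_box (a b : 'I_N -> R) : set 'rV[R]_N :=
  [set x | forall i, a i < x ord0 i < b i].

Let boxes : set (set 'rV[R]_N) := [set open_box z.1 z.2 | z in setT].

Let box_in a b : boxes (open_box a b).
Proof. by exists (a, b). Qed.

Lemma measurable_open_box a b : measurable (open_box a b).
Proof.
rewrite (_ : open_box a b = \bigcap_(i in [set: 'I_N])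
    ((fun x : 'rV[R]_N => x ord0 i) @^-1` `]a i, b i[%classic)); last first.
  apply/seteqP; split => [x Hx i _/=|x Hx i].
    by rewrite in_itv/=; exact: Hx.
  by have /= := Hx i I; rewrite in_itv/=.
apply: fin_bigcap_measurable => // i _; rewrite -[X in measurable X]setTI.
by apply: measurable_coord_rV => //; exact: measurable_itv.
Qed.

Lemma open_boxI a b a' b' : open_box a b `&` open_box a' b' =
  open_box (fun i => Num.max (a i) (a' i)) (fun i => Num.min (b i) (b' i)).
Proof.
apply/seteqP; split => [x [H1 H2] i|x H].
  by rewrite gt_max lt_min; have /andP[-> ->] := H1 i; have /andP[-> ->] := H2 i.
by split => i; have := H i; rewrite gt_max lt_min -!andbA => /and4P[? ? ? ?]; apply/andP.
Qed.

Lemma open_box_bigcup (i : 'I_N) (a b : R) :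
  (fun x : 'rV[R]_N => x ord0 i) @^-1` `]a, b[%classic =
  \bigcup_k open_box (fun j => if j == i then a else - k%:R) (fun j => if j == i then b else k%:R).
Proof.
apply/seteqP; split => [x /=|x [k _ /(_ i)]]; last first.
  by rewrite eqxx/= in_itv.
rewrite in_itv/= => Hx.
exists (Num.truncn (\sum_j `|x ord0 j|)).+1 => //= j; case: ifPn => [/eqP->//|_].
rewrite -ltr_norml (@le_lt_trans _ _ (\sum_j `|x ord0 j|))//.
  by rewrite (bigD1 j)//= lerDl sumr_ge0.
by rewrite truncnS_gt// sumr_ge0.
Qed.

(** Open boxes are stable under intersection; that they also generate the sigma-algebra makes
    Dynkin's theorem available in [ae_zero_of_test]. *)
Lemma measurable_rVE : @measurable _ 'rV[R]_N = <<s boxes >>.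
Proof.
apply/seteqP; split => A; last first.
  move: A; apply: smallest_sub; first exact: sigma_algebra_measurable.
  by move=> _ [z _ <-]; exact: measurable_open_box.
move: A; apply: smallest_sub; first exact: smallest_sigma_algebra.
rewrite -bigcup_seq/= => B [i _ [C mC <-]]; rewrite setTI.
have mi : measurable_fun [set: g_sigma_algebraType boxes]
    (fun x : g_sigma_algebraType boxes => (x : 'rV[R]_N) ord0 i).
  apply: (measurability _ (RGenOpens.measurableE R)).
  move=> _ [_ [a [b ->] <-]]; rewrite setTI open_box_bigcup.
  by apply: bigcupT_measurable => k; apply: sub_sigma_algebra; exact: box_in.
by have := mi measurableT _ mC; rewrite setTI.
Qed.

(** It vanishes off []a, b[] and converges there to 1 as [k] grows, because [flat 0] tends to 1 at
    infinity. *)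
Let bump (a b : R) k (t : R) : R :=
  flat 0 (k.+1%:R * t + - (k.+1%:R * a)) * flat 0 (- k.+1%:R * t + k.+1%:R * b).

Let smooth_bump a b k : smooth1 (bump a b k).
Proof.
move=> n; apply: n_derivableM.
  exact: (n_derivable_comp_affine _ _ (@n_derivable_flat R n 0)).
exact: (n_derivable_comp_affine _ _ (@n_derivable_flat R n 0)).
Qed.

Let bump_le1 a b k t : 0 <= bump a b k t <= 1.
Proof.
rewrite /bump mulr_ge0 ?flat_ge0//= -[leRHS]mulr1.
by rewrite ler_pM ?flat_ge0 ?flat0_le1.
Qed.

Let bump0 a b k t : ~~ (a < t < b) -> bump a b k t = 0.
Proof.
rewrite negb_and -!leNgt => /orP[ta|bt]; rewrite /bump.
  by rewrite flat_le0 ?mul0r// -mulrBr pmulr_rle0// subr_le0.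
by rewrite [X in _ * X]flat_le0 ?mulr0// mulNr addrC -mulrBr pmulr_rle0// subr_le0.
Qed.

Let cvg_flat (c : R) : 0 < c -> flat 0 (k.+1%:R * c) @[k --> \oo] --> (1 : R).
Proof.
move=> c0.
rewrite (_ : (fun k : nat => _) = expR \o (fun k => k.+1%:R^-1 * - c^-1)); last first.
  apply/funext => k /=; rewrite /flat mulr_gt0// expr0 mul1r invfM.
  by rewrite mulrN.
rewrite -[X in _ --> X](@expR0 R); apply: continuous_cvg; first exact: continuous_expR.
rewrite -[X in _ --> X](mul0r (- c^-1)); apply: cvgMl.
exact: cvg_harmonic.
Qed.

Let cvg_bump a b t : bump a b k t @[k --> \oo] --> (\1_(`]a, b[%classic) t : R).
Proof.
rewrite indicE mem_setE in_itv/=; case: (boolP (a < t < b)) => [/andP[ta tb]|H]; last first.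
  by under eq_fun do rewrite bump0//; exact: cvg_cst.
rewrite -[X in _ --> X](mulr1 1).
rewrite (_ : (fun k => _) = (fun k => flat 0 (k.+1%:R * (t - a))) * (fun k => flat 0 (k.+1%:R * (b - t)))).
  by apply: cvgM; apply: cvg_flat; rewrite subr_gt0.
apply/funext => k; rewrite /bump !fctE; congr (flat _ _ * flat _ _).
  by rewrite mulrBr.
by rewrite mulrBr mulNr addrC.
Qed.

Let cvg_prod (I : Type) (s : seq I) (u : I -> nat -> R) (l : I -> R) :
  (forall i, u i k @[k --> \oo] --> l i) ->
  \prod_(i <- s) u i k @[k --> \oo] --> \prod_(i <- s) l i.
Proof.
move=> ul; elim: s => [|i s IH].
  by rewrite big_nil; under eq_fun do rewrite big_nil; exact: cvg_cst.
rewrite big_cons; under eq_fun do rewrite big_cons.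
by apply: cvgM.
Qed.

Variable f : 'rV[R]_N -> R.
Hypothesis mf : measurable_fun setT f.
Hypothesis intf : forall k : nat, mu.-integrable (cube k%:R) (EFin \o f).
Hypothesis f0 : forall phi, test_function phi -> (\int[mu]_x (f x * phi x)%:E = 0)%E.

Let indic_open_box a b (x : 'rV[R]_N) :
  \prod_i \1_(`]a i, b i[%classic) (x ord0 i) = \1_(open_box a b) x :> R.
Proof.
rewrite [RHS]indicE; case: (boolP (x \in open_box a b)) => [|/negP H].
  rewrite inE => H; rewrite big1// => i _; rewrite indicE mem_set//=.
  by rewrite in_itv/=; exact: H.
have [i Hi] : exists i, ~ (a i < x ord0 i < b i).
  by apply: contra_notP H => /forallNP H; rewrite inE => i; apply: contrapT.
by rewrite (bigD1 i)//= indicE memNset ?mul0r//= in_itv.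
Qed.

Lemma box_bound (a b : 'I_N -> R) : exists k : nat, forall i t, a i < t < b i -> `|t| <= k%:R.
Proof.
exists (Num.truncn (\sum_i (`|a i| + `|b i|))).+1 => i t /andP[ta tb].
apply: (@le_trans _ _ (\sum_i (`|a i| + `|b i|))).
  rewrite (bigD1 i)//= (@le_trans _ _ (`|a i| + `|b i|))//; last first.
    by rewrite lerDl sumr_ge0// => j _; rewrite addr_ge0.
  rewrite ler_norml; apply/andP; split.
    have := ler_norm (- a i); rewrite normrN; have := normr_ge0 (b i); lra.
  have := ler_norm (b i); have := normr_ge0 (a i); lra.
by rewrite ltW// truncnS_gt// sumr_ge0// => j _; rewrite addr_ge0.
Qed.

(** The indicator of a box is a pointwise limit of test functions with values in [[0, 1]] that
    vanish off a fixed cube, and [|f|] on that cube dominates. *)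
Let int_box a b : (\int[mu]_x (f x * \1_(open_box a b) x)%:E = 0)%E.
Proof.
have [M HM] := box_bound a b.
pose h k i := bump (a i) (b i) k.
pose phi k := prodf (h k).
have tphi k : test_function (phi k).
  apply: (@test_prodf _ _ _ M%:R) => [i|i t Mt]; first exact: smooth_bump.
  by apply: bump0; apply/negP => /HM; rewrite leNgt Mt.
have mphi k : measurable_fun setT (phi k).
  by apply: continuous_measurable_rV; have := (tphi k).1 [::] => -[].
have phi01 k x : 0 <= phi k x <= 1.
  rewrite /phi /prodf prodr_ge0/=; last by move=> i _; have /andP[] := bump_le1 (a i) (b i) k (x ord0 i).
  by rewrite prodr_ile1// => i _; exact: bump_le1.
have phi0 k x : ~ cube M%:R x -> phi k x = 0.
  move=> Hx; have [i Hi] : exists i, ~ (`|x ord0 i| <= M%:R).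
    by apply: contra_notP Hx => /forallNP H i; apply: contrapT.
  by rewrite /phi (prodfD1 _ i) /h bump0 ?mul0r//; apply/negP => /HM.
have phil x : phi k x @[k --> \oo] --> (\1_(open_box a b) x : R).
  by rewrite -indic_open_box; apply: cvg_prod => i; exact: cvg_bump.
pose g x := (`|f x| * \1_(cube M%:R) x)%R.
have ig : mu.-integrable setT (EFin \o g).
  have := intf M; rewrite integrable_mkcond//; last exact: measurable_cube.
  move=> /integrable_abse; apply: eq_integrable => //.
  move=> x _ /=; rewrite /g /patch indicE; case: ifPn => _ /=.
    by rewrite mulr1.
  by rewrite mulr0 normr0.
have := @dominated_cvg _ _ _ mu setT measurableT (fun k x => (f x * phi k x)%:E)
  (fun x => (f x * \1_(open_box a b) x)%:E) (EFin \o g).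
rewrite (_ : (fun n => _) = cst 0%E); last by apply/funext => k; rewrite f0.
move=> H; rewrite -[LHS](cvg_lim (@ereal_hausdorff R) (H _ _ _ _ _)) ?lim_cst//.
- by move=> k; apply/measurable_EFinP; exact: measurable_funM.
- by move=> x _; apply: cvg_EFin; [near=> k|exact: cvgMr].
- move=> k x _; rewrite /g lee_fin normrM ler_wpM2l//.
  rewrite indicE; case: (boolP (x \in _)) => [_|/negP]; last first.
    by rewrite inE => /(phi0 k) ->; rewrite normr0.
  by have /andP[p0 p1] := phi01 k x; rewrite ger0_norm.
Unshelve. all: by end_near. Qed.

Lemma ae_zero_of_test : ae_zero f.
Proof.
(* Cutting [f] to a bounded box makes it integrable on the whole space, which the stability under
   complements in Dynkin's theorem requires. *)
pose D (m : nat) := open_box (fun=> - m%:R) (fun=> m%:R).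
pose F m x := f x * \1_(D m) x.
have DM m : D m `<=` cube m%:R.
  by move=> x Dx i; rewrite ltW// ltr_norml; exact: Dx.
have iF m : mu.-integrable setT (EFin \o F m).
  have : mu.-integrable (D m) (EFin \o f).
    apply: integrableS (intf m) => //; first exact: measurable_cube.
    exact: measurable_open_box.
  rewrite integrable_mkcond//; last exact: measurable_open_box.
  apply: eq_integrable => // x _; rewrite /F/= /patch indicE.
  by case: ifPn => _; rewrite ?mulr1 ?mulr0.
have iFA m A : measurable A -> mu.-integrable A (EFin \o F m).
  by move=> mA; apply: integrableS (iF m).
have F0 m A : measurable A -> (\int[mu]_(x in A) (F m x)%:E = 0)%E.
  move=> mA.
  pose P B := (\int[mu]_(x in B) (F m x)%:E = 0)%E.
  have PT : P setT by exact: int_box.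
  apply: (@dynkin_induction _ _ boxes P measurable_rVE).
  - move=> _ _ [z1 _ <-] [z2 _ <-]; rewrite open_boxI; exact: box_in.
  - exact: PT.
  - move=> _ [z _ <-]; rewrite /P integral_mkcond.
    rewrite -[RHS](int_box (fun i => Num.max (- m%:R) (z.1 i)) (fun i => Num.min m%:R (z.2 i))).
    apply: eq_integral => x _; rewrite -open_boxI indicI /patch /F/= mulrA indicE.
    rewrite [X in _ = (_ * X)%:E]indicE.
    by case: ifPn => _; rewrite ?mulr1 ?mulr0.
  - move=> S mS PS; rewrite /P.
    have mSC := measurableC mS.
    have := PT; rewrite /P -(setUv S) integral_setU//.
    + by rewrite -/(P S) [X in (X + _)%E]PS add0e.
    + rewrite setUv; exact: measurable_int (iF m).
    + by apply/disj_setPS => x [].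
  - move=> G mG tG PG; rewrite /P integral_bigcup//; last first.
      by apply: iFA; apply: bigcupT_measurable.
    by rewrite eseries0// => k _ _; exact: PG.
  - by rewrite -measurable_rVE.
have aeF m : \forall x \ae mu, F m x = 0.
  have := @integral_ae_eq _ _ _ mu setT measurableT (cst 0%E) (EFin \o F m) (iF m).
  move=> /(_ (measurable_cst _)) H.
  have : ae_eq mu setT (EFin \o F m) (cst 0%E).
    by apply: H => A _ mA; rewrite F0// integral0.
  by apply: filterS => x /(_ I) [].
have : \forall x \ae mu, forall m, F m x = 0 by exact: ae_foralln.
apply: filterS => x Fx.
have [m _ Hm] : (\bigcup_k @cube R N k%:R) x by rewrite cubeT.
(* One more than [m], since the cube is closed and the box [D m] is open. *)
have := Fx m.+1; rewrite /F indicE mem_set ?mulr1//=.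
by move=> i; rewrite -ltr_norml (le_lt_trans (Hm i))// ltr_nat.
Qed.

End fundamental_lemma.

(** * Weak derivatives *)

Section square_integrable.
Context d (T : measurableType d) (R : realType) (mu : {measure set T -> \bar R}).
Implicit Types f g : T -> R.

Definition integ f := mu.-integrable setT (EFin \o f).

Lemma integ_measurable f : integ f -> measurable_fun setT f.
Proof. by move=> /integrableP[/measurable_EFinP]. Qed.

Lemma integD f g : integ f -> integ g -> integ (fun x => f x + g x).
Proof. by move=> fi gi; have := integrableD measurableT fi gi. Qed.

Lemma integB f g : integ f -> integ g -> integ (fun x => f x - g x).
Proof. by move=> fi gi; have := integrableB measurableT fi gi. Qed.

Lemma integZ c f : integ f -> integ (fun x => c * f x).
Proof. by move=> fi; have := integrableZl measurableT c fi. Qed.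

Lemma integ_le f g : measurable_fun setT f -> integ g ->
  (forall x, `|f x| <= g x) -> integ f.
Proof.
move=> mf ig fg; apply: (le_integrable measurableT _ _ ig).
  exact/measurable_EFinP.
by move=> x _ /=; rewrite lee_fin (le_trans (fg x))// ler_norm.
Qed.

Lemma integ_norm f : integ f -> integ (fun x => `|f x|).
Proof. exact: integrable_norm. Qed.

Lemma integ_sum I (s : seq I) (f : I -> T -> R) : (forall i, integ (f i)) ->
  integ (fun x => \sum_(i <- s) f i x).
Proof.
move=> fi; elim: s => [|i s IH].
  by rewrite /integ; under eq_fun do rewrite /= big_nil; exact: integrable0.
by rewrite /integ; under eq_fun do rewrite /= big_cons; exact: integD.
Qed.

Lemma integ_fin f : integ f -> (\int[mu]_x (f x)%:E = (\int[mu]_x f x)%:E)%E.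
Proof. by move=> fi; rewrite /Rintegral fineK//; exact: integrable_fin_num. Qed.

Lemma integ_ge0P f : measurable_fun setT f -> (forall x, 0 <= f x) ->
  (\int[mu]_x (f x)%:E < +oo)%E -> integ f.
Proof.
move=> mf f0 fi; apply/integrableP; split; first exact/measurable_EFinP.
by under eq_integral do rewrite /= ger0_norm//.
Qed.

Lemma Rint_eq_ae f g : measurable_fun setT f -> measurable_fun setT g ->
  (\forall x \ae mu, f x = g x) -> (\int[mu]_x f x = \int[mu]_x g x)%R.
Proof.
move=> mf mg fg; rewrite /Rintegral; congr fine; apply: ae_eq_integral => //.
- exact/measurable_EFinP.
- exact/measurable_EFinP.
- by apply: filterS fg => x /= ->.
Qed.

Lemma RintD f g : integ f -> integ g ->
  (\int[mu]_x (f x + g x) = \int[mu]_x f x + \int[mu]_x g x)%R.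
Proof. by move=> fi gi; rewrite RintegralD. Qed.

Lemma RintB f g : integ f -> integ g ->
  (\int[mu]_x (f x - g x) = \int[mu]_x f x - \int[mu]_x g x)%R.
Proof. by move=> fi gi; rewrite RintegralB. Qed.

Lemma RintZ c f : integ f -> (\int[mu]_x (c * f x) = c * \int[mu]_x f x)%R.
Proof. by move=> fi; rewrite RintegralZl. Qed.

Lemma Rint_le f g : integ f -> integ g -> (forall x, f x <= g x) ->
  (\int[mu]_x f x <= \int[mu]_x g x)%R.
Proof. by move=> fi gi fg; apply: le_Rintegral. Qed.

Lemma Rint_ge0 f : (forall x, 0 <= f x) -> (0 <= \int[mu]_x f x)%R.
Proof. by move=> f0; apply: Rintegral_ge0. Qed.

Lemma Rint_sum I (s : seq I) (f : I -> T -> R) : (forall i, integ (f i)) ->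
  (\int[mu]_x (\sum_(i <- s) f i x) = \sum_(i <- s) \int[mu]_x f i x)%R.
Proof.
move=> fi; elim: s => [|i s IH].
  rewrite big_nil; under eq_Rintegral do rewrite big_nil.
  by rewrite /Rintegral integral0.
rewrite big_cons -IH -RintD//; last exact: integ_sum.
by apply: eq_Rintegral => x _; rewrite big_cons.
Qed.

Lemma le_norm_Rint f g : measurable_fun setT f -> integ g -> (forall x, `|f x| <= g x) ->
  (`|\int[mu]_x f x| <= \int[mu]_x g x)%R.
Proof.
move=> mf ig fg; have fi := integ_le mf ig fg.
apply: le_trans (le_normr_Rintegral measurableT fi) _.
by apply: Rint_le => //; exact: integ_norm.
Qed.

Definition sqinteg f := measurable_fun setT f /\ integ (fun x => f x ^+ 2).

Lemma Lfun2P f : f \in Lfun mu 2%:E <-> sqinteg f.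
Proof.
split=> [l2f|[mf fi]].
  split; last exact: Lfun2_integrable_sqr.
  by move: l2f; rewrite inE => /andP[]; rewrite inE.
rewrite inE; apply/andP; split; rewrite inE//= /finite_norm unlock.
apply: poweR_lty; have /integrableP[_] := fi; apply: le_lt_trans.
apply: ge0_le_integral => //.
- by move=> x _; exact: poweR_ge0.
- apply/measurable_EFinP.
  apply: (@measurableT_comp _ _ _ _ _ _ (fun x : R => x `^ 2)%R) => //.
  exact: measurableT_comp.
- apply/measurable_EFinP; apply: measurableT_comp => //.
  exact: measurable_funX.
- by move=> x _; rewrite /= lee_fin normrX powR_mulrn.
Qed.

Lemma sqintegM f g : sqinteg f -> sqinteg g -> integ (fun x => f x * g x).
Proof.
move=> [mf fi] [mg gi]; apply: integ_le (integD fi gi) _.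
  exact: measurable_funM.
move=> x; rewrite normrM.
have := sqr_ge0 (`|f x| - `|g x|); rewrite sqrrB !real_normK ?num_real//.
have := normr_ge0 (f x); have := normr_ge0 (g x); nra.
Qed.

Lemma sqinteg_le f g : measurable_fun setT f -> sqinteg g ->
  (forall x, `|f x| <= `|g x|) -> sqinteg f.
Proof.
move=> mf [mg gi] fg; split => //; apply: integ_le gi _.
  exact: measurable_funX.
by move=> x; rewrite normrX -[leRHS]real_normK ?num_real// lerXn2r ?nnegrE.
Qed.

Lemma sqintegD f g : sqinteg f -> sqinteg g -> sqinteg (fun x => f x + g x).
Proof.
move=> sf sg; split; first by apply: measurable_funD; [exact: sf.1|exact: sg.1].
rewrite (_ : (fun x => _) = (fun x => f x ^+ 2 + (2 * (f x * g x) + g x ^+ 2))); last first.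
  by apply/funext => x; ring.
apply: integD; first exact: sf.2.
by apply: integD; [apply: integZ; exact: sqintegM|exact: sg.2].
Qed.

Lemma sqintegZ c f : sqinteg f -> sqinteg (fun x => c * f x).
Proof.
move=> sf; split; first by apply: measurable_funM => //; exact: sf.1.
rewrite (_ : (fun x => _) = (fun x => c ^+ 2 * f x ^+ 2)); last first.
  by apply/funext => x; ring.
by apply: integZ; exact: sf.2.
Qed.

Lemma sqintegB f g : sqinteg f -> sqinteg g -> sqinteg (fun x => f x - g x).
Proof.
move=> sf sg; have := sqintegD sf (sqintegZ (-1) sg).
by congr sqinteg; apply/funext => x; rewrite mulN1r.
Qed.

Lemma sqinteg_norm f : sqinteg f -> sqinteg (fun x => `|f x|).
Proof.
move=> sf; apply: (sqinteg_le _ sf); last by move=> x; rewrite normr_id.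
by apply: measurableT_comp => //; exact: sf.1.
Qed.

End square_integrable.

(** * Test functions and weak partial derivatives *)

Section test_functions.
Context {R : realType} {N : nat}.
Local Notation mu := (lebesgue_rV R N).
Local Notation V := 'rV[R]_N.
Implicit Types (f g u phi : V -> R) (i : 'I_N).

Definition e_ i : V := delta_mx ord0 i.

Lemma norm_e i : `|e_ i| <= 1.
Proof.
rewrite -cube_norm// => j; rewrite /e_ mxE eqxx/=.
by case: (_ == _); rewrite ?normr1 ?normr0.
Qed.

Definition locinteg f := measurable_fun setT f /\
  forall k : nat, mu.-integrable (cube k%:R) (EFin \o f).

Lemma locinteg_mul f g (k : nat) C : locinteg f -> measurable_fun setT g ->
  (forall x, `|g x| <= C) -> (forall x, ~ cube k%:R x -> g x = 0) ->
  integ mu (fun x => f x * g x).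
Proof.
move=> [mf fi] mg gC g0.
have H : integ mu (fun x => C * `|f x * \1_(cube k%:R) x|).
  apply: integZ; apply: integ_norm.
  have := fi k; rewrite integrable_mkcond//; last exact: measurable_cube.
  apply: eq_integrable => // x _ /=; rewrite /patch indicE.
  by case: ifPn => _; rewrite ?mulr1 ?mulr0.
apply: integ_le H _; first exact: measurable_funM.
move=> x; rewrite !normrM mulrC; have [Hx|Hx] := pselect (cube k%:R x).
  by rewrite indicE mem_set// normr1 mulr1 ler_wpM2r.
by rewrite g0// normr0 mul0r mulr_ge0// ?mulr_ge0// (le_trans _ (gC x)).
Qed.

(** On a cube, which has finite measure, [|f| <= 1 + f ^ 2]. *)
Lemma sqinteg_loc f : sqinteg mu f -> locinteg f.
Proof.
move=> [mf fi]; split => // k.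
have i1 : mu.-integrable (@cube R N k%:R) (EFin \o (fun x => 1 + f x ^+ 2)).
  have mk := @measurable_cube R N k%:R.
  have c1 : mu.-integrable (@cube R N k%:R) (cst 1%:E).
    by apply/integrableP; split => //=; rewrite integral_cst// normr1 mul1e; exact: cube_finite.
  have c2 : mu.-integrable (@cube R N k%:R) (EFin \o (fun x => f x ^+ 2)).
    exact: integrableS fi.
  by have := integrableD mk c1 c2.
apply: (le_integrable _ _ _ i1); first exact: measurable_cube.
  by apply/measurable_EFinP; exact: measurable_funTS.
move=> x _ /=; rewrite lee_fin [leRHS]ger0_norm; last by rewrite addr_ge0// sqr_ge0.
have := sqr_ge0 (`|f x| - 1); rewrite sqrrB real_normK ?num_real//.
have := normr_ge0 (f x); nra.
Qed.

Lemma locintegB f g : locinteg f -> locinteg g -> locinteg (fun x => f x - g x).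
Proof.
move=> [mf fi] [mg gi]; split; first exact: measurable_funB.
by move=> k; have := integrableB (@measurable_cube R N k%:R) (fi k) (gi k).
Qed.

Lemma test_continuous phi : test_function phi -> continuous phi.
Proof. by move=> [/(_ [::])[]]. Qed.

Lemma test_measurable phi : test_function phi -> measurable_fun setT phi.
Proof. by move=> /test_continuous; exact: continuous_measurable_rV. Qed.

Lemma test_cube phi : test_function phi -> exists k : nat, forall x, ~ cube k%:R x -> phi x = 0.
Proof.
move=> [_ /compact_bounded[M [_ HM]]].
exists (Num.truncn (`|M| + 1)).+1 => x nx; apply/eqP/negPn/negP => px; apply: nx.
rewrite cube_norm//; apply: (@le_trans _ _ (`|M| + 1)).
  apply: HM; first by rewrite (le_lt_trans (ler_norm M))// ltrDl.
  exact: subset_closure.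
by rewrite ltW// truncnS_gt// addr_ge0.
Qed.

Lemma test_bound phi : test_function phi -> exists C, forall x, `|phi x| <= C.
Proof.
move=> tp; have := continuous_compact (f := phi) (A := closure [set x | phi x != 0]).
move=> /(_ _ tp.2) H; have {}H : compact (phi @` closure [set x | phi x != 0]).
  by apply: H; apply: continuous_subspaceT; exact: test_continuous.
have [M [_ HM]] := compact_bounded H.
exists (`|M| + 1) => x; have [->|px] := eqVneq (phi x) 0; first by rewrite normr0 addr_ge0.
apply: HM; first by rewrite (le_lt_trans (ler_norm M))// ltrDl.
by exists x => //; exact: subset_closure.
Qed.

Lemma test_integM f phi : locinteg f -> test_function phi ->
  integ mu (fun x => f x * phi x).
Proof.
move=> lf tp; have [k pk] := test_cube tp; have [C pC] := test_bound tp.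
by apply: (locinteg_mul lf (test_measurable tp) pC pk).
Qed.

Lemma test_loc phi : test_function phi -> locinteg phi.
Proof.
move=> tp; have [C pC] := test_bound tp; split; first exact: test_measurable.
move=> k; apply: measurable_bounded_integrable; first exact: measurable_cube.
- exact: cube_finite.
- exact: measurable_funTS (test_measurable tp).
- exists C; split; first exact: num_real.
  by move=> y Cy x _; rewrite /= (le_trans (pC x))// ltW.
Qed.

Lemma test_sqinteg phi : test_function phi -> sqinteg mu phi.
Proof.
move=> tp; split; first exact: test_measurable.
exact: (test_integM (test_loc tp) tp).
Qed.

Lemma test_derivable phi i x : test_function phi -> derivable phi x (e_ i).
Proof. by move=> [/(_ [::])[_]]. Qed.

Lemma test_partial phi i : test_function phi -> test_function (partial i phi).
Proof.
move=> tp; split; first by move=> s; have := tp.1 (rcons s i); rewrite foldr_rcons.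
apply: (subclosed_compact _ tp.2); first exact: closed_closure.
have /closure_id -> : closed (closure [set x | phi x != 0]) by exact: closed_closure.
apply: closure_subset => x /= px; apply: contrapT => nx.
move: px; apply/negP; rewrite negbK; apply/eqP.
have H : nbhs x (~` closure [set x | phi x != 0]).
  by apply: open_nbhs_nbhs; split => //; apply: closed_openC; exact: closed_closure.
rewrite /partial -(@derive_cst _ _ _ (0 : R) x (e_ i)).
apply: near_eq_derive.
apply: filterS H => y Hy; apply/eqP/negPn/negP => py; apply: Hy; exact: subset_closure.
Qed.

Lemma partial_shift phi i (y x : V) :
  partial i (fun z => phi (z + y)) x = partial i phi (x + y).
Proof.
rewrite /partial /derive; congr (lim _).
by under eq_fun do rewrite /= -addrA.
Qed.

Lemma test_shift phi (y : V) : test_function phi -> test_function (fun z => phi (z + y)).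
Proof.
move=> tp.
have E s : foldr partial (fun z => phi (z + y)) s = fun z => foldr partial phi s (z + y).
  elim: s => // i s IH /=; rewrite IH.
  by apply/funext => x; exact: (partial_shift (foldr partial phi s)).
split=> [s|].
  rewrite E; have [cs ds] := tp.1 s; split.
    move=> x; apply: (@continuous_comp _ _ _ (fun z : V => z + y) (foldr partial phi s) x); last exact: cs.
    by apply: continuousD; [exact: cvg_id|exact: cst_continuous].
  move=> i x; rewrite /derivable.
  rewrite (_ : (fun h : R => _) = (fun h : R => h^-1 *: ((foldr partial phi s \o shift (x + y)) (h *: delta_mx ord0 i) - foldr partial phi s (x + y)))).
    exact: ds.
  by apply/funext => h /=; rewrite addrA.
have [k pk] := test_cube tp.
apply: (@compact_closure_cube R N _ (k%:R + `|y|)); first by rewrite addr_ge0.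
move=> x /= px; rewrite cube_norm ?addr_ge0//.
have : cube k%:R (x + y) by apply: contrapT => /pk H; move: px; rewrite H eqxx.
rewrite cube_norm// => H; rewrite -[x](addrK y) (le_trans (ler_normB _ _))//.
by rewrite lerD2r.
Qed.

Lemma test_line phi i x (t : R) : test_function phi ->
  is_derive t (1 : R) (fun s => phi (x + s *: e_ i)) (partial i phi (x + t *: e_ i)).
Proof.
move=> tp; have := @test_derivable phi i (x + t *: e_ i) tp.
rewrite /partial /derivable /derive => H.
have E : (fun h : R => h^-1 *: (phi (h *: e_ i + (x + t *: e_ i)) - phi (x + t *: e_ i)))
  = (fun h : R => h^-1 *: (phi (x + (h *: 1 + t) *: e_ i) - phi (x + t *: e_ i))).
  apply/funext => h; rewrite addrCA -scalerDl; congr (_ *: (phi (_ + (_ + _) *: _) - _)).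
  by rewrite /GRing.scale/= mulr1.
by apply: DeriveDef; rewrite /derivable /derive/= -?E.
Qed.

Lemma measurable_test_line phi i (t : R) : test_function phi ->
  measurable_fun setT (fun x : V => phi (x + t *: e_ i)).
Proof.
move=> tp; apply: measurableT_comp; first exact: test_measurable.
exact: measurable_rV_add.
Qed.

Lemma is_derive_int_test f phi i (t : R) : locinteg f -> test_function phi ->
  is_derive t (1 : R) (fun s => \int[mu]_x (f x * phi (x + s *: e_ i)))%R
    (\int[mu]_x (f x * partial i phi (x + t *: e_ i)))%R.
Proof.
move=> lf tp; have tdp := test_partial i tp.
have [k pk] := test_cube tdp; have [C pC] := test_bound tdp.
pose F (s : R) (x : V) := f x * phi (x + s *: e_ i).
have D s x : is_derive s (1 : R) (F^~ x) (f x * partial i phi (x + s *: e_ i)).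
  have := @test_line phi i x s tp => ?.
  rewrite (_ : F^~ x = f x \*: (fun s => phi (x + s *: e_ i)))//; exact: is_deriveZ.
have intF s : mu.-integrable setT (EFin \o F s).
  by have := test_integM lf (test_shift (s *: e_ i) tp).
(* For [s] within 1 of [t], the support of the translate by [s] stays in the cube of half-side
   [k + m]; this gives a bound uniform in [s]. *)
pose m := (Num.truncn (`|t| + 1)).+1.
pose G x := `|f x * (C * \1_(cube (k + m)%:R) x)|.
have iG : mu.-integrable setT (EFin \o G).
  apply: integ_norm; apply: (@locinteg_mul f _ (k + m) C lf).
  - by apply: measurable_funM => //; apply: measurable_indic; exact: measurable_cube.
  - have C0 : 0 <= C by apply: le_trans (pC 0).
    move=> x; rewrite indicE; case: (_ \in _); rewrite ?mulr1 ?mulr0 ?normr0// ger0_norm//.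
  - by move=> x nx; rewrite indicE memNset// mulr0.
have It : t \in `]t - 1, t + 1[%classic by rewrite inE/= in_itv/= ltrBlDr ltrDl ltr01.
have bF s x : `]t - 1, t + 1[%classic s -> setT x -> `|partial1of2 F s x| <= G x.
  rewrite /= in_itv/= => /andP[s1 s2] _.
  rewrite /partial1of2 derive1E (@derive_val _ _ _ _ _ _ _ (D s x)) /G !normrM.
  rewrite ler_wpM2l//; have [cx|cx] := pselect (cube k%:R (x + s *: e_ i)).
    rewrite indicE mem_set ?normr1 ?mulr1; first by rewrite (le_trans (pC _))// ler_norm.
    rewrite cube_norm ?ler0n//; move: cx; rewrite cube_norm ?ler0n// => cx.
    rewrite -[x](addrK (s *: e_ i)) (le_trans (ler_normB _ _))// natrD lerD//.
    rewrite normrZ (@le_trans _ _ `|s|)//; first by rewrite ler_piMr// norm_e.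
    apply: (@le_trans _ _ (`|t| + 1)); last by rewrite ltW// truncnS_gt// addr_ge0.
    rewrite -[s](subrK t) (le_trans (ler_normD _ _))// addrC lerD2l.
    by rewrite ler_norml; apply/andP; split; lra.
  by rewrite pk// normr0 mulr_ge0.
have Ds s y : `]t - 1, t + 1[%classic s -> setT y -> derivable (F ^~ y) s 1.
  by move=> _ _; exact: (@ex_derive _ _ _ _ _ _ _ (D s y)).
have := @cvg_differentiation_under_integral R _ V mu F setT measurableT t (t - 1) (t + 1) (set_mem It)
   (fun s _ => intF s) Ds G (fun y => normr_ge0 _) iG bF.
rewrite (_ : (\int[mu]_y partial1of2 F t y)%R = (\int[mu]_x (f x * partial i phi (x + t *: e_ i)))%R); last first.
  apply: eq_Rintegral => x _.
  by rewrite /partial1of2 derive1E (@derive_val _ _ _ _ _ _ _ (D t x)).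
rewrite (_ : (fun h => _) = (fun h : R => h^-1 *: ((\int[mu]_y F (h *: 1 + t) y)%R - (\int[mu]_y F t y)%R))); last first.
  by apply/funext => h; rewrite /GRing.scale/= mulr1.
move=> H; apply: DeriveDef; first by apply/cvg_ex; eexists; exact: H.
by apply: cvg_lim => //; exact: H.
Qed.

(* Differentiate [h |-> \int f(x) psi(x + h e_i) = \int f(x - h e_i) psi(x)] at 0
   from both sides. *)
Lemma test_by_parts phi psi i : test_function phi -> test_function psi ->
  (\int[mu]_x (phi x * partial i psi x) = - \int[mu]_x (partial i phi x * psi x))%R.
Proof.
move=> tp ts.
have H1 := is_derive_int_test i 0 (test_loc tp) ts.
have H2 := is_derive_int_test i (- 0) (test_loc ts) tp.
have E : (fun s => (\int[mu]_x (phi x * psi (x + s *: e_ i)))%R) =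
         (fun s => (\int[mu]_x (psi x * phi (x + s *: e_ i)))%R) \o (fun s => - s).
  apply/funext => s /=; rewrite /Rintegral; congr fine.
  rewrite -[RHS](@integral_shift R N (s *: e_ i)); last first.
    apply: measurable_funM; first exact: test_measurable.
    exact: measurable_test_line.
  by apply: eq_integral => x _; rewrite scaleNr addrK mulrC.
have H3 : is_derive (0 : R) (1 : R) (fun s => (\int[mu]_x (phi x * psi (x + s *: e_ i)))%R)
   ((\int[mu]_x (psi x * partial i phi (x + - 0 *: e_ i)))%R * -1).
  by rewrite E; apply: is_derive1_comp.
have := @derive_val _ _ _ _ _ _ _ H3; rewrite (@derive_val _ _ _ _ _ _ _ H1) mulrN1.
under eq_Rintegral do rewrite scale0r addr0.
move=> ->; congr (- _); apply: eq_Rintegral => x _.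
by rewrite oppr0 scale0r addr0 mulrC.
Qed.

Lemma weak_partial_ofP i u g : sqinteg mu u -> sqinteg mu g ->
  weak_partial_of i u g <-> forall phi, test_function phi ->
  (\int[mu]_x (u x * partial i phi x) = - \int[mu]_x (g x * phi x))%R.
Proof.
move=> su sg.
have E phi : test_function phi ->
    (\int[mu]_x (u x * partial i phi x)%:E = - \int[mu]_x (g x * phi x)%:E)%E <->
    (\int[mu]_x (u x * partial i phi x) = - \int[mu]_x (g x * phi x))%R.
  move=> tp; rewrite integ_fin; last exact: test_integM (sqinteg_loc su) (test_partial i tp).
  rewrite integ_fin; last exact: test_integM (sqinteg_loc sg) tp.
  by rewrite -EFinN; split => [[]//|->].
by split => H phi tp; apply/(E _ tp); exact: H.
Qed.

(** The difference integrates to zero against every test function, so [ae_zero_of_test] applies. *)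
Lemma weak_partial_unique i u g g' : sqinteg mu u -> sqinteg mu g -> sqinteg mu g' ->
  weak_partial_of i u g -> weak_partial_of i u g' -> \forall x \ae mu, g x = g' x.
Proof.
move=> su sg sg' /(weak_partial_ofP i su sg) H /(weak_partial_ofP i su sg') H'.
have lB := locintegB (sqinteg_loc sg) (sqinteg_loc sg').
have := @ae_zero_of_test R N (fun x => g x - g' x) lB.1 lB.2.
have L : forall phi, test_function phi -> (\int[mu]_x ((g x - g' x) * phi x)%:E = 0)%E.
  move=> phi tp; rewrite integ_fin; last exact: test_integM lB tp.
  have i1 := test_integM (sqinteg_loc sg) tp; have i2 := test_integM (sqinteg_loc sg') tp.
  under eq_Rintegral do rewrite mulrBl.
  rewrite RintB// -[X in X - _]opprK -H// -[X in _ - X]opprK -H'//.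
  by rewrite opprK addrC subrr.
by move=> /(_ L); apply: filterS => x /eqP; rewrite subr_eq0 => /eqP.
Qed.

Lemma H1_sqinteg u : H1 u -> sqinteg mu u.
Proof. by move=> [/Lfun2P]. Qed.

Lemma weak_partial_spec u i : H1 u ->
  sqinteg mu (weak_partial i u) /\ weak_partial_of i u (weak_partial i u).
Proof.
move=> [_ /(_ i) ug].
have [/Lfun2P ? ?] := @xgetPex _ (cst 0) [set g | g \in Lfun mu 2%:E /\ weak_partial_of i u g] ug.
by split.
Qed.

Lemma H1I u (g : 'I_N -> V -> R) : sqinteg mu u -> (forall i, sqinteg mu (g i)) ->
  (forall i, weak_partial_of i u (g i)) -> H1 u.
Proof.
by move=> su sg wg; split; [exact/Lfun2P|move=> i; exists (g i); split => //; exact/Lfun2P].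
Qed.

Lemma weak_partial_ae u i g : H1 u -> sqinteg mu g -> weak_partial_of i u g ->
  \forall x \ae mu, weak_partial i u x = g x.
Proof.
move=> hu sg wg; have [sw ww] := weak_partial_spec i hu.
exact: (weak_partial_unique (H1_sqinteg hu) sw sg ww wg).
Qed.

Lemma weak_partial_ofZ c i u g : sqinteg mu u -> sqinteg mu g ->
  weak_partial_of i u g -> weak_partial_of i (fun x => c * u x) (fun x => c * g x).
Proof.
move=> su sg /(weak_partial_ofP i su sg) H.
apply/(weak_partial_ofP i (sqintegZ c su) (sqintegZ c sg)) => phi tp.
have i1 := test_integM (sqinteg_loc su) (test_partial i tp).
have i2 := test_integM (sqinteg_loc sg) tp.
under eq_Rintegral do rewrite -mulrA.
under [in RHS]eq_Rintegral do rewrite -mulrA.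
by rewrite !RintZ// H// mulrN.
Qed.

Lemma weak_partial_ofD i u g v h : sqinteg mu u -> sqinteg mu g ->
  sqinteg mu v -> sqinteg mu h ->
  weak_partial_of i u g -> weak_partial_of i v h ->
  weak_partial_of i (fun x => u x + v x) (fun x => g x + h x).
Proof.
move=> su sg sv sh /(weak_partial_ofP i su sg) H /(weak_partial_ofP i sv sh) H'.
apply/(weak_partial_ofP i (sqintegD su sv) (sqintegD sg sh)) => phi tp.
have i1 := test_integM (sqinteg_loc su) (test_partial i tp).
have i2 := test_integM (sqinteg_loc sg) tp.
have i3 := test_integM (sqinteg_loc sv) (test_partial i tp).
have i4 := test_integM (sqinteg_loc sh) tp.
under eq_Rintegral do rewrite mulrDl.
under [in RHS]eq_Rintegral do rewrite mulrDl.
by rewrite !RintD// H// H'// opprD.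
Qed.

Lemma sqinteg_shift (y : V) u : sqinteg mu u -> sqinteg mu (fun x => u (x + y)).
Proof.
move=> [m i]; split; last exact: (integrable_shift y i).
by apply: measurableT_comp m _; exact: measurable_rV_add.
Qed.

Lemma Rint_shift (y : V) u : measurable_fun setT u ->
  (\int[mu]_x u (x + y) = \int[mu]_x u x)%R.
Proof. by move=> mu_; rewrite /Rintegral integral_shift. Qed.

Lemma weak_partial_of_shift (y : V) i u g : sqinteg mu u -> sqinteg mu g ->
  weak_partial_of i u g -> weak_partial_of i (fun x => u (x + y)) (fun x => g (x + y)).
Proof.
move=> su sg /(weak_partial_ofP i su sg) H.
apply/(weak_partial_ofP i (sqinteg_shift y su) (sqinteg_shift y sg)) => phi tp.
have tps := test_shift (- y) tp.
have := H _ tps.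
rewrite -(@Rint_shift y (fun x => u x * _)); last first.
  by apply: measurable_funM; [exact: su.1|apply: test_measurable; exact: test_partial].
rewrite -(@Rint_shift y (fun x => g x * _)); last first.
  by apply: measurable_funM; [exact: sg.1|exact: test_measurable].
under eq_Rintegral do rewrite partial_shift addrK.
by under [in X in _ = - X -> _]eq_Rintegral do rewrite addrK.
Qed.

Lemma weak_partial_of_test i phi : test_function phi -> weak_partial_of i phi (partial i phi).
Proof.
move=> tp.
apply/(weak_partial_ofP i (test_sqinteg tp) (test_sqinteg (test_partial i tp))) => psi ts.
exact: test_by_parts.
Qed.

Lemma sqr_grad_ae u (g : 'I_N -> V -> R) : H1 u -> (forall i, sqinteg mu (g i)) ->
  (forall i, weak_partial_of i u (g i)) ->
  \forall x \ae mu, sqr_grad u x = \sum_(i < N) g i x ^+ 2.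
Proof.
move=> hu sg wg.
have : \forall x \ae mu, forall i, weak_partial i u x = g i x.
  apply: filter_forall.
  by move=> i; exact: weak_partial_ae.
by apply: filterS => x Hx; rewrite /sqr_grad; apply: eq_bigr => i _; rewrite Hx.
Qed.

End test_functions.

Section ge0_scale.
Context d (T : measurableType d) (R : realType) (mu : {measure set T -> \bar R}).

Lemma ge0_integral_cstM (c : R) (f : T -> R) : 0 <= c -> measurable_fun setT f ->
  (forall x, 0 <= f x) ->
  (\int[mu]_x (c * f x)%:E = c%:E * \int[mu]_x (f x)%:E)%E.
Proof.
move=> c0 mf f0; rewrite -ge0_integralZl//; first exact/measurable_EFinP.
by move=> x _; rewrite lee_fin.
Qed.

Lemma ge0_integral_Mcst (c : R) (f : T -> R) : 0 <= c -> measurable_fun setT f ->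
  (forall x, 0 <= f x) ->
  (\int[mu]_x (f x * c)%:E = (\int[mu]_x (f x)%:E) * c%:E)%E.
Proof.
move=> c0 mf f0; rewrite muleC -ge0_integral_cstM//.
by apply: eq_integral => x _; rewrite mulrC.
Qed.

Lemma ge0_le_integral_EFin (f g : T -> R) : measurable_fun setT f -> measurable_fun setT g ->
  (forall x, 0 <= f x <= g x) -> (\int[mu]_x (f x)%:E <= \int[mu]_x (g x)%:E)%E.
Proof.
move=> mf mg fg; apply: ge0_le_integral => //.
- by move=> x _; rewrite lee_fin; have /andP[] := fg x.
- exact/measurable_EFinP.
- exact/measurable_EFinP.
- by move=> x _; rewrite lee_fin; have /andP[] := fg x.
Qed.

End ge0_scale.

(** * Translations *)

Section line_average.
Context {R : realType} {N : nat}.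
Local Notation mu := (lebesgue_rV R N).
Local Notation leb := (@lebesgue_measure R).
Local Notation V := 'rV[R]_N.
Variables (i : 'I_N) (g : V -> R) (h : R).
Hypotheses (sg : sqinteg mu g) (h0 : 0 <= h).

Let I : set R := `[0, h]%classic.

Let K (z : measurableTypeR R * V) : R := \1_I z.1 * g (z.2 + z.1 *: e_ i).

(** Not divided by [h] in spite of the name: if [g] is the weak derivative of [u], this is the
    increment of [u] along the segment, see [translation_ae]. It is meaningful for almost every
    [x]. *)
Definition line_avg (x : V) : R := (\int[leb]_s (\1_I s * g (x + s *: e_ i)))%R.

Let mK : measurable_fun setT K.
Proof.
apply: measurable_funM.
  apply: (@measurableT_comp _ _ _ _ _ _ (\1_I : measurableTypeR R -> R)).
    by apply: measurable_indic; exact: measurable_itv.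
  exact: measurable_fst.
apply: (measurableT_comp sg.1).
apply: measurable_fun_coord_rV => j.
rewrite (_ : (fun x => _) = (fun z : measurableTypeR R * V => z.2 ord0 j + z.1 * (e_ i : V) ord0 j)); last first.
  by apply/funext => z; rewrite !mxE.
apply: measurable_funD.
  exact: (measurableT_comp (measurable_coord_rV j) measurable_snd).
by apply: measurable_funM => //; exact: measurable_fst.
Qed.

Let mKx x : measurable_fun setT (fun s : measurableTypeR R => K (s, x)).
Proof. by apply: (measurableT_comp mK); exact: pair2_measurable. Qed.

Let mI : measurable_fun setT (\1_I : measurableTypeR R -> R).
Proof. by apply: measurable_indic; exact: measurable_itv. Qed.

Let int_indic_I : (\int[leb]_s (\1_I s)%:E = h%:E)%E.
Proof.
have E : lebesgue_measure I = h%:E.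
  rewrite /I lebesgue_measure_itv/= lte_fin; case: ltgtP h0 => // [h1 _|<- _//].
  by rewrite oppr0 adde0.
rewrite integral_indic//; last exact: measurable_itv.
by rewrite setIT; exact: E.
Qed.

Let indic_I_sqr s : (\1_I s : R) ^+ 2 = \1_I s.
Proof. by rewrite indicE; case: (_ \in _); rewrite ?expr1n ?expr0n. Qed.

Let iI : integ leb (\1_I : measurableTypeR R -> R).
Proof. by apply: integ_ge0P => //; rewrite int_indic_I ltry. Qed.

Let sI : sqinteg leb (\1_I : measurableTypeR R -> R).
Proof. by split => //; have := iI; congr integ; apply/funext => s; rewrite indic_I_sqr. Qed.

Let S (x : V) : \bar R := (\int[leb]_s (K (s, x) ^+ 2)%:E)%E.

Let mK2 : measurable_fun setT (fun z => (K z ^+ 2)%:E).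
Proof. by apply/measurable_EFinP; exact: measurable_funX. Qed.

Let mS : measurable_fun setT S.
Proof.
apply: (@measurable_fun_fubini_tonelli_G _ _ _ _ R leb _ mK2).
by move=> z; rewrite lee_fin sqr_ge0.
Qed.

Let S_ge0 x : (0 <= S x)%E.
Proof. by apply: integral_ge0 => s _; rewrite lee_fin sqr_ge0. Qed.

Let intg2 : (\int[mu]_x (g x ^+ 2)%:E = (\int[mu]_x (g x ^+ 2))%:E)%E.
Proof. by rewrite integ_fin//; exact: sg.2. Qed.

Let intK2 : (\int[mu]_x S x = (h * \int[mu]_x (g x ^+ 2)%R)%:E)%E.
Proof.
rewrite /S -(@fubini_tonelli _ _ _ _ R leb mu _ mK2); last first.
  by move=> z; rewrite lee_fin sqr_ge0.
transitivity (\int[leb]_s (\1_I s * \int[mu]_x (g x ^+ 2))%:E)%E.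
  apply: eq_integral => s _; rewrite /K/= EFinM.
  rewrite -[in RHS]intg2 -[in RHS](@integral_shift R N (s *: e_ i)); last first.
    by apply: measurable_funX; exact: sg.1.
  rewrite -ge0_integral_cstM//.
  - by apply: eq_integral => x _; rewrite exprMn indic_I_sqr.
  - apply: measurable_funX.
    by apply: measurableT_comp sg.1 _; exact: measurable_rV_add.
  - by move=> x; exact: sqr_ge0.
rewrite ge0_integral_Mcst//; first by rewrite int_indic_I EFinM.
by apply: Rint_ge0 => x; exact: sqr_ge0.
Qed.

Let S_fin : \forall x \ae mu, S x \is a fin_num.
Proof.
have iS : mu.-integrable setT S.
  apply/integrableP; split => //.
  by under eq_integral do rewrite gee0_abs//; rewrite intK2 ltry.
by have := integrable_ae measurableT iS; apply: filterS => x; exact.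
Qed.

Let sKx x : S x \is a fin_num -> sqinteg leb (fun s : measurableTypeR R => K (s, x)).
Proof.
move=> Sx; split; first exact: mKx.
apply: integ_ge0P.
- by apply: measurable_funX; exact: mKx.
- by move=> s; exact: sqr_ge0.
- by rewrite -(ge0_fin_numE (S_ge0 x)).
Qed.

Let KI x s : K (s, x) = \1_I s * K (s, x).
Proof.
by rewrite /K/= mulrA indicE; case: (_ \in _); rewrite ?mulr1 ?mul0r.
Qed.

Let iKx x : S x \is a fin_num -> integ leb (fun s : measurableTypeR R => K (s, x)).
Proof.
move=> Sx; have := sqintegM sI (sKx Sx).
by congr integ; apply/funext => s; rewrite -KI.
Qed.

(* Jensen's inequality on [0, h] *)
Let avg_sqr x : S x \is a fin_num -> line_avg x ^+ 2 <= h * fine (S x).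
Proof.
move=> Sx; have iK := iKx Sx; have [_ iK2] := sKx Sx.
have -> : line_avg x = (\int[leb]_s K (s, x))%R by [].
have -> : fine (S x) = (\int[leb]_s (K (s, x) ^+ 2))%R by [].
have EI : (\int[leb]_s (\1_I s) = h)%R by rewrite /Rintegral int_indic_I.
set A := (\int[leb]_s K (s, x))%R; set B := (\int[leb]_s (K (s, x) ^+ 2))%R.
(* The integral of [(K (s, x) - m) ^ 2] over [[0, h]] is nonnegative for every [m]; the choice
   [m = A / h] gives the claim. *)
have H m : 0 <= B - (2 * m) * A + m ^+ 2 * h.
  rewrite -EI -RintZ// -RintZ// -RintB//; last exact: integZ.
  rewrite -RintD//; [|by apply: integB => //; exact: integZ|exact: integZ].
  apply: Rint_ge0 => s; rewrite KI indicE; case: (_ \in _) => /=; rewrite ?mulr1 ?mul1r ?mul0r ?mulr0.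
    have := sqr_ge0 (K (s, x) - m); rewrite sqrrB; lra.
  by rewrite expr0n/= subrr addr0.
have [h1|h1] := ltP 0 h.
  have := H (A / h).
  have -> : B - 2 * (A / h) * A + (A / h) ^+ 2 * h = B - A ^+ 2 / h.
    by field; rewrite gt_eqF.
  by rewrite subr_ge0 ler_pdivrMr// mulrC.
have hE : h = 0 by apply/eqP; rewrite eq_le h0 h1.
(* For [h = 0] the nonnegative quantity in [H] is affine in [m], which forces its slope to
   vanish. *)
have : A = 0.
  have := H (A); have := H (A *+ (Num.truncn B).+1).
  have [//|A0] := eqVneq A 0.
  have := H ((B + 1) / A); rewrite hE mulr0 addr0.
  have -> : B - 2 * ((B + 1) / A) * A = - B - 2 by field.
  have B0 : 0 <= B by apply: Rint_ge0 => s; exact: sqr_ge0.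
  lra.
by move=> ->; rewrite hE mul0r expr0n.
Qed.

Let m_avg : measurable_fun setT line_avg.
Proof.
rewrite (_ : line_avg = fine \o (fun x => (\int[leb]_s (K (s, x))%:E)%E)); last by [].
apply: measurableT_comp; first exact: fine_measurable.
under eq_fun do rewrite integralE.
have mE : measurable_fun setT (EFin \o K) by exact/measurable_EFinP.
apply: emeasurable_funB.
  have := @measurable_fun_fubini_tonelli_G _ _ _ _ R leb _ (measurable_funepos mE) (funepos_ge0 _).
  congr measurable_fun; apply/funext => x; apply: eq_integral => s _.
  by rewrite !funeposE.
have := @measurable_fun_fubini_tonelli_G _ _ _ _ R leb _ (measurable_funeneg mE) (funeneg_ge0 _).
congr measurable_fun; apply/funext => x; apply: eq_integral => s _.
by rewrite !funenegE.
Qed.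

(** Jensen's inequality on each segment, then Tonelli: by translation invariance each [s] in
    [[0, h]] contributes the same integral of [g ^ 2], whence the second factor [h]. *)
Lemma line_avg_sqr_le : (\int[mu]_x (line_avg x ^+ 2)%:E <=
  (h ^+ 2 * \int[mu]_x (g x ^+ 2)%R)%:E)%E.
Proof.
apply: (@le_trans _ _ (\int[mu]_x (h%:E * S x))%E); last first.
  rewrite ge0_integralZl//.
  by rewrite intK2 -EFinM mulrA -expr2.
apply: ae_ge0_le_integral => //.
- by move=> x _; rewrite lee_fin sqr_ge0.
- by apply/measurable_EFinP; exact: measurable_funX.
- by move=> x _; rewrite mule_ge0// lee_fin.
- by apply: measurable_funeM.
- apply: filterS S_fin => x Sx _.
  by rewrite -[S x]fineK// -EFinM lee_fin; exact: avg_sqr.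
Qed.

Lemma line_avg_sqinteg : sqinteg mu line_avg.
Proof.
split; first exact: m_avg.
apply: integ_ge0P.
- exact: measurable_funX.
- by move=> x; exact: sqr_ge0.
- by apply: le_lt_trans line_avg_sqr_le _; rewrite ltry.
Qed.

Let k psi (z : measurableTypeR R * V) : \bar R := (K z * psi z.2)%:E.

Let mk psi : sqinteg mu psi -> measurable_fun setT (k psi).
Proof.
move=> sp; apply/measurable_EFinP; apply: measurable_funM => //.
by apply: measurableT_comp sp.1 _; exact: measurable_snd.
Qed.

Let ik psi : sqinteg mu psi -> (leb \x mu)%E.-integrable setT (k psi).
Proof.
move=> sp; have mks := mk sp.
apply/(integrable12ltyP leb mu mks).
  have C0 : 0 <= (\int[mu]_x (g x ^+ 2) + \int[mu]_x (psi x ^+ 2))%R.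
    by rewrite addr_ge0//; apply: Rint_ge0 => x; exact: sqr_ge0.
  apply: (@le_lt_trans _ _ (\int[leb]_s (\1_I s * (\int[mu]_x (g x ^+ 2) + \int[mu]_x (psi x ^+ 2)))%:E)%E).
    apply: ge0_le_integral => //.
    - by move=> s _; exact: integral_ge0.
    - have mka : measurable_fun setT (fun z => `|k psi z|%E) by exact: measurableT_comp.
      exact: (@measurable_fun_fubini_tonelli_F _ _ _ _ R mu _ mka (fun=> abse_ge0 _)).
    - by apply/measurable_EFinP; apply: measurable_funM.
    move=> s _; rewrite /k /K/=.
    have i1 := (sqinteg_shift (s *: e_ i) sg).2.
    have -> : (\int[mu]_x (g x ^+ 2) + \int[mu]_x (psi x ^+ 2))%R =
       (\int[mu]_x (g (x + s *: e_ i) ^+ 2 + psi x ^+ 2))%R.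
      rewrite RintD//; last exact: sp.2.
      congr (_ + _); rewrite -(@Rint_shift R N (s *: e_ i))//.
      by apply: measurable_funX; exact: sg.1.
    rewrite EFinM -integ_fin; last by apply: integD => //; exact: sp.2.
    have mgp : measurable_fun setT (fun x : V => g (x + s *: e_ i) ^+ 2 + psi x ^+ 2).
      by apply: measurable_funD; [exact: integ_measurable i1|exact: integ_measurable sp.2].
    rewrite -ge0_integral_cstM//; last by move=> x; rewrite addr_ge0// sqr_ge0.
    apply: ge0_le_integral_EFin.
    - apply: measurableT_comp => //; apply: measurable_funM; last exact: sp.1.
      apply: measurable_funM => //.
      by apply: measurableT_comp sg.1 _; exact: measurable_rV_add.
    - exact: measurable_funM.
    - move=> x; rewrite normr_ge0/= -mulrA normrM ger0_norm//.
      rewrite ler_wpM2l//.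
      rewrite normrM; have := sqr_ge0 (`|g (x + s *: e_ i)| - `|psi x|).
      rewrite sqrrB !real_normK ?num_real//.
      have := normr_ge0 (g (x + s *: e_ i)); have := normr_ge0 (psi x); nra.
  by rewrite ge0_integral_Mcst// int_indic_I -EFinM ltry.
Qed.

Let int_k psi s : sqinteg mu psi ->
  (\int[mu]_x k psi (s, x))%E =
  ((fun s => (\int[mu]_x (psi x * g (x + s *: e_ i)))%R%:E) \_ `[0, h]) s.
Proof.
move=> sp; rewrite /patch; case: ifPn => sI'.
  rewrite -(@integ_fin _ _ _ mu); last by apply: sqintegM sp _; exact: sqinteg_shift.
  by apply: eq_integral => x _; rewrite /k /K/= indicE /I sI' mul1r mulrC.
by rewrite integral0_eq// => x _; rewrite /k /K/= indicE /I (negbTE sI') !mul0r.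
Qed.

Lemma line_avg_integrable psi : sqinteg mu psi ->
  leb.-integrable `[0, h] (EFin \o (fun s => \int[mu]_x (psi x * g (x + s *: e_ i)))%R).
Proof.
move=> sp; rewrite integrable_mkcond; last exact: measurable_itv.
have := integrable_fubini_F (ik sp); apply: eq_integrable => // s _.
exact: int_k.
Qed.

Lemma line_avg_fubini psi : sqinteg mu psi ->
  (\int[mu]_x (psi x * line_avg x) =
   \int[leb]_(s in `[0%R, h]) \int[mu]_x (psi x * g (x + s *: e_ i)))%R.
Proof.
move=> sp; rewrite /Rintegral; congr fine; have := Fubini (ik sp).
rewrite [X in X = _ -> _](_ : _ = (\int[leb]_(s in `[0%R, h]) (\int[mu]_x (psi x * g (x + s *: e_ i)))%R%:E)%E); last first.
  by rewrite [RHS]integral_mkcond; apply: eq_integral => s _; exact: int_k.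
move=> ->; apply/esym; apply: ae_eq_integral => //.
- exact: (measurable_fubini_G (ik sp)).
- by apply/measurable_EFinP; apply: measurable_funM => //; exact: sp.1.
apply: filterS S_fin => x Sx _.
have iK := iKx Sx.
rewrite /k/=; under eq_integral do rewrite EFinM.
by rewrite integralZr// integ_fin// -EFinM mulrC.
Qed.

End line_average.

(** * Increments of functions with a weak derivative *)

Section translation.
Context {R : realType} {N : nat}.
Local Notation mu := (lebesgue_rV R N).
Local Notation leb := (@lebesgue_measure R).
Local Notation V := 'rV[R]_N.

Section direction.
Variables (i : 'I_N) (u g : V -> R).
Hypotheses (su : sqinteg mu u) (sg : sqinteg mu g) (wg : weak_partial_of i u g).

Let shift_test (f : V -> R) phi (s : R) : sqinteg mu f -> test_function phi ->
  (\int[mu]_x (f x * phi (x + (- s) *: e_ i)) = \int[mu]_x (phi x * f (x + s *: e_ i)))%R.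
Proof.
move=> sf tp; rewrite -[LHS](@Rint_shift R N (s *: e_ i)); last first.
  by apply: measurable_funM; [exact: sf.1|exact: measurable_test_line].
by apply: eq_Rintegral => x _; rewrite scaleNr addrK mulrC.
Qed.

Lemma is_derive_shift_int f phi (s : R) : sqinteg mu f -> test_function phi ->
  is_derive s (1 : R) (fun s => \int[mu]_x (f x * phi (x + (- s) *: e_ i)))%R
   (- \int[mu]_x (f x * partial i phi (x + (- s) *: e_ i)))%R.
Proof.
move=> sf tp.
have := is_derive_int_test i (- s) (sqinteg_loc sf) tp => D.
have := @is_derive1_comp R (fun s => \int[mu]_x (f x * phi (x + s *: e_ i)))%R (fun s => - s) s _ _ D (is_deriveNid s 1).
by rewrite mulrN1.
Qed.

(** The fundamental theorem of calculus for [P], which carries the translation on the smooth [phi].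
    The weak derivative of [u], tested with the translates of [phi], identifies the derivative of
    [P] with [Q]. *)
Lemma translation_test phi h : 0 < h -> test_function phi ->
  (\int[mu]_x ((u (x + h *: e_ i) - u x) * phi x) =
   \int[leb]_(s in `[0%R, h]) \int[mu]_x (phi x * g (x + s *: e_ i)))%R.
Proof.
move=> h0 tp.
pose P s := (\int[mu]_x (u x * phi (x + (- s) *: e_ i)))%R.
pose Q s := (\int[mu]_x (phi x * g (x + s *: e_ i)))%R.
have DP s : is_derive s (1 : R) P (Q s).
  have := is_derive_shift_int s su tp; rewrite -/P.
  rewrite (_ : - _ = Q s)// /Q -(shift_test s sg tp).
  have := (weak_partial_ofP i su sg).1 wg _ (test_shift ((- s) *: e_ i) tp).
  by under eq_Rintegral do rewrite partial_shift; move=> ->; rewrite opprK.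
have cQ : continuous Q.
  rewrite (_ : Q = (fun s => \int[mu]_x (g x * phi (x + (- s) *: e_ i)))%R); last first.
    by apply/funext => s; rewrite shift_test.
  apply: is_derive_continuous => s; exact: is_derive_shift_int.
have cP : continuous P by exact: (is_derive_continuous DP).
have H : (\int[leb]_(s in `[0%R, h]) (Q s)%:E)%E = ((P h)%:E - (P 0)%:E)%E.
  apply: continuous_FTC2 => //.
  - exact: continuous_subspaceT.
  - split.
    + by move=> s _; exact: (@ex_derive _ _ _ _ _ _ _ (DP s)).
    + by apply: cvg_at_right_filter; exact: cP.
    + by apply: cvg_at_left_filter; exact: cP.
  - by move=> s _; rewrite derive1E (@derive_val _ _ _ _ _ _ _ (DP s)).
rewrite [RHS]/Rintegral H -EFinB/=.
rewrite /P !(shift_test _ su tp).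
under [in LHS]eq_Rintegral do rewrite mulrBl.
rewrite RintB; last 2 first.
- exact: (test_integM (sqinteg_loc (sqinteg_shift _ su)) tp).
- exact: (test_integM (sqinteg_loc su) tp).
by congr (_ - _); apply: eq_Rintegral => x _; rewrite ?scale0r ?addr0 mulrC.
Qed.

(** By [translation_test] and Fubini both sides have the same integral against every test
    function. *)
Lemma translation_ae h : 0 < h ->
  \forall x \ae mu, u (x + h *: e_ i) - u x = line_avg i g h x.
Proof.
move=> h0; have sl := line_avg_sqinteg i sg (ltW h0).
have sd : sqinteg mu (fun x => u (x + h *: e_ i) - u x).
  by apply: sqintegB su; exact: sqinteg_shift.
have lB := locintegB (sqinteg_loc sd) (sqinteg_loc sl).
have := @ae_zero_of_test R N _ lB.1 lB.2.
have L : forall phi, test_function phi ->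
   (\int[mu]_x ((u (x + h *: e_ i) - u x - line_avg i g h x) * phi x)%:E = 0)%E.
  move=> phi tp; rewrite integ_fin; last exact: test_integM lB tp.
  have i1 := test_integM (sqinteg_loc sd) tp; have i2 := test_integM (sqinteg_loc sl) tp.
  under eq_Rintegral do rewrite mulrBl.
  rewrite RintB// translation_test// -(line_avg_fubini i sg (ltW h0) (test_sqinteg tp)).
  rewrite [X in (_ - X)%:E](_ : _ = (\int[mu]_x (phi x * line_avg i g h x))%R) ?subrr//.
  by apply: eq_Rintegral => x _; rewrite mulrC.
by move=> /(_ L); apply: filterS => x /eqP; rewrite subr_eq0 => /eqP.
Qed.

Lemma translation_sqr_le h : 0 < h ->
  (\int[mu]_x ((u (x + h *: e_ i) - u x) ^+ 2) <= h ^+ 2 * \int[mu]_x (g x ^+ 2))%R.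
Proof.
move=> h0; have sl := line_avg_sqinteg i sg (ltW h0).
have sd : sqinteg mu (fun x => u (x + h *: e_ i) - u x).
  by apply: sqintegB su; exact: sqinteg_shift.
rewrite -lee_fin -(integ_fin sd.2).
apply: le_trans (line_avg_sqr_le i sg (ltW h0)).
rewrite (integ_fin sl.2) (integ_fin sd.2) lee_fin (@Rint_eq_ae _ _ _ mu _ (fun x => line_avg i g h x ^+ 2))//.
- exact: integ_measurable sd.2.
- exact: integ_measurable sl.2.
- by apply: filterS (translation_ae h0) => x ->.
Qed.

End direction.

Definition shift_dist (u : V -> R) (y : V) : R := (\int[mu]_x ((u (x + y) - u x) ^+ 2))%R.

Let sqinteg_diff (u : V -> R) (y : V) : sqinteg mu u -> sqinteg mu (fun x => u (x + y) - u x).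
Proof. by move=> su; apply: (sqintegB _ su); exact: sqinteg_shift. Qed.

Lemma shift_distN u y : sqinteg mu u -> shift_dist u (- y) = shift_dist u y.
Proof.
move=> su; rewrite /shift_dist -(@Rint_shift R N y); last exact: integ_measurable (sqinteg_diff _ su).2.
by apply: eq_Rintegral => x _; rewrite addrK -sqrrN opprB.
Qed.

Lemma shift_dist0 u : shift_dist u 0 = 0.
Proof.
rewrite /shift_dist /Rintegral integral0_eq// => x _.
by rewrite addr0 subrr expr0n.
Qed.

Lemma shift_distD u y z : sqinteg mu u ->
  shift_dist u (y + z) <= 2 * shift_dist u y + 2 * shift_dist u z.
Proof.
move=> su; rewrite /shift_dist.
have i1 := (sqinteg_diff y su).2; have i2 := (sqinteg_diff z su).2.
have i3 := (sqinteg_diff (y + z) su).2.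
rewrite -(@Rint_shift R N z (fun x => (u (x + y) - u x) ^+ 2)); last exact: integ_measurable i1.
have i1z : integ mu (fun x : V => (u (x + z + y) - u (x + z)) ^+ 2) by exact: integrable_shift i1.
rewrite -!RintZ// -RintD; [|exact: integZ|exact: integZ].
apply: Rint_le => //; first by apply: integD; exact: integZ.
move=> x; rewrite (addrC y z) (addrA x z y).
by have := sqr_ge0 ((u (x + z + y) - u (x + z)) - (u (x + z) - u x)); nra.
Qed.

Lemma shift_dist_line i u g t : sqinteg mu u -> sqinteg mu g -> weak_partial_of i u g ->
  shift_dist u (t *: e_ i) <= t ^+ 2 * (\int[mu]_x (g x ^+ 2))%R.
Proof.
move=> su sg wg; have [t0|t0|->] := ltgtP t 0.
- rewrite -shift_distN// -scaleNr -sqrrN; apply: (translation_sqr_le su sg wg).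
  by rewrite oppr_gt0.
- exact: (translation_sqr_le su sg wg).
- by rewrite scale0r shift_dist0 expr0n mul0r.
Qed.

(** The translation is split along the coordinate axes, each step costing a factor 2 by
    [shift_distD]. Only the quadratic order in [|y|] matters for the maximum principle, not the
    constant. *)
Lemma shift_dist_le u : H1 u -> exists2 C, 0 <= C & forall y, shift_dist u y <= C * `|y| ^+ 2.
Proof.
move=> hu; have su := H1_sqinteg hu.
have : forall s : seq 'I_N, exists2 C, 0 <= C & forall y : V,
    shift_dist u (\sum_(j <- s) y ord0 j *: e_ j) <= C * `|y| ^+ 2.
  elim=> [|j s [C C0 IH]].
    by exists 0 => // y; rewrite big_nil shift_dist0 mul0r.
  have [sg wg] := weak_partial_spec j hu.
  exists (2 * (\int[mu]_x (weak_partial j u x ^+ 2))%R + 2 * C).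
    by rewrite addr_ge0// mulr_ge0//; apply: Rint_ge0 => x; exact: sqr_ge0.
  move=> y; rewrite big_cons; apply: le_trans (shift_distD _ _ su) _.
  have E (a b c : R) : (2 * a + 2 * b) * c = 2 * (a * c) + 2 * (b * c) by ring.
  rewrite E lerD// ler_pM2l//.
  apply: le_trans (shift_dist_line _ su sg wg) _.
  rewrite mulrC ler_wpM2l//; first by apply: Rint_ge0 => x; exact: sqr_ge0.
  rewrite -[leLHS]real_normK ?num_real// lerXn2r ?nnegrE//.
  by have /(cube_norm _ (normr_ge0 y)) := lexx `|y|; exact.
move=> /(_ (index_enum 'I_N))[C C0 H]; exists C => // y.
by have := H y; rewrite -row_sum_delta.
Qed.

End translation.

Lemma ler_eq (R : realType) (x y : R) : x = y -> x <= y.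
Proof. by move=> ->. Qed.

Lemma le_Rintegral_on d (T : measurableType d) (R : realType)
    (mu : {measure set T -> \bar R}) (D : set T) (f g : T -> R) :
  measurable D -> mu.-integrable D (EFin \o f) -> mu.-integrable D (EFin \o g) ->
  (forall x, D x -> f x <= g x) ->
  (\int[mu]_(x in D) f x <= \int[mu]_(x in D) g x)%R.
Proof.
move=> mD fi gi fg; rewrite /Rintegral fine_le//; try exact: integrable_fin_num.
by apply: le_integral => // x; rewrite inE => Dx; rewrite lee_fin fg.
Qed.

(** Since the derivative is known to exist, a one-sided expansion with quadratic remainder
    identifies it. *)
Lemma is_derive0_eq (R : realType) (f : R -> R) (l A D : R) :
  is_derive (0 : R) (1 : R) f l ->
  (forall h, 0 < h <= 1 -> `|f h - f 0 - h * A| <= D * h ^+ 2) -> l = A.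
Proof.
move=> [df dl] H.
have D0 : 0 <= D.
  have := H 1; rewrite ltr01 lexx expr1n mulr1 => /(_ isT); exact: le_trans.
apply/eqP; rewrite -subr_eq0 -normr_le0; apply/ler_addgt0Pl => e e0; rewrite addr0.
have e2 : 0 < e / 2 by rewrite divr_gt0.
move: df => /cvgrPdist_le; rewrite -/(derive _ _ _) dl => /(_ _ e2) [d /= d0 Hd].
pose h := Num.min (d / 2) (Num.min 1 (e / 2 / (D + 1))).
have D1 : 0 < D + 1 by rewrite ltr_wpDl.
have h0 : 0 < h by rewrite /h !lt_min ltr01 !divr_gt0.
have h1 : h <= 1 by rewrite !ge_min lexx orbT.
have hd : h < d by rewrite gt_min; apply/orP; left; rewrite ltr_pdivrMr// ltr_pMr// ltr1n.
have hD : D * h <= e / 2.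
  have : h <= e / 2 / (D + 1) by rewrite !ge_min lexx !orbT.
  rewrite ler_pdivlMr ?ltr_wpDl//; apply: le_trans.
  by rewrite mulrC ler_pM2l// lerDl.
have := Hd h; rewrite /ball/= sub0r normrN gtr0_norm// => /(_ hd (lt0r_neq0 h0)).
rewrite /GRing.scale/= mulr1 addr0 => K1.
have K2 : `|h^-1 * (f h - f 0) - A| <= e / 2.
  apply: le_trans hD.
  have -> : h^-1 * (f h - f 0) - A = h^-1 * (f h - f 0 - h * A).
    by field; rewrite gt_eqF.
  rewrite normrM gtr0_norm ?invr_gt0// ler_pdivrMl//.
  by rewrite (le_trans (H h _)) ?h0 ?h1//; rewrite expr2; apply: ler_eq; ring.
rewrite (splitr e); apply: le_trans (lerD K1 K2).
by apply: le_trans (ler_normD _ _); apply: ler_eq; congr `|_|; ring.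
Qed.

Lemma lipschitz_measurable (R : realType) (f : R -> R) (L : R) :
  (forall a b, `|f b - f a| <= L * `|b - a|) -> measurable_fun setT f.
Proof.
move=> fL; apply: continuous_measurable_fun => x.
apply/cvgrPdist_le => e e0.
have L0 : 0 < `|L| + 1 by rewrite ltr_wpDl.
exists (e / (`|L| + 1)) => /=; first by rewrite divr_gt0.
move=> y /= /ltW; rewrite ler_pdivlMr// => H.
rewrite (le_trans (fL _ _))// (le_trans _ H)// mulrC ler_wpM2l//.
by rewrite (le_trans (ler_norm L))// lerDl.
Qed.

(** * The chain rule for weak derivatives *)

Section chain_rule.
Context {R : realType} {N : nat}.
Local Notation mu := (lebesgue_rV R N).
Local Notation leb := (@lebesgue_measure R).
Local Notation V := 'rV[R]_N.
Variables (F F' : R -> R) (L : R).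
Hypotheses (mF : measurable_fun setT F) (mF' : measurable_fun setT F').
Hypotheses (L0 : 0 <= L) (F_le : forall r, `|F r| <= `|r|) (F'_le1 : forall r, `|F' r| <= 1).
Hypothesis F_taylor : forall a b, `|F b - F a - F' a * (b - a)| <= L * (b - a) ^+ 2.
Hypothesis F'_lip : forall a b, `|F' b - F' a| <= L * `|b - a|.
Variables (i : 'I_N) (u g : V -> R).
Hypotheses (su : sqinteg mu u) (sg : sqinteg mu g) (wg : weak_partial_of i u g).

Lemma chain_sqinteg : sqinteg mu (fun x => F (u x)).
Proof. by apply: (sqinteg_le _ su) => //; apply: measurableT_comp su.1. Qed.

Let mF'u : measurable_fun setT (fun x => F' (u x)).
Proof. exact: measurableT_comp su.1. Qed.

Lemma chain_partial_sqinteg : sqinteg mu (fun x => F' (u x) * g x).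
Proof.
apply: (sqinteg_le _ sg) => [|x]; first by apply: measurable_funM => //; exact: sg.1.
by rewrite normrM ler_piMl.
Qed.

Let G := (\int[mu]_x (g x ^+ 2))%R.

Let G0 : 0 <= G. Proof. by apply: Rint_ge0 => x; exact: sqr_ge0. Qed.

Section test.
Variables (phi : V -> R) (C : R).
Hypotheses (tp : test_function phi) (pC : forall x, `|phi x| <= C).

Let C0 : 0 <= C. Proof. exact: le_trans (pC 0). Qed.

Let psi x := F' (u x) * phi x.

Let spsi : sqinteg mu psi.
Proof.
apply: (sqinteg_le _ (test_sqinteg tp)) => [|x].
  by apply: measurable_funM => //; exact: test_measurable.
by rewrite normrM ler_piMl.
Qed.

(** The constant of [a_near]: the first [G] comes from Young's inequality, the rest from the
    increments of [psi]. *)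
Let E := G + 2 * (L * C) ^+ 2 * G + 2 * (\int[mu]_x (partial i phi x ^+ 2))%R.

Let a s := (\int[mu]_x (psi x * g (x + s *: e_ i)))%R.

Let A := (\int[mu]_x (psi x * g x))%R.

(** An increment of [F'(u) phi] is at most [L C] times that of [u] plus that of [phi], and both obey
    the translation estimate. *)
Let psi_diff s : 0 <= s ->
  (\int[mu]_x ((psi (x - s *: e_ i) - psi x) ^+ 2) <=
  s ^+ 2 * (2 * (L * C) ^+ 2 * G + 2 * (\int[mu]_x (partial i phi x ^+ 2))%R))%R.
Proof.
move=> s0.
have sd f : sqinteg mu f -> sqinteg mu (fun x => f (x - s *: e_ i) - f x).
  by move=> sf; apply: (sqintegB _ sf); exact: sqinteg_shift.
apply: (@le_trans _ _ (\int[mu]_x (2 * (L * C) ^+ 2 * (u (x - s *: e_ i) - u x) ^+ 2 +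
   2 * (phi (x - s *: e_ i) - phi x) ^+ 2))%R).
  apply: Rint_le.
  - exact: (sd _ spsi).2.
  - by apply: integD; apply: integZ; [exact: (sd _ su).2|exact: (sd _ (test_sqinteg tp)).2].
  move=> x; set y := x - s *: e_ i.
  have H : `|psi y - psi x| <= L * C * `|u y - u x| + `|phi y - phi x|.
    have -> : psi y - psi x = (F' (u y) - F' (u x)) * phi y + F' (u x) * (phi y - phi x).
      by rewrite /psi; ring.
    rewrite (le_trans (ler_normD _ _))// lerD// normrM; last by rewrite ler_piMl.
    by rewrite -mulrA (mulrC C) mulrA ler_pM.
  have H2 : (psi y - psi x) ^+ 2 <= (L * C * `|u y - u x| + `|phi y - phi x|) ^+ 2.
    by rewrite -[leLHS]real_normK ?num_real// lerXn2r ?nnegrE// (le_trans _ H).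
  apply: le_trans H2 _.
  rewrite -(real_normK (num_real (u y - u x))) -(real_normK (num_real (phi y - phi x))).
  by have := sqr_ge0 (L * C * `|u y - u x| - `|phi y - phi x|); nra.
rewrite RintD; [|by apply: integZ; exact: (sd _ su).2|by apply: integZ; exact: (sd _ (test_sqinteg tp)).2].
rewrite !RintZ; [|exact: (sd _ (test_sqinteg tp)).2|exact: (sd _ su).2].
have H1 := shift_dist_line (- s) su sg wg.
have H2 := shift_dist_line (- s) (test_sqinteg tp) (test_sqinteg (test_partial i tp)) (weak_partial_of_test i tp).
rewrite /shift_dist scaleNr sqrrN in H1 H2.
rewrite mulrDr; apply: lerD.
  have LC : 0 <= 2 * (L * C) ^+ 2 by rewrite mulr_ge0// sqr_ge0.
  by rewrite [leRHS]mulrCA ler_wpM2l.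
by rewrite [leRHS]mulrCA ler_wpM2l.
Qed.

(** As [g] is only square integrable, its translates converge without a rate. The translation is
    therefore moved onto [psi], whose increments are of order [s]; Young's inequality with weights
    [h] and [1 / h] concludes. *)
Let a_near s h : 0 < h -> 0 <= s <= h -> `|a s - A| <= h * E.
Proof.
move=> h0 /andP[s0 sh].
have spsi' := sqinteg_shift (- (s *: e_ i)) spsi.
have sd := sqintegB spsi' spsi.
have -> : a s - A = (\int[mu]_x ((psi (x - s *: e_ i) - psi x) * g x))%R.
  under [in RHS]eq_Rintegral do rewrite mulrBl.
  rewrite RintB; [|exact: sqintegM|exact: sqintegM]; congr (_ - _).
  rewrite -[RHS](@Rint_shift R N (s *: e_ i)); last first.
    by apply: measurable_funM; [exact: spsi'.1|exact: sg.1].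
  by apply: eq_Rintegral => x _; rewrite addrK.
apply: (@le_trans _ _ (\int[mu]_x (h * g x ^+ 2 + h^-1 * (psi (x - s *: e_ i) - psi x) ^+ 2))%R).
  apply: le_norm_Rint.
  - by apply: measurable_funM; [exact: sd.1|exact: sg.1].
  - by apply: integD; apply: integZ; [exact: sg.2|exact: sd.2].
  move=> x; set z := psi _ - _.
  have := sqr_ge0 (`|z| - h * `|g x|).
  rewrite sqrrB exprMn !real_normK ?num_real// normrM => H.
  rewrite -(ler_pM2l h0) mulrDr (mulrA h h^-1) mulfV ?gt_eqF// mul1r.
  have := normr_ge0 z; have := normr_ge0 (g x); nra.
rewrite RintD; [|by apply: integZ; exact: sg.2|by apply: integZ; exact: sd.2].
rewrite !RintZ; [|exact: sd.2|exact: sg.2].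
rewrite /E -[X in _ <= _ * X]addrA mulrDr lerD2l ler_pdivrMl//.
apply: le_trans (psi_diff s0) _.
rewrite [leRHS]mulrA -expr2 ler_wpM2r//.
  rewrite addr_ge0// ?mulr_ge0// ?sqr_ge0//.
  by apply: Rint_ge0 => x; exact: sqr_ge0.
by rewrite lerXn2r ?nnegrE// ltW.
Qed.

Let avg_near h : 0 < h ->
  `| \int[mu]_x (psi x * line_avg i g h x) - h * A |%R <= h ^+ 2 * E.
Proof.
move=> h0; rewrite (line_avg_fubini i sg (ltW h0) spsi).
have mI : measurable (`[0, h]%classic : set (measurableTypeR R)) by exact: measurable_itv.
have ia := line_avg_integrable i sg (ltW h0) spsi.
have lebI : (leb `[0, h]%classic) = h%:E.
  by rewrite lebesgue_measure_itv/= lte_fin h0 oppr0 adde0.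
have ic c : leb.-integrable (`[0, h]%classic : set (measurableTypeR R)) (EFin \o cst c).
  apply/integrableP; split; first exact: (measurable_cst c%:E).
  have -> : (\int[leb]_(x in `[0%R, h]) `|(EFin \o cst c) x| = `|c|%:E * leb `[0%R, h]%classic)%E.
    by rewrite /= integral_cst.
  by rewrite lebI -EFinM ltry.
have EA c : (\int[leb]_(s in `[0%R, h]) c)%R = h * c.
  by rewrite Rintegral_cst// mulrC; congr (_ * _); exact: (congr1 fine lebI).
rewrite -(EA A) -RintegralB//; last exact: ic.
have iB : leb.-integrable (`[0, h]%classic : set (measurableTypeR R)) (EFin \o (fun s => a s - A)).
  by have := integrableB mI ia (ic A).
apply: le_trans (le_normr_Rintegral mI iB) _.
rewrite expr2 -mulrA -[X in _ <= X]EA.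
apply: le_Rintegral_on => //; [exact: integrable_norm|exact: (ic (h * E))|].
move=> s; rewrite /= in_itv/= => sI; exact: a_near.
Qed.

(** Taylor's formula for [F] at [u x], where the increment of [u] is the line integral of [g] by
    [translation_ae]. The quadratic error is integrable thanks to [translation_sqr_le]. *)
Let remainder h : 0 < h ->
  `| \int[mu]_x (F (u (x + h *: e_ i)) * phi x) - \int[mu]_x (F (u x) * phi x) - h * A |%R
  <= (L * C * G + E) * h ^+ 2.
Proof.
move=> h0; pose w x := u (x + h *: e_ i) - u x.
have sw : sqinteg mu w by apply: (sqintegB _ su); exact: sqinteg_shift.
have sFs := sqinteg_shift (h *: e_ i) chain_sqinteg.
pose T x := (F (u (x + h *: e_ i)) - F (u x) - F' (u x) * w x) * phi x.
have iF1 := test_integM (sqinteg_loc sFs) tp.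
have iF2 := test_integM (sqinteg_loc chain_sqinteg) tp.
have ipw := sqintegM spsi sw.
have -> : (\int[mu]_x (F (u (x + h *: e_ i)) * phi x) - \int[mu]_x (F (u x) * phi x) - h * A)%R
   = (\int[mu]_x T x + (\int[mu]_x (psi x * line_avg i g h x) - h * A))%R.
  have -> : (\int[mu]_x (psi x * line_avg i g h x) = \int[mu]_x (psi x * w x))%R.
    apply: Rint_eq_ae.
    - by apply: measurable_funM; [exact: spsi.1|exact: (line_avg_sqinteg i sg (ltW h0)).1].
    - exact: integ_measurable ipw.
    - by apply: filterS (translation_ae su sg wg h0) => x <-.
  rewrite /T (_ : (\int[mu]_x ((F (u (x + h *: e_ i)) - F (u x) - F' (u x) * w x) * phi x))%R =
    (\int[mu]_x ((F (u (x + h *: e_ i)) * phi x - F (u x) * phi x) - psi x * w x))%R); last first.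
    by apply: eq_Rintegral => x _; rewrite /psi; ring.
  rewrite RintB//; last exact: integB.
  by rewrite RintB//; ring.
apply: le_trans (ler_normD _ _) _; rewrite mulrDl lerD//; last by rewrite [leRHS]mulrC; exact: avg_near.
apply: (@le_trans _ _ (\int[mu]_x (L * C * w x ^+ 2))%R).
  apply: le_norm_Rint.
  - apply: measurable_funM; last exact: test_measurable.
    by apply: measurable_funB; [apply: measurable_funB; [exact: sFs.1|exact: chain_sqinteg.1]|apply: measurable_funM => //; exact: sw.1].
  - by apply: integZ; exact: sw.2.
  move=> x; rewrite /T normrM (mulrAC L C); apply: ler_pM => //.
rewrite RintZ; last exact: sw.2.
rewrite -[leRHS]mulrA ler_wpM2l ?mulr_ge0// [leRHS]mulrC.
exact: (translation_sqr_le su sg wg h0).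
Qed.

(** Translating [phi] by [- h] amounts to translating [F(u)] by [h]. The derivative at 0 is thus
    known from the side of [phi], and from that of [F(u)] by [remainder]. *)
Lemma chain_test : (\int[mu]_x (F (u x) * partial i phi x) = - \int[mu]_x (F' (u x) * g x * phi x))%R.
Proof.
have sF := chain_sqinteg.
pose P s := (\int[mu]_x (F (u x) * phi (x + (- s) *: e_ i)))%R.
have DP : is_derive (0 : R) (1 : R) P (- \int[mu]_x (F (u x) * partial i phi x))%R.
  have -> : (\int[mu]_x (F (u x) * partial i phi x) =
      \int[mu]_x (F (u x) * partial i phi (x + (- 0) *: e_ i)))%R.
    by apply: eq_Rintegral => x _; rewrite oppr0 scale0r addr0.
  exact: is_derive_shift_int.
rewrite -[LHS]opprK; congr (- _).
have -> : (\int[mu]_x (F' (u x) * g x * phi x))%R = A.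
  by apply: eq_Rintegral => x _; rewrite /psi mulrAC.
apply: (is_derive0_eq DP) => h /andP[h0 _]; apply: le_trans (remainder h0).
rewrite /P; apply: ler_eq; congr (`|_ - _ - _|).
  rewrite -(@Rint_shift R N (h *: e_ i)); last first.
    by apply: measurable_funM; [exact: sF.1|exact: measurable_test_line].
  by apply: eq_Rintegral => x _; rewrite scaleNr addrK.
by apply: eq_Rintegral => x _; rewrite oppr0 scale0r addr0.
Qed.

End test.

Lemma weak_partial_of_comp : weak_partial_of i (fun x => F (u x)) (fun x => F' (u x) * g x).
Proof.
apply/(weak_partial_ofP i chain_sqinteg chain_partial_sqinteg) => phi tp.
have [C pC] := test_bound tp; exact: chain_test tp pC.
Qed.

End chain_rule.

(** * A regularised absolute value *)

Section smooth_abs.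
Context {R : realType}.
Variable d : R.
Hypothesis d0 : 0 < d.

(** Subtracting [d] makes it vanish at 0 and stay below [|r|]: it keeps square integrability and the
    zeros of [u]. Its derivative is [smooth_sgn]. *)
Definition smooth_abs (r : R) : R := Num.sqrt (r ^+ 2 + d ^+ 2) - d.
Definition smooth_sgn (r : R) : R := r / Num.sqrt (r ^+ 2 + d ^+ 2).

Let S r := Num.sqrt (r ^+ 2 + d ^+ 2).

Let S_sqr r : S r ^+ 2 = r ^+ 2 + d ^+ 2.
Proof. by rewrite sqr_sqrtr// addr_ge0// sqr_ge0. Qed.

Let S_ge0 r : 0 <= S r. Proof. exact: sqrtr_ge0. Qed.

Let S_ged r : d <= S r.
Proof. by rewrite -(ler_sqr (ltW d0) (S_ge0 r)) S_sqr lerDr sqr_ge0. Qed.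

Let S_gt0 r : 0 < S r. Proof. exact: lt_le_trans (S_ged r). Qed.

Let S_abs r : `|r| <= S r.
Proof. by rewrite -(ler_sqr (normr_ge0 r) (S_ge0 r)) S_sqr real_normK ?num_real// lerDl sqr_ge0. Qed.

Lemma smooth_abs_ge0 r : 0 <= smooth_abs r.
Proof. by rewrite subr_ge0; exact: S_ged. Qed.

Lemma smooth_abs_le r : smooth_abs r <= `|r|.
Proof.
rewrite lerBlDr -(ler_sqr (S_ge0 r)) ?nnegrE ?(addr_ge0 _ (ltW d0))// S_sqr sqrrD.
by rewrite real_normK ?num_real// lerD2r lerDl mulrn_wge0// mulr_ge0// (ltW d0).
Qed.

Lemma smooth_abs_ge r : `|r| - d <= smooth_abs r.
Proof. by rewrite lerD2r. Qed.

Lemma smooth_sgn_le1 r : `|smooth_sgn r| <= 1.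
Proof. by rewrite normrM normfV (gtr0_norm (S_gt0 r)) ler_pdivrMr// mul1r. Qed.

Lemma smooth_abs_lip a b : `|smooth_abs b - smooth_abs a| <= `|b - a|.
Proof.
have -> : smooth_abs b - smooth_abs a = S b - S a by rewrite /smooth_abs /S; ring.
rewrite -(@ler_pXn2r _ 2)// ?nnegrE// !real_normK ?num_real//.
rewrite !sqrrB !S_sqr.
(* The Cauchy-Schwarz inequality for the vectors [(a, d)] and [(b, d)]. *)
suff : a * b + d ^+ 2 <= S a * S b by nra.
rewrite (le_trans (ler_norm _))// -(@ler_pXn2r _ 2)// ?nnegrE ?mulr_ge0//.
rewrite real_normK ?num_real// exprMn !S_sqr.
by have := sqr_ge0 (a - b); have := sqr_ge0 d; nra.
Qed.

(** The remainder equals [(S a S b - a b - d^2) / S a], which is nonnegative by Cauchy-Schwarz. The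
    constant [2 / d] is that of [smooth_sgn_lip], the chain rule taking one [L] for both bounds. *)
Lemma smooth_abs_taylor a b :
  `|smooth_abs b - smooth_abs a - smooth_sgn a * (b - a)| <= 2 / d * (b - a) ^+ 2.
Proof.
have H1 : a * b + d ^+ 2 <= S a * S b.
  rewrite (le_trans (ler_norm _))// -(@ler_pXn2r _ 2)// ?nnegrE ?mulr_ge0//.
  rewrite real_normK ?num_real// exprMn !S_sqr.
  by have := sqr_ge0 (a - b); have := sqr_ge0 d; nra.
have H2 : S a * S b <= a * b + d ^+ 2 + (b - a) ^+ 2.
  have := sqr_ge0 (S a - S b); rewrite sqrrB !S_sqr.
  have := sqr_ge0 (b - a); nra.
have -> : smooth_abs b - smooth_abs a - smooth_sgn a * (b - a) =
   (S a * S b - a * b - d ^+ 2) / S a.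
  have E : S a * S a = a ^+ 2 + d ^+ 2 by rewrite -expr2 S_sqr.
  apply: (mulIf (lt0r_neq0 (S_gt0 a))).
  rewrite mulfVK ?gt_eqF// /smooth_abs /smooth_sgn -/(S a) -/(S b).
  have E2 : a / S a * (b - a) * S a = a * (b - a).
    by field; rewrite gt_eqF.
  rewrite mulrBl E2; nra.
rewrite ger0_norm; last by rewrite divr_ge0//; lra.
rewrite ler_pdivrMr//; apply: (@le_trans _ _ ((b - a) ^+ 2)); first lra.
rewrite -[leLHS]mul1r mulrAC ler_wpM2r ?sqr_ge0//.
by rewrite mulrAC ler_pdivlMr// mul1r (le_trans (S_ged a))// -[leLHS]mul1r ler_wpM2r// ler1n.
Qed.

Lemma smooth_sgn_lip a b : `|smooth_sgn b - smooth_sgn a| <= 2 / d * `|b - a|.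
Proof.
have -> : smooth_sgn b - smooth_sgn a = (b - a) / S b + a / S a * ((S a - S b) / S b).
  by rewrite /smooth_sgn -/(S a) -/(S b); field; rewrite !gt_eqF.
have HV : (S b)^-1 <= d^-1 by rewrite lef_pV2 ?posrE.
have E : 2 / d * `|b - a| = `|b - a| / d + 1 * (`|b - a| / d) by field; rewrite gt_eqF.
rewrite E (le_trans (ler_normD _ _))// lerD//.
  by rewrite normrM normfV (gtr0_norm (S_gt0 b)) ler_wpM2l.
rewrite normrM ler_pM//; first exact: smooth_sgn_le1.
rewrite normrM normfV (gtr0_norm (S_gt0 b)) ler_pM// ?invr_ge0//.
have := smooth_abs_lip b a.
rewrite distrC (distrC a b) => H; apply: le_trans H.
by apply: ler_eq; rewrite distrC; congr `|_|; rewrite /smooth_abs /S; ring.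
Qed.

Lemma smooth_abs_measurable : measurable_fun setT smooth_abs.
Proof. by apply: (@lipschitz_measurable _ _ 1) => a b; rewrite mul1r; exact: smooth_abs_lip. Qed.

Lemma smooth_sgn_measurable : measurable_fun setT smooth_sgn.
Proof. exact: lipschitz_measurable smooth_sgn_lip. Qed.

End smooth_abs.

(** * Nehari sets *)

Section nehari_manifold.
Context {R : realType} {N : nat}.
Local Notation V := 'rV[R]_N.
Variables (p : R) (J A B : (V -> R) -> \bar R).
Hypothesis p1 : 1 < p.
Hypothesis JE : forall u, H1 u -> J u = (2^-1%:E * A u - (p + 1)^-1%:E * B u)%E.
Hypothesis A_gt0 : forall u, H1 u -> ~ ae_zero u -> (0 < A u)%E.
Hypothesis B_gt0 : forall u, H1 u -> ~ ae_zero u -> (0 < B u)%E.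
Hypothesis AZ : forall c u, 0 < c -> H1 u -> A (fun x => c * u x) = ((c ^+ 2)%:E * A u)%E.
Hypothesis BZ : forall c u, 0 < c -> H1 u -> B (fun x => c * u x) = ((c `^ (p + 1))%:E * B u)%E.
Hypothesis H1Z : forall c u, H1 u -> H1 (fun x : V => c * u x).
Hypothesis nzZ : forall c u, 0 < c -> ~ ae_zero u -> ~ ae_zero (fun x : V => c * u x).

Let p10 : 0 < p + 1. Proof. by rewrite addr_gt0// (lt_trans ltr01). Qed.

Let fin_numAB u : H1 u -> ~ ae_zero u -> J u \is a fin_num ->
  exists a b, A u = a%:E /\ B u = b%:E.
Proof.
move=> hu nu; rewrite JE//; have := A_gt0 hu nu; have := B_gt0 hu nu.
case: (A u) => [a||]; case: (B u) => [b||] //.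
- by move=> _ _ _; exists a, b.
- by move=> _ _; rewrite gt0_muley ?lte_fin ?invr_gt0.
- by move=> _ _; rewrite gt0_muley ?lte_fin ?invr_gt0.
(* Here the difference is [+oo - +oo], which is [-oo] by convention, hence not finite. *)
- by move=> _ _; rewrite !gt0_muley ?lte_fin ?invr_gt0.
Qed.

Let JZ u a b c : H1 u -> A u = a%:E -> B u = b%:E -> 0 < c ->
  J (fun x => c * u x) = (2^-1 * (c ^+ 2 * a) - (p + 1)^-1 * (c `^ (p + 1) * b))%:E.
Proof.
move=> hu Ea Eb c0; rewrite JE; last exact: H1Z.
by rewrite AZ// BZ// Ea Eb -!EFinM -EFinB.
Qed.

Let derive_J u a b : H1 u -> A u = a%:E -> B u = b%:E ->
  is_derive (0 : R) (1 : R) (fun t => fine (J (fun x => u x + t * u x))) (a - b).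
Proof.
move=> hu Ea Eb.
pose f (t : R) := 2^-1 * ((1 + t) ^+ 2 * a) - (p + 1)^-1 * ((1 + t) `^ (p + 1) * b).
apply: (@near_eq_is_derive R R R f).
  near=> t; have t1 : 0 < 1 + t.
    rewrite -ltrBlDl sub0r; near: t; exact: lt_nbhsr.
  rewrite (_ : (fun x => _) = (fun x => (1 + t) * u x)); last first.
    by apply/funext => x; rewrite mulrDl mul1r.
  by rewrite (JZ hu Ea Eb).
have D1 : is_derive (0 : R) (1 : R) (fun t : R => 1 + t) 1.
  have := @is_deriveD R R R (cst 1) id 0 1 0 1 (is_derive_cst _ _ _) (is_derive_id _ _).
  by rewrite add0r.
have D2 : is_derive (0 : R) (1 : R) (fun t : R => (1 + t) ^+ 2) 2.
  have := @is_deriveX R R (fun t : R => 1 + t) 2 0 1 1 D1.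
  by rewrite /GRing.scale/= addr0 expr1 !mulr1.
have D3 : is_derive (0 : R) (1 : R) (fun t : R => (1 + t) `^ (p + 1)) (p + 1).
  have g0 : 0 < 1 + (0 : R) by rewrite addr0.
  have := @is_derive1_comp R (fun z : R => z `^ (p + 1)) (fun t : R => 1 + t) 0 _ _ (@is_derive1_powR R (p + 1) (1 + 0) g0) D1.
  by rewrite addr0 powR1 !mulr1.
have -> : f = (2^-1 * a) \*: (fun t : R => (1 + t) ^+ 2) - ((p + 1)^-1 * b) \*: (fun t : R => (1 + t) `^ (p + 1)).
  have E (x y z : R) : x * (y * z) = x * z * y by ring.
  by apply/funext => t; rewrite /f (E 2^-1) (E (p + 1)^-1).
have -> : a - b = (2^-1 * a) *: (2 : R) - ((p + 1)^-1 * b) *: (p + 1).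
  by rewrite /GRing.scale/=; field; rewrite gt_eqF.
by apply: is_deriveB; exact: is_deriveZ.
Unshelve. all: by end_near. Qed.

(** Along the ray [(1 + t) u] the energy has derivative [A u - B u] at 0. The finiteness of [A u]
    and [B u] is part of the Nehari condition: both are positive, and an infinite one would make
    [J u] infinite. *)
Lemma nehariP u : nehari J u <->
  [/\ H1 u, ~ ae_zero u & exists r, A u = r%:E /\ B u = r%:E].
Proof.
split=> [[hu nu [Jfin Jder]]|[hu nu [r [Ea Eb]]]].
  split=> //.
  have E0 : (fun x => u x + 0 * u x) = u by apply/funext => x; rewrite mul0r addr0.
  have := nbhs_singleton Jfin; rewrite E0 => /(fin_numAB hu nu)[a [b [Ea Eb]]].
  have D := derive_J hu Ea Eb.
  have : a - b = 0 by rewrite -(@derive_val _ _ _ _ _ _ _ D) (@derive_val _ _ _ _ _ _ _ Jder).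
  by move=> /eqP; rewrite subr_eq0 => /eqP ab; exists a; rewrite Ea Eb ab.
split=> //; split; last by have := derive_J hu Ea Eb; rewrite subrr.
near=> t; have t1 : 0 < 1 + t.
  rewrite -ltrBlDl sub0r; near: t; exact: lt_nbhsr.
rewrite (_ : (fun x => _) = (fun x => (1 + t) * u x)); last first.
  by apply/funext => x; rewrite mulrDl mul1r.
by rewrite (JZ hu Ea Eb).
Unshelve. all: by end_near. Qed.

Definition nehari_coef : R := 2^-1 - (p + 1)^-1.

Lemma nehari_coef_gt0 : 0 < nehari_coef.
Proof. by rewrite subr_gt0 ltf_pV2 ?posrE//; move: p1; lra. Qed.

Lemma nehari_energy u r : H1 u -> A u = r%:E -> B u = r%:E ->
  J u = (nehari_coef * r)%:E.
Proof.
by move=> hu Ea Eb; rewrite JE// Ea Eb -!EFinM -EFinB /nehari_coef mulrBl.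
Qed.

(** The energy of the projection [t u] when [A u = a] and [B u = b]: the factor
    [t = (a / b)^(1 / (p - 1))] solves [t^2 a = t^(p + 1) b]. *)
Definition nehari_proj (a b : R) : R :=
  nehari_coef * (a * ((a / b) `^ (p - 1)^-1) ^+ 2).

Lemma nehari_level_le u a b : H1 u -> ~ ae_zero u -> A u = a%:E -> B u = b%:E ->
  (nehari_level J <= (nehari_proj a b)%:E)%E.
Proof.
move=> hu nu Ea Eb.
have a0 : 0 < a by rewrite -lte_fin -Ea A_gt0.
have b0 : 0 < b by rewrite -lte_fin -Eb B_gt0.
pose t := (a / b) `^ (p - 1)^-1.
have t0 : 0 < t by rewrite powR_gt0// divr_gt0.
have pm : 0 < p - 1 by rewrite subr_gt0.
have tE : t `^ (p + 1) * b = t ^+ 2 * a.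
  have -> : p + 1 = 2%:R + (p - 1) by ring.
  rewrite powRD; last by rewrite (gt_eqF t0) implybT.
  rewrite powR_mulrn ?ltW// /t -(powRrM _ (p - 1)^-1) mulVf ?gt_eqF// powRr1; last by rewrite ltW// divr_gt0.
  by rewrite -mulrA divfK ?gt_eqF.
have Ea' : A (fun x => t * u x) = (t ^+ 2 * a)%:E by rewrite AZ// Ea -EFinM.
have Eb' : B (fun x => t * u x) = (t ^+ 2 * a)%:E by rewrite BZ// Eb -EFinM tE.
apply: ereal_inf_lbound; exists (fun x => t * u x).
  apply/nehariP; split; [exact: H1Z|exact: nzZ|by exists (t ^+ 2 * a)].
rewrite (nehari_energy (H1Z _ hu) Ea' Eb') /nehari_proj -/t.
by rewrite (mulrC (t ^+ 2)).
Qed.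

End nehari_manifold.

(** * The four terms of the energy *)

Section energies.
Context {R : realType} {N : nat}.
Local Notation mu := (lebesgue_rV R N).
Local Notation V := 'rV[R]_N.
Implicit Types (u a b : V -> R).

Lemma H1Z c u : H1 u -> H1 (fun x => c * u x).
Proof.
move=> hu; apply: (@H1I _ _ _ (fun i x => c * weak_partial i u x)).
- exact: sqintegZ (H1_sqinteg hu).
- by move=> i; have [sg _] := weak_partial_spec i hu; exact: sqintegZ.
- move=> i; have [sg wg] := weak_partial_spec i hu.
  exact: (weak_partial_ofZ c (H1_sqinteg hu) sg wg).
Qed.

Lemma H1_shift y u : H1 u -> H1 (fun x => u (x + y)).
Proof.
move=> hu; apply: (@H1I _ _ _ (fun i x => weak_partial i u (x + y))).
- exact: sqinteg_shift (H1_sqinteg hu).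
- by move=> i; have [sg _] := weak_partial_spec i hu; exact: (sqinteg_shift y sg).
- move=> i; have [sg wg] := weak_partial_spec i hu.
  exact: (weak_partial_of_shift y (H1_sqinteg hu) sg wg).
Qed.

Lemma ae_zeroZ c u : 0 < c -> ae_zero (fun x => c * u x) -> ae_zero u.
Proof.
move=> c0; apply: filterS => x /eqP; rewrite mulf_eq0 gt_eqF//= => /eqP.
exact.
Qed.

Lemma sqr_grad_ge0 u x : 0 <= sqr_grad u x.
Proof. by apply: sumr_ge0 => i _; exact: sqr_ge0. Qed.

Lemma integ_sqr_grad u : H1 u -> integ mu (sqr_grad u).
Proof.
move=> hu; apply: integ_sum => i.
by have [[_ ?] _] := weak_partial_spec i hu.
Qed.

Lemma sqr_gradZ c u : H1 u ->
  (\int[mu]_x sqr_grad (fun x => c * u x) x = c ^+ 2 * \int[mu]_x sqr_grad u x)%R.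
Proof.
move=> hu; rewrite -RintZ; last exact: integ_sqr_grad.
apply: Rint_eq_ae.
- exact: integ_measurable (integ_sqr_grad (H1Z c hu)).
- by apply: measurable_funM => //; exact: integ_measurable (integ_sqr_grad hu).
have sg i : sqinteg mu (fun x => c * weak_partial i u x).
  by apply: sqintegZ; exact: (weak_partial_spec i hu).1.
have wg i : weak_partial_of i (fun x => c * u x) (fun x => c * weak_partial i u x).
  have [s w] := weak_partial_spec i hu.
  exact: (weak_partial_ofZ c (H1_sqinteg hu) s w).
apply: filterS (sqr_grad_ae (H1Z c hu) sg wg) => x ->.
by rewrite /sqr_grad mulr_sumr; apply: eq_bigr => i _; rewrite exprMn.
Qed.

Lemma sqr_grad_shift y u : H1 u ->
  (\int[mu]_x sqr_grad (fun x => u (x + y)) x = \int[mu]_x sqr_grad u x)%R.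
Proof.
move=> hu; have mg := integ_measurable (integ_sqr_grad hu).
rewrite -[RHS](@Rint_shift R N y)//.
apply: Rint_eq_ae.
- exact: integ_measurable (integ_sqr_grad (H1_shift y hu)).
- by apply: measurableT_comp mg _; exact: measurable_rV_add.
have sg i : sqinteg mu (fun x => weak_partial i u (x + y)).
  exact: (sqinteg_shift y (weak_partial_spec i hu).1).
have wg i : weak_partial_of i (fun x => u (x + y)) (fun x => weak_partial i u (x + y)).
  have [s w] := weak_partial_spec i hu.
  exact: (weak_partial_of_shift y (H1_sqinteg hu) s w).
exact: sqr_grad_ae (H1_shift y hu) sg wg.
Qed.

Lemma sqr_int_gt0 u : sqinteg mu u -> ~ ae_zero u -> (0 < \int[mu]_x (u x ^+ 2))%R.
Proof.
move=> su nu; rewrite lt_neqAle Rint_ge0 ?andbT; last by move=> x; exact: sqr_ge0.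
apply/negP => /eqP E; apply: nu.
have H : (\int[mu]_x `|(u x ^+ 2)%:E| = 0)%E.
  under eq_integral do rewrite gee0_abs ?lee_fin ?sqr_ge0//.
  have iu2 : integ mu (fun x => u x ^+ 2) := su.2.
  by rewrite (integ_fin iu2) -E.
have mE : measurable_fun setT (fun x => (u x ^+ 2)%:E).
  by apply/measurable_EFinP; exact: integ_measurable su.2.
have /(ae_eq_integral_abs mu measurableT mE) := H.
by apply: filterS => x /(_ I) [] /eqP; rewrite sqrf_eq0 => /eqP.
Qed.

Variables (p ai bi C : R).
Hypotheses (p1 : 1 < p) (ai0 : 0 < ai) (bi0 : 0 < bi) (C0 : 0 <= C).

Definition base u : R := (\int[mu]_x (sqr_grad u x + ai * u x ^+ 2))%R.
(** With [|a|] the integrand is nonnegative everywhere, whereas [a] is so only almost everywhere;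
    the rules for nonnegative integrals then apply without integrability. Likewise for [wpower]. *)
Definition potential a u : \bar R := (\int[mu]_x (`|a x| * u x ^+ 2)%:E)%E.
Definition power u : \bar R := (\int[mu]_x (`|u x| `^ (p + 1))%:E)%E.
Definition wpower b u : \bar R := (\int[mu]_x (`|b x| * `|u x| `^ (p + 1))%:E)%E.

Lemma integ_base u : H1 u -> integ mu (fun x => sqr_grad u x + ai * u x ^+ 2).
Proof.
move=> hu; apply: integD; first exact: integ_sqr_grad.
by apply: integZ; exact: (H1_sqinteg hu).2.
Qed.

Lemma baseE u : H1 u ->
  base u = (\int[mu]_x sqr_grad u x + ai * \int[mu]_x (u x ^+ 2))%R.
Proof.
move=> hu; rewrite /base RintD ?RintZ//; first exact: (H1_sqinteg hu).2.
- exact: integ_sqr_grad.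
- by apply: integZ; exact: (H1_sqinteg hu).2.
Qed.

Lemma baseZ c u : H1 u -> base (fun x => c * u x) = c ^+ 2 * base u.
Proof.
move=> hu; rewrite !baseE//; last exact: H1Z.
rewrite sqr_gradZ//; under [X in _ + _ * X]eq_Rintegral do rewrite exprMn.
by rewrite RintZ; [ring|exact: (H1_sqinteg hu).2].
Qed.

Lemma base_shift y u : H1 u -> base (fun x => u (x + y)) = base u.
Proof.
move=> hu; rewrite !baseE//; last exact: H1_shift.
rewrite sqr_grad_shift// (@Rint_shift R N y (fun x => u x ^+ 2))//.
exact: integ_measurable (H1_sqinteg hu).2.
Qed.

Lemma base_gt0 u : H1 u -> ~ ae_zero u -> 0 < base u.
Proof.
move=> hu nu; rewrite baseE// ltr_wpDl//.
  by apply: Rint_ge0 => x; exact: sqr_grad_ge0.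
by rewrite mulr_gt0// sqr_int_gt0//; exact: H1_sqinteg.
Qed.

Lemma potential_ge0 a u : (0 <= potential a u)%E.
Proof. by apply: integral_ge0 => x _; rewrite lee_fin mulr_ge0// sqr_ge0. Qed.

Lemma measurable_potential a u : measurable_fun setT a -> measurable_fun setT u ->
  measurable_fun setT (fun x => `|a x| * u x ^+ 2).
Proof.
move=> ma mu_; apply: measurable_funM; first exact: measurableT_comp.
exact: measurable_funX.
Qed.

Lemma potentialZ a c u : measurable_fun setT a -> measurable_fun setT u ->
  potential a (fun x => c * u x) = ((c ^+ 2)%:E * potential a u)%E.
Proof.
move=> ma mu_; rewrite /potential -ge0_integral_cstM ?sqr_ge0//.
- by apply: eq_integral => x _; rewrite exprMn mulrCA.
- exact: measurable_potential.
- by move=> x; rewrite mulr_ge0// sqr_ge0.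
Qed.

Lemma measurable_power u : measurable_fun setT u ->
  measurable_fun setT (fun x => `|u x| `^ (p + 1)).
Proof.
move=> mu_; apply: (@measurableT_comp _ _ _ _ _ _ (fun z : R => z `^ (p + 1))) => //.
exact: measurableT_comp.
Qed.

Lemma measurable_wpower b u : measurable_fun setT b -> measurable_fun setT u ->
  measurable_fun setT (fun x => `|b x| * `|u x| `^ (p + 1)).
Proof.
move=> mb mu_; apply: measurable_funM; first exact: measurableT_comp.
exact: measurable_power.
Qed.

Lemma power_ge0 u : (0 <= power u)%E.
Proof. by apply: integral_ge0 => x _; rewrite lee_fin powR_ge0. Qed.

Lemma wpower_ge0 b u : (0 <= wpower b u)%E.
Proof. by apply: integral_ge0 => x _; rewrite lee_fin mulr_ge0// powR_ge0. Qed.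

Lemma powerZ c u : 0 <= c -> measurable_fun setT u ->
  power (fun x => c * u x) = ((c `^ (p + 1))%:E * power u)%E.
Proof.
move=> c0 mu_; rewrite /power -ge0_integral_cstM ?powR_ge0//.
- by apply: eq_integral => x _; rewrite normrM ger0_norm// powRM.
- exact: measurable_power.
Qed.

Lemma wpowerZ b c u : 0 <= c -> measurable_fun setT b -> measurable_fun setT u ->
  wpower b (fun x => c * u x) = ((c `^ (p + 1))%:E * wpower b u)%E.
Proof.
move=> c0 mb mu_; rewrite /wpower -ge0_integral_cstM ?powR_ge0//.
- by apply: eq_integral => x _; rewrite normrM ger0_norm// powRM// mulrCA.
- exact: measurable_wpower.
Qed.

Lemma power_shift y u : measurable_fun setT u -> power (fun x => u (x + y)) = power u.
Proof.
move=> mu_; rewrite /power (@integral_shift R N y (fun x => `|u x| `^ (p + 1)))//.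
exact: measurable_power.
Qed.

Lemma power_gt0 u : measurable_fun setT u -> ~ ae_zero u -> (0 < power u)%E.
Proof.
move=> mu_ nu; rewrite lt_neqAle power_ge0 andbT; apply/negP => /eqP E; apply: nu.
have H : (\int[mu]_x `|(`|u x| `^ (p + 1))%:E| = 0)%E.
  by under eq_integral do rewrite gee0_abs ?lee_fin ?powR_ge0//; exact: (esym E).
have mE : measurable_fun setT (fun x => (`|u x| `^ (p + 1))%:E).
  by apply/measurable_EFinP; exact: measurable_power.
have /(ae_eq_integral_abs mu measurableT mE) := H.
by apply: filterS => x /(_ I) [] /powR_eq0_eq0 /eqP; rewrite normr_eq0 => /eqP.
Qed.

Lemma wpower_le b u : measurable_fun setT b -> measurable_fun setT u ->
  (\forall x \ae mu, `|b x| <= C) -> (wpower b u <= C%:E * power u)%E.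
Proof.
move=> mb mu_ bC; rewrite /power -ge0_integral_cstM//; last exact: measurable_power.
apply: ae_ge0_le_integral => //.
- by apply/measurable_EFinP; exact: measurable_wpower.
- by move=> x _; rewrite lee_fin mulr_ge0// powR_ge0.
- by apply/measurable_EFinP; apply: measurable_funM => //; exact: measurable_power.
- by apply: filterS bC => x bx _; rewrite lee_fin ler_wpM2r// powR_ge0.
Qed.

Lemma potentialE a l u : measurable_fun setT a -> ae_nonneg a -> 0 <= l -> H1 u ->
  (\int[mu]_x (sqr_grad u x + (ai + l * a x) * u x ^+ 2)%:E =
   (base u)%:E + l%:E * potential a u)%E.
Proof.
move=> ma a0 l0 hu; have mu_ := (H1_sqinteg hu).1.
have mp := measurable_potential ma mu_.
have mb := integ_measurable (integ_base hu).
rewrite /base -integ_fin; last exact: integ_base.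
rewrite /potential -ge0_integral_cstM//; last by move=> x; rewrite mulr_ge0// sqr_ge0.
rewrite -ge0_integralD//; last 4 first.
- by move=> x _; rewrite lee_fin addr_ge0 ?sqr_grad_ge0// mulr_ge0 ?sqr_ge0// ltW.
- exact/measurable_EFinP.
- by move=> x _; rewrite lee_fin mulr_ge0// mulr_ge0// sqr_ge0.
- by apply/measurable_EFinP; exact: measurable_funM.
apply: ae_eq_integral => //.
- apply/measurable_EFinP; apply: measurable_funD.
    exact: integ_measurable (integ_sqr_grad hu).
  apply: measurable_funM; last exact: measurable_funX.
  by apply: measurable_funD => //; exact: measurable_funM.
- apply: emeasurable_funD; first exact/measurable_EFinP.
  by apply/measurable_EFinP; exact: measurable_funM.
apply: filterS a0 => x ax _; rewrite -EFinD ger0_norm//; congr (_%:E); ring.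
Qed.

Lemma wpowerE b u : measurable_fun setT b -> ae_nonneg b -> H1 u ->
  (\int[mu]_x ((bi + b x) * `|u x| `^ (p + 1))%:E = bi%:E * power u + wpower b u)%E.
Proof.
move=> mb b0 hu; have mu_ := (H1_sqinteg hu).1.
have mw := measurable_wpower mb mu_; have mp := measurable_power mu_.
rewrite /power -ge0_integral_cstM//; last exact: ltW.
rewrite /wpower -ge0_integralD//; last 3 first.
- by move=> x _; rewrite lee_fin mulr_ge0 ?powR_ge0// ltW.
- by apply/measurable_EFinP; exact: measurable_funM.
- exact/measurable_EFinP.
apply: ae_eq_integral => //.
- apply/measurable_EFinP; apply: measurable_funM => //.
  exact: measurable_funD.
- by apply: emeasurable_funD; apply/measurable_EFinP => //; exact: measurable_funM.
by apply: filterS b0 => x bx _; rewrite /= (ger0_norm bx) mulrDl.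
Qed.

End energies.

(** * Strong maximum principle *)

Section cutoff.
Context {R : realType}.
Variable e : R.
Hypothesis e01 : 0 < e <= 1.
Implicit Types s t : R.

(** Positive exactly on []-1/e, 1/e[]. The derivatives [cutoff1] and [cutoff2] are written out
    because they have to be compared with [cutoff] itself. *)
Definition cutoff t : R := flat 0 (1 + e * t) * flat 0 (1 - e * t).

Definition cutoff1 t : R :=
  e * (flat 2 (1 + e * t) * flat 0 (1 - e * t) - flat 0 (1 + e * t) * flat 2 (1 - e * t)).

Definition cutoff2 t : R :=
  e ^+ 2 * ((flat 4 (1 + e * t) - 2 * flat 3 (1 + e * t)) * flat 0 (1 - e * t)
          - 2 * (flat 2 (1 + e * t) * flat 2 (1 - e * t))
          + flat 0 (1 + e * t) * (flat 4 (1 - e * t) - 2 * flat 3 (1 - e * t))).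

Let is_derive_flat_affine k (c : R) t : is_derive t (1 : R) (fun t => flat k (1 + c * t))
  (c * (flat k.+2 (1 + c * t) - k%:R * flat k.+1 (1 + c * t))).
Proof.
have D1 := @is_derive_flat R k (1 + c * t).
have D2 : is_derive t (1 : R) (fun t => 1 + c * t) c.
  rewrite (_ : (fun t => _) = cst 1 + c \*: id)//.
  by apply: is_derive_eq; rewrite add0r /GRing.scale/= mulr1.
have D := @is_derive1_comp _ (flat k) (fun t => 1 + c * t) t _ _ D1 D2.
apply: (is_derive_eq D); ring.
Qed.

Let is_derive_flatP k t := is_derive_flat_affine k e t.

Let is_derive_flatM k t : is_derive t (1 : R) (fun t => flat k (1 - e * t))
  (- e * (flat k.+2 (1 - e * t) - k%:R * flat k.+1 (1 - e * t))).
Proof.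
have := is_derive_flat_affine k (- e) t.
rewrite (_ : (fun t => flat k (1 + - e * t)) = (fun t => flat k (1 - e * t))); last first.
  by apply/funext => x; rewrite mulNr.
by rewrite (mulNr e t).
Qed.

Lemma is_derive_cutoff t : is_derive t (1 : R) cutoff (cutoff1 t).
Proof.
have D1 := is_derive_flatP 0 t; have D2 := is_derive_flatM 0 t.
apply: (is_derive_eq (is_deriveM D1 D2)); rewrite /cutoff1 /GRing.scale/=; ring.
Qed.

Lemma is_derive_cutoff1 t : is_derive t (1 : R) cutoff1 (cutoff2 t).
Proof.
have D1 := is_derive_flatP 0 t; have D2 := is_derive_flatM 0 t.
have D3 := is_derive_flatP 2 t; have D4 := is_derive_flatM 2 t.
have D := is_deriveZ e (is_deriveB (is_deriveM D3 D2) (is_deriveM D1 D4)).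
apply: (is_derive_eq D); rewrite /cutoff2 /GRing.scale/=; ring.
Qed.

Lemma smooth1_cutoff : smooth1 cutoff.
Proof.
move=> n; apply: n_derivableM.
  apply: (@n_derivable_ext _ n (fun t => flat 0 (e * t + 1))).
    by move=> t; rewrite addrC.
  exact/n_derivable_comp_affine/n_derivable_flat.
apply: (@n_derivable_ext _ n (fun t => flat 0 (- e * t + 1))).
  by move=> t; rewrite addrC mulNr.
exact/n_derivable_comp_affine/n_derivable_flat.
Qed.

Lemma cutoff_ge0 t : 0 <= cutoff t.
Proof. by rewrite mulr_ge0// flat_ge0. Qed.

Lemma cutoff_le1 t : cutoff t <= 1.
Proof. by rewrite -[leRHS]mulr1 ler_pM ?flat_ge0 ?flat0_le1. Qed.

Let e0 : 0 < e. Proof. by case/andP: e01. Qed.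

Lemma cutoff_gt0 t : `|t| < e^-1 -> 0 < cutoff t.
Proof.
rewrite -(ltr_pM2l e0) mulfV ?gt_eqF// => H.
have : `|e * t| < 1 by rewrite normrM (gtr0_norm e0).
by rewrite ltr_norml => /andP[? ?]; rewrite mulr_gt0// flat_gt0//; lra.
Qed.

Lemma cutoff_eq0 t : e^-1 <= `|t| -> cutoff t = 0.
Proof.
rewrite -(ler_pM2l e0) mulfV ?gt_eqF// => H.
have : 1 <= `|e * t| by rewrite normrM (gtr0_norm e0).
rewrite ler_normr => /orP[] H1; rewrite /cutoff.
  by rewrite [flat _ (1 - _)]flat_le0 ?mulr0//; lra.
by rewrite flat_le0 ?mul0r//; lra.
Qed.

Let flat_pow k s : 0 < s -> flat k s = s^-1 ^+ k * flat 0 s.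
Proof. by move=> s0; rewrite /flat s0 expr0 mul1r. Qed.

Let cutoff_eq t : (0 < 1 + e * t /\ 0 < 1 - e * t) \/
  (forall k l, flat k (1 + e * t) * flat l (1 - e * t) = 0).
Proof.
have [t1|t1] := leP (1 + e * t) 0; first by right => k l; rewrite flat_le0// mul0r.
have [t2|t2] := leP (1 - e * t) 0; last by left.
by right => k l; rewrite [flat l _]flat_le0// mulr0.
Qed.

(** The cut-off is even and decreases with [|t|]. This gives the cross term between Gaussian and
    cut-off a favourable sign in [heat2_ge]. *)
Lemma mul_cutoff1_le0 t : t * cutoff1 t <= 0.
Proof.
rewrite /cutoff1; have [[t1 t2]|E] := cutoff_eq t; last by rewrite !E; lra.
rewrite !(flat_pow 2)//.
set P := (1 + e * t)^-1; set Q := (1 - e * t)^-1.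
rewrite (_ : _ * _ = e * t * (P ^+ 2 - Q ^+ 2) * (flat 0 (1 + e * t) * flat 0 (1 - e * t))); last by ring.
rewrite mulr_le0_ge0 ?mulr_ge0 ?flat_ge0//.
have P0 : 0 < P by rewrite invr_gt0.
have Q0 : 0 < Q by rewrite invr_gt0.
have PE : P - Q = - 2 * (e * t) * (P * Q).
  by rewrite /P /Q; field; rewrite !gt_eqF.
rewrite subr_sqr PE.
rewrite [leLHS](_ : _ = - (2 * (e * t) ^+ 2 * (P * Q) * (P + Q))); last by ring.
rewrite oppr_le0; apply: mulr_ge0; last by rewrite addr_ge0// ltW.
by apply: mulr_ge0; rewrite mulr_ge0 ?sqr_ge0// ltW.
Qed.

(** Where the cut-off is positive, the ratio is [e^2] times a polynomial in [m] that is bounded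
    below by completing squares, and [e <= 1]. The value 9 is not sharp; what counts is that it does
    not depend on [e]. *)
Lemma cutoff2_ge t : - 9 * cutoff t <= cutoff2 t.
Proof.
rewrite /cutoff2 /cutoff; have [[t1 t2]|E] := cutoff_eq t; last first.
  rewrite (_ : e ^+ 2 * _ = 0) ?E ?mulr0//.
  rewrite mulrBl mulrBr -!mulrA !E [_ * (2 * _)]mulrCA !E; ring.
rewrite !(flat_pow 2)// !(flat_pow 3)// !(flat_pow 4)//.
set P := (1 + e * t)^-1; set Q := (1 - e * t)^-1.
set z := flat 0 (1 + e * t) * flat 0 (1 - e * t).
rewrite [leRHS](_ : _ = e ^+ 2 * (P ^+ 4 - 2 * P ^+ 3 - 2 * P ^+ 2 * Q ^+ 2 + Q ^+ 4 - 2 * Q ^+ 3) * z); last by rewrite /z; ring.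
apply: ler_wpM2r; first exact: cutoff_ge0.
(* By this relation a symmetric polynomial in [P] and [Q] depends on [m = P Q] alone. *)
have PE : P + Q = 2 * (P * Q) by rewrite /P /Q; field; rewrite !gt_eqF.
pose m := P * Q.
have -> : P ^+ 4 - 2 * P ^+ 3 - 2 * P ^+ 2 * Q ^+ 2 + Q ^+ 4 - 2 * Q ^+ 3 =
    (4 * m ^+ 2 - 4 * m - 1) ^+ 2 + 4 * (m - 1) ^+ 2 + 4 - 9.
  have -> : P ^+ 4 - 2 * P ^+ 3 - 2 * P ^+ 2 * Q ^+ 2 + Q ^+ 4 - 2 * Q ^+ 3 =
    (P + Q) ^+ 4 - 4 * m * (P + Q) ^+ 2 - 2 * (P + Q) ^+ 3 + 6 * m * (P + Q) by rewrite /m; ring.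
  by rewrite PE -/m; ring.
set X := _ ^+ 2 + _ + 4.
have X0 : 0 <= X.
  by have := sqr_ge0 (4 * m ^+ 2 - 4 * m - 1); have := sqr_ge0 (m - 1); rewrite /X; lra.
have e2 : e ^+ 2 <= 1 by case/andP: e01 => _ e1; rewrite exprn_ile1// ltW.
have := sqr_ge0 e; nra.
Qed.

End cutoff.

(** * The cut-off Gaussian in one variable *)

Section heat.
Context {R : realType}.
Variable e : R.
Hypothesis e01 : 0 < e <= 1.
Implicit Types s t : R.

(* The Gaussian [k * exp (- (k t)^2)], cut off, with [k = exp s]. *)
Definition heat s t : R := expR (s - expR (2 * s) * t ^+ 2) * cutoff e t.

Definition heat1 s t : R :=
  expR (s - expR (2 * s) * t ^+ 2) * (cutoff1 e t - 2 * expR (2 * s) * t * cutoff e t).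

Definition heat2 s t : R := expR (s - expR (2 * s) * t ^+ 2) *
  (cutoff2 e t - 4 * expR (2 * s) * (t * cutoff1 e t)
   + (4 * expR (2 * s) ^+ 2 * t ^+ 2 - 2 * expR (2 * s)) * cutoff e t).

Let is_derive_gauss s t : is_derive t (1 : R) (fun t => expR (s - expR (2 * s) * t ^+ 2))
  (expR (s - expR (2 * s) * t ^+ 2) * (- 2 * expR (2 * s) * t)).
Proof.
have D2 : is_derive t (1 : R) (fun t => s - expR (2 * s) * t ^+ 2) (- 2 * expR (2 * s) * t).
  rewrite (_ : (fun t => _) = cst s - expR (2 * s) \*: (id ^+ 2))//.
  by apply: is_derive_eq; rewrite sub0r /GRing.scale/= mulr1 expr1; ring.
exact: (@is_derive1_comp _ expR (fun t => s - expR (2 * s) * t ^+ 2) t _ _ (is_derive_expR _) D2).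
Qed.

Lemma is_derive_heat s t : is_derive t (1 : R) (heat s) (heat1 s t).
Proof.
have D := is_deriveM (is_derive_gauss s t) (is_derive_cutoff e t).
apply: (is_derive_eq D); rewrite /heat1 /GRing.scale/=; ring.
Qed.

Lemma is_derive_heat1 s t : is_derive t (1 : R) (heat1 s) (heat2 s t).
Proof.
have D0 : is_derive t (1 : R) (fun t => 2 * expR (2 * s) * t) (2 * expR (2 * s)).
  rewrite (_ : (fun t => _) = (2 * expR (2 * s)) \*: id)//.
  by apply: is_derive_eq; rewrite /GRing.scale/= mulr1.
have D1 := is_deriveB (is_derive_cutoff1 e t) (is_deriveM D0 (is_derive_cutoff e t)).
have D := is_deriveM (is_derive_gauss s t) D1.
apply: (is_derive_eq D); rewrite /heat2 /GRing.scale/= !fctE; ring.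
Qed.

(** The Gaussian contributes [4 k^4 t^2 - 2 k^2] exactly, the cross term is nonnegative by
    [mul_cutoff1_le0], and the cut-off costs at most 9. *)
Lemma heat2_ge s t :
  (4 * expR (2 * s) ^+ 2 * t ^+ 2 - 2 * expR (2 * s) - 9) * heat s t <= heat2 s t.
Proof.
rewrite /heat /heat2 mulrCA ler_wpM2l ?expR_ge0//.
have := cutoff2_ge e01 t; have := mul_cutoff1_le0 e t; have := expR_ge0 (2 * s).
set q := expR _ => q0 H1 H2.
have : q * (t * cutoff1 e t) <= 0 by rewrite mulr_ge0_le0.
lra.
Qed.

Lemma heat_ge0 s t : 0 <= heat s t.
Proof. by rewrite mulr_ge0 ?expR_ge0 ?cutoff_ge0. Qed.

Lemma heat_eq0 s t : e^-1 < `|t| -> heat s t = 0.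
Proof. by move=> /ltW et; rewrite /heat cutoff_eq0// mulr0. Qed.

Lemma smooth1_heat s : smooth1 (heat s).
Proof.
move=> n; apply: n_derivableM; last exact: smooth1_cutoff.
apply: (@n_derivable_expR _ n (fun t => s - expR (2 * s) * t ^+ 2)).
apply: n_derivableD; first exact: n_derivable_cst.
apply: (@n_derivable_ext _ n (fun t => - expR (2 * s) * (t * t))).
  by move=> t; rewrite -expr2 mulNr.
apply: n_derivableM; first exact: n_derivable_cst.
by apply: n_derivableM; exact: n_derivable_id.
Qed.

End heat.

(** Up to the constant, the normal density of standard deviation [exp (- s)]. The exponent is half
    that of [heat]: the other half pays for the factor [|y|^2] in [inner_le]. *)
Lemma integral_gauss (R : realType) (s : R) :
  (\int[lebesgue_measure]_t (expR (s - expR (2 * s) * t ^+ 2 / 2))%:E = (Num.sqrt (pi *+ 2))%:E)%E.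
Proof.
set sqrt2pi := Num.sqrt _.
have s0 : expR (- s) != 0 by rewrite gt_eqF// expR_gt0.
have pi2 : 0 < (pi : R) *+ 2 by rewrite mulrn_wgt0// pi_gt0.
have E t : expR (s - expR (2 * s) * t ^+ 2 / 2) = sqrt2pi * normal_pdf 0 (expR (- s)) t.
  rewrite normal_pdfE// /normal_peak /normal_fun subr0.
  have -> : Num.sqrt (expR (- s) ^+ 2 * pi *+ 2) = expR (- s) * sqrt2pi.
    by rewrite -mulrnAr sqrtrM ?sqr_ge0// sqrtr_sqr ger0_norm// expR_ge0.
  have r0 : sqrt2pi != 0 by rewrite gt_eqF// sqrtr_gt0.
  have -> : expR (- s) ^+ 2 = (expR (2 * s))^-1 by rewrite -expRN -expRM_natl mulrN.
  have -> : - t ^+ 2 / ((expR (2 * s))^-1 *+ 2) = - (expR (2 * s) * t ^+ 2 / 2).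
    by field; rewrite gt_eqF// expR_gt0.
  by rewrite expRD !expRN; field; rewrite r0 !gt_eqF ?expR_gt0.
under eq_integral do rewrite E.
rewrite ge0_integral_cstM ?integral_normal_pdf ?mule1//.
- exact: sqrtr_ge0.
- exact: measurable_normal_pdf.
- by move=> t; exact: normal_pdf_ge0.
Qed.

(** * The kernel in dimension [N] and its monotonicity *)

Section kernel.
Context {R : realType} {N : nat}.
Local Notation mu := (lebesgue_rV R N).
Local Notation V := 'rV[R]_N.
Implicit Types (s t : R) (x y : V).

Definition laplacian (phi : V -> R) : V -> R := fun x => \sum_i partial i (partial i phi) x.

Lemma laplacian_shift phi y x : laplacian (fun z => phi (z + y)) x = laplacian phi (x + y).
Proof.
apply: eq_bigr => i _.
have -> : partial i (fun z => phi (z + y)) = fun z => partial i phi (z + y).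
  by apply/funext => z; exact: partial_shift.
exact: (partial_shift (partial i phi)).
Qed.

Lemma integ_laplacian c f phi : locinteg f -> test_function phi ->
  integ mu (fun x => f x * (c * phi x - laplacian phi x)).
Proof.
move=> lf tp.
rewrite (_ : (fun x => _) = (fun x => c * (f x * phi x) - \sum_i f x * partial i (partial i phi) x)).
  apply: integB; first by apply: integZ; exact: test_integM.
  apply: integ_sum => i; apply: test_integM => //.
  by do 2 apply: test_partial.
by apply/funext => x; rewrite mulrBr mulr_sumr mulrCA.
Qed.

(** The squared Euclidean norm, which governs the Gaussian, whereas [|x|] is the sup norm. *)
Definition sumsq x : R := \sum_i x ord0 i ^+ 2.

Lemma sumsq_ge0 x : 0 <= sumsq x.
Proof. by apply: sumr_ge0 => i _; exact: sqr_ge0. Qed.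

Lemma norm_le_sumsq x : `|x| ^+ 2 <= sumsq x.
Proof.
have : `|x| <= Num.sqrt (sumsq x).
  rewrite -cube_norm ?sqrtr_ge0// => i.
  rewrite -(ler_pXn2r (n := 2))// ?nnegrE ?sqrtr_ge0// sqr_sqrtr ?sumsq_ge0//.
  rewrite real_normK ?num_real// /sumsq (bigD1 i)//= lerDl.
  by apply: sumr_ge0 => j _; exact: sqr_ge0.
by rewrite -(ler_pXn2r (n := 2)) ?nnegrE ?sqrtr_ge0// sqr_sqrtr ?sumsq_ge0.
Qed.

Lemma measurable_sumsq : measurable_fun setT sumsq.
Proof.
by apply: measurable_sum => i; apply: measurable_funX; exact: measurable_coord_rV.
Qed.

Variables (n : nat) (c : R).
Hypothesis c0 : 0 <= c.

Let e : R := n.+1%:R^-1.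

Let e01 : 0 < e <= 1.
Proof. by rewrite invr_gt0 ltr0Sn/= invf_le1 ?ltr0Sn// ler1n. Qed.

Definition heatN s : V -> R := prodf (fun=> heat e s).

Let Z y : R := \prod_i cutoff e (y ord0 i).

Let Z_ge0 y : 0 <= Z y.
Proof. by apply: prodr_ge0 => i _; exact: cutoff_ge0. Qed.

Let Z_le1 y : Z y <= 1.
Proof.
have : Z y <= \prod_(i < N) 1 by apply: ler_prod => i _; rewrite cutoff_ge0 cutoff_le1.
by rewrite prodr_const expr1n.
Qed.

Let Z_gt0 y : `|y| < n.+1%:R -> 0 < Z y.
Proof.
move=> yn; apply: prodr_gt0 => i _; apply: cutoff_gt0 => //; rewrite invrK.
by apply: le_lt_trans yn; move: i; exact/(cube_norm y (normr_ge0 y)).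
Qed.

Lemma heatNE s y : heatN s y = expR (N%:R * s - expR (2 * s) * sumsq y) * Z y.
Proof.
rewrite /heatN /prodf /heat big_split/= -expR_sum; congr (expR _ * _).
by rewrite sumrB sumr_const card_ord -[s *+ N]mulr_natl /sumsq mulr_sumr.
Qed.

Lemma test_heatN s : test_function (heatN s).
Proof.
apply: (@test_prodf _ _ _ n.+1%:R) => [i|i t nt]; first exact: smooth1_heat.
by apply: (heat_eq0 e01); rewrite invrK.
Qed.

Lemma heatN_ge0 s y : 0 <= heatN s y.
Proof. by rewrite heatNE mulr_ge0 ?expR_ge0. Qed.

(** For the full Gaussian this would be an equality without the 9, which is the price of the cut-off
    in each coordinate. *)
Lemma laplacian_heatN s y :
  (4 * expR (2 * s) ^+ 2 * sumsq y - (2 * expR (2 * s) + 9) * N%:R) * heatN s y <=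
  laplacian (heatN s) y.
Proof.
have -> : (4 * expR (2 * s) ^+ 2 * sumsq y - (2 * expR (2 * s) + 9) * N%:R) * heatN s y =
  \sum_(i < N) (4 * expR (2 * s) ^+ 2 * y ord0 i ^+ 2 - 2 * expR (2 * s) - 9) * heatN s y.
  rewrite -mulr_suml; congr (_ * _).
  rewrite (eq_bigr (fun i => 4 * expR (2 * s) ^+ 2 * y ord0 i ^+ 2 - (2 * expR (2 * s) + 9))); last first.
    by move=> i _; ring.
  by rewrite sumrB sumr_const card_ord -mulr_sumr mulr_natr.
apply: ler_sum => i _.
have D1 (g g' : R -> R) : (forall t, is_derive t (1 : R) g (g' t)) ->
    partial i (prodf (subst_fun (fun=> heat e s) i g)) =
    prodf (subst_fun (fun=> heat e s) i g').
  move=> D; apply/funext => x; rewrite /partial.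
  have D' : forall t, is_derive t (1 : R) (subst_fun (fun=> heat e s) i g i) (g' t).
    by move=> t; rewrite /subst_fun eqxx.
  have := is_derive_prodf x D' => DD.
  rewrite (@derive_val _ _ _ _ _ _ _ DD); apply: eq_bigr => j _.
  by rewrite /subst_fun; case: eqP.
have E0 : heatN s = prodf (subst_fun (fun=> heat e s) i (heat e s)).
  apply/funext => x; apply: eq_bigr => j _.
  by rewrite /subst_fun; case: eqP.
rewrite E0 (D1 _ _ (fun t => is_derive_heat e s t)) (D1 _ _ (fun t => is_derive_heat1 e s t)).
rewrite !prodf_subst mulrA ler_wpM2r//.
  by apply: prodr_ge0 => j _; exact: heat_ge0.
exact: heat2_ge.
Qed.

(** The zero-order terms that the factor [w] has to absorb: [c] from the operator and 9 for each
    cut-off coordinate. *)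
Let B : R := c + 9 * N%:R.

Let B0 : 0 <= B.
Proof. by rewrite addr_ge0// mulr_ge0. Qed.

Let w s : R := expR (- (B / 4) * expR (- (2 * s))).

Let w_ge0 s : 0 <= w s. Proof. exact: expR_ge0. Qed.

Let w_le1 s : w s <= 1.
Proof.
rewrite /w -expR0 ler_expR mulNr oppr_le0 mulr_ge0 ?expR_ge0//.
by rewrite divr_ge0.
Qed.

(* In terms of [tau = 1 / (4 k^2)], [k = exp s], this is the heat kernel at time
   [tau], cut off and multiplied by [exp (- B tau)], up to a constant. *)
Definition kern s y : R := w s * heatN s y.

Definition dkern s y : R :=
  (B / 2 * expR (- (2 * s)) + N%:R - 2 * expR (2 * s) * sumsq y) * kern s y.

Lemma kern_ge0 s y : 0 <= kern s y.
Proof. by rewrite mulr_ge0// heatN_ge0. Qed.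

Lemma kern_le_heatN s y : kern s y <= heatN s y.
Proof. by rewrite ler_piMl// heatN_ge0. Qed.

Lemma heatN_le s y : heatN s y <= expR (N%:R * s - expR (2 * s) * sumsq y).
Proof. by rewrite heatNE ler_piMr ?expR_ge0. Qed.

Lemma kern_gt0 s y : `|y| < n.+1%:R -> 0 < kern s y.
Proof.
by move=> yn; rewrite mulr_gt0 ?expR_gt0// heatNE mulr_gt0 ?expR_gt0 ?Z_gt0.
Qed.

Lemma heatN_eq0 s y : ~ cube n.+1%:R y -> heatN s y = 0.
Proof.
move=> yn; have [i Hi] : exists i, n.+1%:R < `|y ord0 i|.
  apply: contrapT => H; apply: yn => i; rewrite leNgt; apply/negP => Hi.
  by apply: H; exists i.
by rewrite /heatN (prodfD1 _ i) heat_eq0 ?mul0r// invrK.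
Qed.

Lemma measurable_kern s : measurable_fun setT (kern s).
Proof. by apply: measurable_funM => //; exact: test_measurable (test_heatN s). Qed.

Lemma measurable_dkern s : measurable_fun setT (dkern s).
Proof.
apply: measurable_funM; last exact: measurable_kern.
by apply: measurable_funB => //; apply: measurable_funM => //; exact: measurable_sumsq.
Qed.

Lemma is_derive_kern s y : is_derive s (1 : R) (kern^~ y) (dkern s y).
Proof.
have -> : kern^~ y = Z y \*: (expR \o (fun s => N%:R * s - sumsq y * expR (2 * s) - B / 4 * expR (- (2 * s)))).
  apply/funext => t; rewrite /kern heatNE /w mulrA -expRD /GRing.scale/= mulrC; congr (_ * expR _); ring.
have D1 (a : R) : is_derive s (1 : R) (fun s => expR (a * s)) (a * expR (a * s)).
  have D2 : is_derive s (1 : R) (fun s => a * s) a.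
    rewrite (_ : (fun s => _) = a \*: id)//.
    by apply: is_derive_eq; rewrite /GRing.scale/= mulr1.
  by rewrite mulrC; exact: (@is_derive1_comp _ expR (fun s => a * s) s _ _ (is_derive_expR _) D2).
have D3 : is_derive s (1 : R) (fun s => N%:R * s - sumsq y * expR (2 * s) - B / 4 * expR (- (2 * s)))
    (N%:R - sumsq y * (2 * expR (2 * s)) - B / 4 * (- 2 * expR (- 2 * s))).
  rewrite (_ : (fun s => _) = N%:R \*: id - sumsq y \*: (fun s => expR (2 * s)) - (B / 4) \*: (fun s => expR (- 2 * s))).
    have D4 := D1 2; have D5 := D1 (- 2).
    by apply: is_derive_eq; rewrite /GRing.scale/= mulr1.
  by apply/funext => t; rewrite !fctE /GRing.scale/= mulNr.
have D6 := is_deriveZ (Z y) (@is_derive1_comp _ expR _ s _ _ (is_derive_expR _) D3).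
apply: (is_derive_eq D6).
rewrite /dkern /kern heatNE /w [w s * _]mulrA -expRD [in RHS]mulrA mulNr /GRing.scale/=.
rewrite (_ : - (B / 4) * expR (- (2 * s)) + (N%:R * s - expR (2 * s) * sumsq y) =
  N%:R * s - sumsq y * expR (2 * s) - B / 4 * expR (- (2 * s))); last by ring.
by rewrite mulNr; field.
Qed.

(** In terms of [tau], [2 k^2] times the derivative in [s] is minus the derivative in [tau]: the
    kernel is a subsolution of the heat equation with zero-order term [c]. The part [9 N] of [B]
    cancels the loss in [laplacian_heatN]. *)
Lemma dkern_ge s y : w s * (c * heatN s y - laplacian (heatN s) y) <= 2 * expR (2 * s) * dkern s y.
Proof.
have E : expR (2 * s) * expR (- (2 * s)) = 1 by rewrite expRN mulfV// gt_eqF// expR_gt0.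
have -> : 2 * expR (2 * s) * dkern s y = w s *
   ((B * (expR (2 * s) * expR (- (2 * s))) + 2 * expR (2 * s) * N%:R - 4 * expR (2 * s) ^+ 2 * sumsq y) * heatN s y).
  by rewrite /dkern /kern; field.
rewrite E ler_wpM2l// /B.
have := laplacian_heatN s y; lra.
Qed.

(** Differentiation under the integral needs a bound locally uniform in [s]. The kernel vanishes off
    a cube, on which [sumsq y] is at most [N (n + 1)^2]. *)
Lemma dkern_bound t : exists C, 0 <= C /\ forall s y, t - 1 < s < t + 1 -> `|dkern s y| <= C.
Proof.
exists ((B / 2 * expR (- (2 * (t - 1))) + N%:R + 2 * expR (2 * (t + 1)) * (N%:R * n.+1%:R ^+ 2)) *
  expR (N%:R * (t + 1))).
split=> [|s y /andP[s1 s2]].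
  by rewrite mulr_ge0 ?expR_ge0// !addr_ge0 ?mulr_ge0 ?expR_ge0// invr_ge0.
have [cy|cy] := pselect (cube n.+1%:R y); last first.
  rewrite /dkern /kern heatN_eq0// !mulr0 normr0.
  by rewrite mulr_ge0 ?expR_ge0// !addr_ge0 ?mulr_ge0 ?expR_ge0// invr_ge0.
rewrite normrM ler_pM//; last first.
  rewrite ger0_norm ?kern_ge0// (le_trans (kern_le_heatN _ _))// (le_trans (heatN_le _ _))//.
  rewrite ler_expR; have : 0 <= expR (2 * s) * sumsq y by rewrite mulr_ge0 ?expR_ge0 ?sumsq_ge0.
  have : N%:R * s <= N%:R * (t + 1) by rewrite ler_wpM2l// ltW.
  lra.
rewrite (le_trans (ler_normB _ _))// lerD//.
  rewrite ger0_norm; last by rewrite !addr_ge0 ?mulr_ge0 ?expR_ge0// invr_ge0.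
  by rewrite lerD2r ler_wpM2l ?divr_ge0// ler_expR; lra.
rewrite ger0_norm; last by rewrite !mulr_ge0 ?expR_ge0 ?sumsq_ge0.
apply: ler_pM; rewrite ?mulr_ge0 ?expR_ge0 ?sumsq_ge0//.
  by rewrite ler_pM2l// ler_expR; lra.
rewrite /sumsq -mulr_natl mulr1 -[N in leRHS]card_ord mulr_natl -sumr_const.
apply: ler_sum => i _; rewrite -real_normK ?num_real// lerXn2r ?nnegrE//.
Qed.

Lemma is_derive_int_kern f t : locinteg f ->
  is_derive t (1 : R) (fun s => \int[mu]_y (f y * kern s y))%R (\int[mu]_y (f y * dkern t y))%R.
Proof.
move=> lf; have [C [C0 HC]] := dkern_bound t.
pose F (s : R) (y : V) := f y * kern s y.
have D s y : is_derive s (1 : R) (F^~ y) (f y * dkern s y).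
  have := is_derive_kern s y => ?.
  rewrite (_ : F^~ y = f y \*: (fun s => kern s y))//; exact: is_deriveZ.
have intF s : mu.-integrable setT (EFin \o F s).
  have := integZ (w s) (test_integM lf (test_heatN s)).
  by congr (integrable _ _ _); apply/funext => y /=; rewrite /F /kern mulrCA.
pose G y := `|f y * (C * \1_(cube n.+1%:R) y)|.
have iG : mu.-integrable setT (EFin \o G).
  apply: integ_norm; apply: (@locinteg_mul _ _ f _ n.+1 C lf).
  - by apply: measurable_funM => //; apply: measurable_indic; exact: measurable_cube.
  - move=> x; rewrite indicE; case: (_ \in _); rewrite ?mulr1 ?mulr0 ?normr0// ger0_norm//.
  - by move=> x nx; rewrite indicE memNset// mulr0.
have It : t \in `]t - 1, t + 1[%classic by rewrite inE/= in_itv/= ltrBlDr ltrDl ltr01.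
have bF s y : `]t - 1, t + 1[%classic s -> setT y -> `|partial1of2 F s y| <= G y.
  rewrite /= in_itv/= => s12 _.
  rewrite /partial1of2 derive1E (@derive_val _ _ _ _ _ _ _ (D s y)).
  rewrite /G normrM [leRHS]normrM ler_wpM2l//; have [cx|cx] := pselect (cube n.+1%:R y).
    by rewrite indicE mem_set// mulr1 (le_trans (HC _ _ s12))// ler_norm.
  by rewrite /dkern /kern heatN_eq0// !mulr0 normr0.
have Ds s y : `]t - 1, t + 1[%classic s -> setT y -> derivable (F ^~ y) s 1.
  by move=> _ _; exact: (@ex_derive _ _ _ _ _ _ _ (D s y)).
have := @cvg_differentiation_under_integral R _ V mu F setT measurableT t (t - 1) (t + 1) (set_mem It)
   (fun s _ => intF s) Ds G (fun y => normr_ge0 _) iG bF.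
rewrite (_ : (\int[mu]_y partial1of2 F t y)%R = (\int[mu]_y (f y * dkern t y))%R); last first.
  apply: eq_Rintegral => x _.
  by rewrite /partial1of2 derive1E (@derive_val _ _ _ _ _ _ _ (D t x)).
rewrite (_ : (fun h => h^-1 *: (\int[mu]_y F (h + t) y - \int[mu]_y F t y))%R = (fun h : R => h^-1 *: ((\int[mu]_y F (h *: 1 + t) y)%R - (\int[mu]_y F t y)%R))); last first.
  by apply/funext => h; rewrite /GRing.scale/= mulr1.
move=> H; apply: DeriveDef; first by apply/cvg_ex; eexists; exact: H.
by apply: cvg_lim => //; exact: H.
Qed.

Lemma integ_kern f s : locinteg f -> integ mu (fun y => f y * kern s y).
Proof.
move=> lf; have := integZ (w s) (test_integM lf (test_heatN s)).
by congr (integ _ _); apply/funext => y; rewrite /kern mulrCA.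
Qed.

Lemma integ_dkern f s : locinteg f -> integ mu (fun y => f y * dkern s y).
Proof.
move=> lf; have [C [C0 HC]] := dkern_bound s.
apply: (@locinteg_mul _ _ f _ n.+1 C lf).
- exact: measurable_dkern.
- by move=> y; apply: HC; rewrite ltrBlDr ltrDl ltr01.
- by move=> y ny; rewrite /dkern /kern heatN_eq0// !mulr0.
Qed.

(** The inequality [- Delta v + c v >= 0] in the sense of distributions. *)
Definition superharmonic v := forall phi, test_function phi -> (forall x, 0 <= phi x) ->
  0 <= (\int[mu]_x (v x * (c * phi x - laplacian phi x)))%R.

(** By [dkern_ge], the derivative in [s] is bounded below by a nonnegative multiple of the pairing
    of [v] with a translate of [heatN], which is an admissible test function. *)
Lemma int_kern_ndecr v x s t : sqinteg mu v -> (forall x, 0 <= v x) -> superharmonic v ->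
  s <= t -> (\int[mu]_y (v (y + x)%R * kern s y) <= \int[mu]_y (v (y + x)%R * kern t y))%R.
Proof.
move=> sv v0 Hv st; have lf := sqinteg_loc (sqinteg_shift x sv).
have D r := is_derive_int_kern r lf.
apply: (@ger0_derive1_ndecr _ (fun s => \int[mu]_y (v (y + x)%R * kern s y))%R s t) => //.
- move=> r _; rewrite derive1E (@derive_val _ _ _ _ _ _ _ (D r)).
  have q0 : 0 < 2 * expR (2 * r) by rewrite mulr_gt0 ?expR_gt0.
  rewrite -(pmulr_rge0 _ q0) -RintZ; last exact: integ_dkern.
  have tp := test_shift (- x) (test_heatN r).
  have := Hv _ tp (fun z => heatN_ge0 r (z - x)).
  rewrite -(@Rint_shift _ _ x (fun y => v y * _)); last first.
    apply: measurable_funM; first exact: sv.1.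
    apply: measurable_funB.
      by apply: measurable_funM => //; exact: test_measurable.
    by apply: measurable_sum => i; apply: test_measurable; do 2 apply: test_partial.
  move=> H; have {}H := mulr_ge0 (w_ge0 r) H; apply: le_trans H _.
  have E y : laplacian (fun z => heatN r (z - x)) (y + x) = laplacian (heatN r) y.
    by rewrite (laplacian_shift (heatN r)) addrK.
  under eq_Rintegral do rewrite E addrK.
  rewrite -RintZ; last exact: integ_laplacian lf (test_heatN r).
  apply: Rint_le.
  + exact/integZ/integ_laplacian/test_heatN.
  + exact/integZ/integ_dkern.
  + by move=> y; rewrite mulrCA [leRHS]mulrCA ler_wpM2l// dkern_ge.
- apply: continuous_subspaceT => r.
  have [Dr _] := D r; have : derivable (fun s => (\int[mu]_y (v (y + x)%R * kern s y))%R) r 1 by [].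
  by move=> /derivable1_diffP/differentiable_continuous.
Qed.

End kernel.

(** * Spreading of the zero set of a supersolution *)

Section strong_maximum_principle.
Context {R : realType} {N : nat}.
Local Notation mu := (lebesgue_rV R N).
Local Notation V := 'rV[R]_N.
Implicit Types (s t : R) (x y : V).

Section bounded_zero_set.
Variables (n : nat) (c : R) (v : V -> R) (C : R) (Z : set V).
Hypotheses (c0 : 0 <= c) (sv : sqinteg mu v) (v0 : forall x, 0 <= v x).
Hypotheses (C0 : 0 <= C) (vC : forall y, shift_dist v y <= C * `|y| ^+ 2).
Hypotheses (mZ : measurable Z) (Zoo : (mu Z < +oo)%E) (vZ : forall x, Z x -> v x = 0).
Hypothesis Hv : superharmonic c v.

(** The two orders of integration play against each other: in [y] first, one finds averages of [v]
    around [x], increasing with [s]; in [x] first, increments of [v] starting from [Z], whose total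
    decays with [s]. *)
Let G s (z : V * V) : R := \1_Z z.1 * (v (z.2 + z.1) * kern n c s z.2).

Let G_ge0 s z : 0 <= G s z.
Proof.
rewrite /G; apply: mulr_ge0; first by rewrite indicE.
by apply: mulr_ge0; [exact: v0|exact: kern_ge0].
Qed.

Let G_ge0E s z : (0 <= (EFin \o G s) z)%E.
Proof. by rewrite lee_fin; exact: G_ge0. Qed.

Let mG s : measurable_fun setT (EFin \o G s).
Proof.
apply/measurable_EFinP; apply: measurable_funM.
  by apply: (measurableT_comp _ measurable_fst); exact: measurable_indic.
apply: measurable_funM; last first.
  by apply: (measurableT_comp _ measurable_snd); exact: measurable_kern.
apply: (measurableT_comp sv.1).
apply: measurable_fun_coord_rV => j.
under eq_fun do rewrite mxE.
apply: measurable_funD.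
  exact: (measurableT_comp (measurable_coord_rV j) measurable_snd).
exact: (measurableT_comp (measurable_coord_rV j) measurable_fst).
Qed.

Let mF s := @measurable_fun_fubini_tonelli_F _ _ _ _ R mu _ (mG s) (G_ge0E s).

Let z0 : R := fine (mu Z).

Let z0_ge0 : 0 <= z0. Proof. by rewrite fine_ge0. Qed.

(** Because [(1 + t/4)^2 - t = (1 - t/4)^2]. *)
Let le_expR_half t : 0 <= t -> t <= expR (t / 2).
Proof.
move=> t0; have -> : expR (t / 2) = expR (t / 4) ^+ 2.
  by rewrite -expRM_natl; congr expR; field.
have H := expR_ge1Dx (t / 4); have := sqr_ge0 (1 - t / 4).
by have : (1 + t / 4) ^+ 2 <= expR (t / 4) ^+ 2; [rewrite lerXn2r ?nnegrE ?expR_ge0//; lra|nra].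
Qed.

(* On [Z] the function [v] is the increment of [v], which is small in the mean. *)
Let inner_le s y : (\int[mu]_x (G s (x, y))%:E <=
  (expR (- s) * (z0 + C) * \prod_(i < N) expR (s - expR (2 * s) * y ord0 i ^+ 2 / 2))%:E)%E.
Proof.
have sd : sqinteg mu (fun x => v (x + y) - v x) by apply: (sqintegB _ sv); exact: sqinteg_shift.
have i1 : integ mu (\1_Z : V -> R).
  apply: integ_ge0P; first exact: measurable_indic.
    by move=> x; rewrite indicE.
  by rewrite integral_indic// setIT.
have k0 := @kern_ge0 R N n c s y.
(* Young's inequality with weights [exp (- s)] and [exp s], which balance once the increment over
   [y] is of order [|y|], itself comparable to [exp (- s)]. *)
pose H x := kern n c s y * (expR (- s) * \1_Z x + expR s * (v (x + y) - v x) ^+ 2).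
have iH : integ mu H by apply: integZ; apply: integD; apply: integZ => //; exact: sd.2.
have es : expR s * expR (- s) = 1 by rewrite expRN mulfV// gt_eqF// expR_gt0.
apply: (@le_trans _ _ (\int[mu]_x (H x)%:E)%E).
  apply: ge0_le_integral_EFin.
  - have /measurable_EFinP := mG s; move=> m1.
    by apply: (measurableT_comp m1); exact: pair2_measurable.
  - exact: integ_measurable iH.
  move=> x; apply/andP; split; first exact: G_ge0.
  rewrite /G /H /= [leLHS]mulrA [leLHS]mulrC ler_wpM2l// (addrC y).
  rewrite indicE; have [xZ|xZ] := boolP (x \in Z); last first.
    by rewrite mul0r mulr0 add0r mulr_ge0 ?expR_ge0// sqr_ge0.
  rewrite mul1r mulr1 (vZ (set_mem xZ)) subr0.
  have := v0 (x + y); have := expR_gt0 s; have := expR_gt0 (- s).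
  have := sqr_ge0 (expR s * v (x + y) - 1); nra.
rewrite integ_fin// lee_fin /H RintZ; last first.
  by apply: integD; apply: integZ => //; exact: sd.2.
rewrite RintD; [|exact: integZ|by apply: integZ; exact: sd.2].
rewrite RintZ// RintZ; last exact: sd.2.
have -> : (\int[mu]_x \1_Z x = z0)%R by rewrite /Rintegral integral_indic// setIT.
rewrite -/(shift_dist v y).
set T := expR (2 * s) * sumsq y.
have T0 : 0 <= T by rewrite mulr_ge0 ?expR_ge0 ?sumsq_ge0.
have -> : \prod_(i < N) expR (s - expR (2 * s) * y ord0 i ^+ 2 / 2) = expR (N%:R * s - T / 2).
  rewrite -expR_sum sumrB sumr_const card_ord -[s *+ N]mulr_natl -mulr_suml.
  by rewrite /T /sumsq mulr_sumr.
(* Half of the Gaussian exponent is given up: the factor [exp (T / 2)] dominates both 1 and [T],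
   hence [exp (2 s) |y|^2]. *)
apply: (@le_trans _ _ (expR (N%:R * s - T) * (expR (- s) * ((z0 + C) * expR (T / 2))))); last first.
  have -> : N%:R * s - T / 2 = N%:R * s - T + T / 2 by field.
  by rewrite [expR (_ + T / 2)]expRD; apply: ler_eq; ring.
apply: ler_pM => //.
- by rewrite addr_ge0// mulr_ge0 ?expR_ge0// Rint_ge0// => x; exact: sqr_ge0.
- exact: le_trans (kern_le_heatN _ c0 _ _) (heatN_le _ _ _).
have -> : expR s = expR (- s) * expR (2 * s) by rewrite -expRD; congr expR; ring.
rewrite -[X in _ + X]mulrA -mulrDr ler_wpM2l ?expR_ge0// [leRHS]mulrDl lerD//.
  by rewrite ler_peMr// -expR0 ler_expR divr_ge0.
apply: (@le_trans _ _ (C * T)); last by rewrite ler_wpM2l// le_expR_half.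
rewrite /T mulrCA ler_wpM2l ?expR_ge0// (le_trans (vC y))// ler_wpM2l//.
exact: norm_le_sumsq.
Qed.

(** The integral of the Gaussian product is bounded independently of [s] by [integral_gauss]; the
    decay [exp (- s)], that is [1 / k], remains. *)
Let outer_le s : (\int[mu]_x \int[mu]_y (G s (x, y))%:E <=
  (expR (- s) * ((z0 + C) * Num.sqrt (pi *+ 2) ^+ N))%:E)%E.
Proof.
rewrite [leLHS](@fubini_tonelli _ _ _ _ R mu mu _ (mG s) (G_ge0E s)).
have p0 y : 0 <= \prod_(i < N) expR (s - expR (2 * s) * y ord0 i ^+ 2 / 2).
  by apply: prodr_ge0 => i _; exact: expR_ge0.
have mp : measurable_fun setT (fun y : V => \prod_(i < N) expR (s - expR (2 * s) * y ord0 i ^+ 2 / 2)).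
  apply: measurable_prod => i _; apply: measurableT_comp => //.
  apply: measurable_funB => //; apply: measurable_funM => //; apply: measurable_funM => //.
  by apply: measurable_funX; exact: measurable_coord_rV.
apply: (@le_trans _ _ (\int[mu]_y (expR (- s) * (z0 + C) *
    \prod_(i < N) expR (s - expR (2 * s) * y ord0 i ^+ 2 / 2))%:E)%E).
  apply: ge0_le_integral => //.
  - by move=> y _; apply: integral_ge0 => x _; rewrite lee_fin.
  - exact: (@measurable_fun_fubini_tonelli_G _ _ _ _ R mu _ (mG s) (G_ge0E s)).
  - by apply/measurable_EFinP; exact: measurable_funM.
  - by move=> y _; exact: inner_le.
rewrite ge0_integral_cstM ?mulr_ge0 ?expR_ge0 ?addr_ge0// [in leRHS]mulrA [leRHS]EFinM.
apply: lee_wpmul2l; first by rewrite lee_fin mulr_ge0 ?expR_ge0// addr_ge0.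
apply: (le_trans (@integral_rV_prod_le R N (fun=> fun t => expR (s - expR (2 * s) * t ^+ 2 / 2))
  (fun=> Num.sqrt (pi *+ 2)) _ _ _)).
- move=> i; apply: measurableT_comp => //.
  apply: measurable_funB => //; apply: measurable_funM => //; apply: measurable_funM => //.
- by move=> i t; exact: expR_ge0.
- by move=> i; rewrite integral_gauss.
- by rewrite prodr_const card_ord.
Qed.

Let GE s x : (\int[mu]_y (G s (x, y))%:E = (\1_Z x * \int[mu]_y (v (y + x)%R * kern n c s y))%:E)%E.
Proof.
have lf := sqinteg_loc (sqinteg_shift x sv).
rewrite -RintZ; last exact: integ_kern.
by rewrite -integ_fin//; apply: integZ; exact: integ_kern.
Qed.

(** The value at [s = 0] is at most the value at any [s >= 0] by monotonicity, and the latter is at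
    most [K exp (- s)]. *)
Let int_G0 : (\int[mu]_x \int[mu]_y (G 0 (x, y))%:E = 0)%E.
Proof.
have I0 : (0 <= \int[mu]_x \int[mu]_y (G 0 (x, y))%:E)%E.
  by apply: integral_ge0 => x _; apply: integral_ge0 => y _; rewrite lee_fin.
set K := (z0 + C) * Num.sqrt (pi *+ 2) ^+ N.
have H s : 0 <= s -> (\int[mu]_x \int[mu]_y (G 0 (x, y))%:E <= (expR (- s) * K)%:E)%E.
  move=> s0; apply: le_trans (outer_le s).
  apply: ge0_le_integral.
  - exact: measurableT.
  - by move=> x _; apply: integral_ge0 => y _; rewrite lee_fin.
  - exact: mF.
  - exact: mF.
  move=> x _; rewrite (GE 0 x) (GE s x) lee_fin; apply: ler_wpM2l; first by rewrite indicE.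
  exact: int_kern_ndecr.
have := H 0 (lexx 0); rewrite oppr0 expR0 mul1r.
set L := (\int[mu]_x _)%E in I0 H * => IK.
have Lfin : L \is a fin_num by rewrite ge0_fin_numE// (le_lt_trans IK)// ltry.
rewrite -(fineK Lfin) in I0 H IK *; move: I0 IK; rewrite !lee_fin => I0 IK.
congr EFin; apply/eqP; rewrite eq_le I0 andbT.
have K0 : 0 <= K := le_trans I0 IK.
apply/ler_addgt0Pl => d d0; rewrite addr0.
have s0 : 0 <= K / d by rewrite divr_ge0// ltW.
have := H _ s0; rewrite lee_fin => /le_trans; apply.
rewrite expRN -ler_pdivlMl ?invr_gt0 ?expR_gt0// invrK.
apply: (@le_trans _ _ ((K / d) * d)); first by rewrite divfK// gt_eqF.
rewrite ler_pM2r//; have := expR_ge1Dx (K / d); lra.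
Qed.

(** By [int_G0] the weighted average around almost every point of [Z] is zero, and [Z] is not
    negligible. The kernel is positive at distance less than [n + 1], so [v] vanishes there. *)
Lemma zero_near_zero_set : ~ mu Z = 0%E ->
  exists2 x, Z x & \forall y \ae mu, `|y - x| < n.+1%:R -> v y = 0.
Proof.
move=> nZ.
have ae0 : \forall x \ae mu, (\int[mu]_y (G 0 (x, y))%:E = 0)%E.
  have /(ae_eq_integral_abs _ measurableT (mF 0)).1 : (\int[mu]_x `|\int[mu]_y (G 0 (x, y))%:E| = 0)%E.
    rewrite -[RHS]int_G0; apply: eq_integral => x _; rewrite gee0_abs//.
    by apply: integral_ge0 => y _; rewrite lee_fin.
  by apply: filterS => x /(_ I).
have [x Zx x0] : exists2 x, Z x & (\int[mu]_y (G 0 (x, y))%:E = 0)%E.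
  apply: contrapT => nx; apply: nZ.
  have /negligibleP -> // : mu.-negligible Z.
  by apply: negligibleS ae0 => x Zx /= H; apply: nx; exists x.
exists x => //.
have mGx : measurable_fun setT (fun y => (G 0 (x, y))%:E).
  by apply: (measurableT_comp (mG 0)); exact: pair1_measurable.
have /(ae_eq_integral_abs _ measurableT mGx).1 : (\int[mu]_y `|(G 0 (x, y))%:E| = 0)%E.
  rewrite -[RHS]x0; apply: eq_integral => y _.
  by rewrite gee0_abs// lee_fin.
move=> /(ae_shift (- x)); apply: filterS => y /(_ I) + yx.
rewrite /G /= indicE (mem_set Zx) mul1r subrK => -[] /eqP.
by rewrite mulf_eq0 [kern _ _ _ _ == 0]gt_eqF ?orbF => [/eqP|]; last exact: kern_gt0.
Qed.

End bounded_zero_set.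

Lemma strong_maximum_principle (c : R) (v : V -> R) (C : R) (Z : set V) :
  0 <= c -> sqinteg mu v -> (forall x, 0 <= v x) ->
  0 <= C -> (forall y, shift_dist v y <= C * `|y| ^+ 2) ->
  measurable Z -> mu Z != 0%E -> (forall x, Z x -> v x = 0) ->
  superharmonic c v -> ae_zero v.
Proof.
move=> c0 sv v0 C0 vC mZ nZ vZ Hv.
have mk k : measurable (@cube R N k%:R) by exact: measurable_cube.
(* A bounded piece of [Z] of positive measure: [inner_le] involves the measure of the zero set,
   which must be finite. *)
have [M nM] : exists M : nat, mu (Z `&` cube M%:R) != 0%E.
  apply: contrapT => H; move/eqP: nZ; apply.
  have /negligibleP -> // : mu.-negligible Z.
  rewrite -[Z]setIT -(@cubeT R N) setI_bigcupr.
  apply: negligible_bigcup => k.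
  have /negligibleP H' := measurableI _ _ mZ (mk k).
  by apply/H'; apply/eqP/negPn/negP => nk; apply: H; exists k.
suff H k : \forall y \ae mu, cube k%:R y -> v y = 0.
  have := ae_foralln H; apply: filterS => y Hy.
  have : setT y by []; rewrite -(@cubeT R N) => -[k _]; exact: Hy.
(* The centre [x] lies in the cube of half-side [M], so the open ball of radius [M + k + 1] around
   it contains the cube of half-side [k]. *)
have [x [_ xM]] := @zero_near_zero_set (M + k) c v C (Z `&` cube M%:R) c0 sv v0 C0 vC
  (measurableI _ _ mZ (mk M)) (le_lt_trans (le_measure _ (mem_set (measurableI _ _ mZ (mk M))) (mem_set (mk M)) (@subIsetr _ _ _)) (@cube_finite R N _))
  (fun x Zx => vZ x Zx.1) Hv (elimN eqP nM).
apply: filterS => y Hy yk; apply: Hy.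
move: xM yk; rewrite !cube_norm// => xM yk.
rewrite (le_lt_trans (ler_normB _ _))// (le_lt_trans (lerD yk xM))//.
by rewrite -natrD ltr_nat addnC.
Qed.

End strong_maximum_principle.

(** * Comparison of the levels *)

Section infinite_measure.
Context {R : realType}.

Lemma lebesgue_rVT n : (0 < n)%N -> lebesgue_rV R n setT = +oo%E.
Proof.
case: n => // n _.
have leT : @lebesgue_measure R setT = +oo%E.
  by have := @lebesgue_measure_itv R `]-oo, +oo[; rewrite set_itvNyy.
elim: n => [|n IH].
  rewrite /= /lebesgue_cons /pushforward preimage_setT -setXTT product_measure1E//.
  rewrite [X in (_ * X)%E](_ : _ = 1%E); last exact: diracT.
  by rewrite mule1; exact: leT.
change (lebesgue_rV R n.+2) with (lebesgue_cons (lebesgue_rV R n.+1) : {sigma_finite_measure set _ -> \bar R}).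
rewrite /= /lebesgue_cons /pushforward preimage_setT -setXTT product_measure1E// IH; set m := (X in (X * _)%E).
have -> : m = +oo%E by exact: leT.
by rewrite mulyy.
Qed.

End infinite_measure.

Section levels.
Context {R : realType} {N : nat}.
Local Notation mu := (lebesgue_rV R N).
Local Notation V := 'rV[R]_N.
Implicit Types (u v a b : V -> R).

(** For [a <= r] the projection factor is at most 1. *)
Lemma nehari_proj_le (p a r : R) : 1 < p -> 0 < a -> a <= r ->
  nehari_proj p a r <= nehari_coef p * a.
Proof.
move=> p1 a0 ar; have r0 := lt_le_trans a0 ar.
rewrite /nehari_proj ler_pM2l ?nehari_coef_gt0// ler_piMr ?(ltW a0)//.
rewrite exprn_ile1 ?powR_ge0//.
rewrite -[leRHS](powRr0 (a / r)).
apply: ger_powR; first by rewrite divr_gt0// ler_pdivrMr// mul1r.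
by rewrite invr_ge0 subr_ge0 ltW.
Qed.

Lemma nehari_proj_mono (p a a' r r' : R) : 1 < p -> 0 < a -> a <= a' -> 0 < r -> r <= r' ->
  nehari_proj p a r' <= nehari_proj p a' r.
Proof.
move=> p1 a0 aa r0 rr; have a'0 := lt_le_trans a0 aa; have r'0 := lt_le_trans r0 rr.
rewrite /nehari_proj ler_pM2l ?nehari_coef_gt0//.
apply: ler_pM => //; rewrite ?sqr_ge0 ?(ltW a0)//.
rewrite lerXn2r ?nnegrE ?powR_ge0//.
apply: ge0_ler_powR; rewrite ?nnegrE ?invr_ge0 ?divr_ge0 ?subr_ge0 ?(ltW p1) ?(ltW a0) ?(ltW r0) ?(ltW a'0) ?(ltW r'0)//.
by rewrite ler_pM// ?invr_ge0 ?(ltW a0) ?(ltW r'0)// lef_pV2.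
Qed.

(* [s] is chosen with [s ^ (1 + 2 / (p - 1)) = 1 + d]. *)
Lemma nehari_proj_cvg (p r d : R) : 1 < p -> 0 < r -> 0 < d ->
  exists2 s, 1 < s & nehari_proj p (r * s) r <= nehari_coef p * (r * (1 + d)).
Proof.
move=> p1 r0 d0; set e := (p - 1)^-1; have e0 : 0 < e by rewrite invr_gt0 subr_gt0.
have k0 : 0 < 1 + e + e by rewrite !addr_gt0.
have s1 : 1 < (1 + d) `^ (1 + e + e)^-1.
  have E1 : (1 : R) = 1 `^ (1 + e + e)^-1 by rewrite powR1.
  rewrite [ltLHS]E1.
  by apply: gt0_ltr_powR; rewrite ?invr_gt0 ?nnegrE//; lra.
exists ((1 + d) `^ (1 + e + e)^-1) => //; set s := _ `^ _ in s1 *.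
rewrite /nehari_proj -/e [r * s]mulrC mulfK ?gt_eqF// ler_pM2l ?nehari_coef_gt0//.
rewrite [s * r]mulrC -mulrA ler_pM2l//; apply: ler_eq.
have s0 : 0 < s by rewrite (lt_trans ltr01).
have sn : s != 0 by rewrite gt_eqF.
rewrite expr2 mulrA -[X in X * _ * _](powRr1 (ltW s0)) -!powRD ?sn ?implybT//.
by rewrite /s -powRrM mulVf ?gt_eqF// powRr1//; lra.
Qed.

Variables (p ai bi C : R) (a b : V -> R).
Hypotheses (p1 : 1 < p) (ai0 : 0 < ai) (bi0 : 0 < bi) (C0 : 0 <= C).
Hypotheses (ma : measurable_fun setT a) (mb : measurable_fun setT b).
Hypotheses (a0 : ae_nonneg a) (b0 : ae_nonneg b).
Hypothesis bC : \forall x \ae mu, `|b x| <= C.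

Local Notation I := (I_lambda p ai bi a b).
Local Notation Ioo := (I_infty N p ai bi).
Local Notation bas := (base ai).
Local Notation pot := (potential a).
Local Notation pow := (power p).
Local Notation wpow := (wpower p b).

Definition quad (l : R) u : \bar R := ((bas u)%:E + l%:E * pot u)%E.
Definition nonlin u : \bar R := (bi%:E * pow u + wpow u)%E.

Let meas u : H1 u -> measurable_fun setT u. Proof. by move=> /H1_sqinteg[]. Qed.

Let quad_gt0 l u : 0 <= l -> H1 u -> ~ ae_zero u -> (0 < quad l u)%E.
Proof.
move=> l0 hu nu; apply: (@lt_le_trans _ _ (bas u)%:E); first by rewrite lte_fin base_gt0.
by rewrite /quad leeDl// mule_ge0 ?lee_fin ?potential_ge0.
Qed.

Let nonlin_gt0 u : H1 u -> ~ ae_zero u -> (0 < nonlin u)%E.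
Proof.
move=> hu nu; apply: (@lt_le_trans _ _ (bi%:E * pow u)%E).
  by rewrite mule_gt0 ?lte_fin// power_gt0//; exact: meas.
by rewrite /nonlin leeDl// wpower_ge0.
Qed.

Let quadZ l c u : 0 < c -> H1 u -> quad l (fun x => c * u x) = ((c ^+ 2)%:E * quad l u)%E.
Proof.
move=> c0 hu; rewrite /quad baseZ// potentialZ//; last exact: meas.
rewrite [RHS]muleDr//.
by rewrite EFinM muleCA.
Qed.

Let nonlinZ c u : 0 < c -> H1 u ->
  nonlin (fun x => c * u x) = ((c `^ (p + 1))%:E * nonlin u)%E.
Proof.
move=> c0 hu; have mu_ := meas hu.
rewrite /nonlin powerZ ?(ltW c0)// wpowerZ ?(ltW c0)//.
rewrite [RHS]ge0_muleDr; [by rewrite muleCA| |exact: wpower_ge0].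
by rewrite mule_ge0 ?power_ge0 ?lee_fin ?(ltW bi0).
Qed.

Let nzZ c u : 0 < c -> ~ ae_zero u -> ~ ae_zero (fun x : V => c * u x).
Proof. by move=> c0 nu /ae_zeroZ; move/(_ c0). Qed.

Let IE l u : 0 <= l -> H1 u -> I l u = (2^-1%:E * quad l u - (p + 1)^-1%:E * nonlin u)%E.
Proof. by move=> l0 hu; rewrite /I_lambda /energy potentialE// wpowerE. Qed.

Let IooE u : H1 u -> Ioo u = (2^-1%:E * (bas u)%:E - (p + 1)^-1%:E * (bi%:E * pow u))%E.
Proof.
move=> hu; rewrite /I_infty /energy /base -integ_fin; last exact: integ_base.
have E : (bi%:E * pow u = \int[mu]_x (bi * `|u x| `^ (p + 1))%:E)%E.
  rewrite ge0_integral_cstM ?(ltW bi0)//.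
  by apply: measurable_power; exact: meas.
by rewrite E.
Qed.

Lemma nehari_lambdaP l u : 0 <= l ->
  nehari (I l) u <-> [/\ H1 u, ~ ae_zero u & exists r, quad l u = r%:E /\ nonlin u = r%:E].
Proof.
move=> l0; apply: (@nehariP R N p (I l) (quad l) nonlin p1 (fun u => @IE l u l0)).
- by move=> v; exact: quad_gt0.
- exact: nonlin_gt0.
- by move=> c v c0; exact: quadZ.
- by move=> c v c0; exact: nonlinZ.
- exact: H1Z.
Qed.

Lemma energy_lambda l u r : 0 <= l -> H1 u -> quad l u = r%:E -> nonlin u = r%:E ->
  I l u = (nehari_coef p * r)%:E.
Proof. by move=> l0; apply: (nehari_energy (fun u => @IE l u l0)). Qed.

Lemma level_lambda_le l u r s : 0 <= l -> H1 u -> ~ ae_zero u ->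
  quad l u = r%:E -> nonlin u = s%:E ->
  (nehari_level (I l) <= (nehari_proj p r s)%:E)%E.
Proof.
move=> l0; apply: (@nehari_level_le R N p (I l) (quad l) nonlin p1 (fun u => @IE l u l0)).
- by move=> v; exact: quad_gt0.
- exact: nonlin_gt0.
- by move=> c v c0; exact: quadZ.
- by move=> c v c0; exact: nonlinZ.
- exact: H1Z.
- by move=> c v; exact: nzZ.
Qed.

Let power_inf_gt0 u : H1 u -> ~ ae_zero u -> (0 < bi%:E * pow u)%E.
Proof. by move=> hu nu; rewrite mule_gt0 ?lte_fin// power_gt0//; exact: meas. Qed.

Lemma nehari_inftyP u : nehari Ioo u <->
  [/\ H1 u, ~ ae_zero u & exists r, (bas u)%:E = r%:E /\ (bi%:E * pow u)%E = r%:E].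
Proof.
apply: (@nehariP R N p Ioo (fun u => (bas u)%:E) (fun u => bi%:E * pow u)%E p1 IooE) => //.
- by move=> v hv nv; rewrite lte_fin base_gt0.
- by move=> c v c0 hv; rewrite baseZ.
- by move=> c v c0 hv; rewrite powerZ ?(ltW c0)//; [rewrite muleCA|exact: meas].
- exact: H1Z.
Qed.

Lemma energy_infty u r : H1 u -> bas u = r -> (bi%:E * pow u)%E = r%:E ->
  Ioo u = (nehari_coef p * r)%:E.
Proof.
move=> hu br; apply: (@nehari_energy R N p Ioo (fun u => (bas u)%:E) (fun u => bi%:E * pow u)%E IooE) => //.
by rewrite br.
Qed.

(** For [l = 0] the product with an infinite potential would be 0; a positive [l] is what makes the
    potential finite. *)
Let quad_fin l u r : 0 < l -> quad l u = r%:E -> exists2 P, 0 <= P & pot u = P%:E.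
Proof.
move=> l0 E; have := potential_ge0 a u; move: E; rewrite /quad.
case: (pot u) => [P||] //; first by move=> _ P0; exists P.
by rewrite gt0_muley ?lte_fin// addey.
Qed.

(** On the Nehari set of [l2] the nonlinear term is [bas u + l2 * P], at least the quadratic term
    [bas u + l1 * P] of [l1]. The projection factor is then at most 1, and the gap [(l2 - l1) * P]
    gives the strict inequality. *)
Lemma level_lambda_mono l1 l2 u : 0 <= l1 -> l1 < l2 -> nehari (I l2) u ->
  (nehari_level (I l1) <= I l2 u)%E /\
  (pot u != 0%E -> (nehari_level (I l1) < I l2 u)%E).
Proof.
move=> l10 l12; have l20 := le_lt_trans l10 l12.
move=> /(nehari_lambdaP _ (ltW l20))[hu nu [r [Er Br]]].
have [P P0 EP] := quad_fin l20 Er.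
have E1 : quad l1 u = (bas u + l1 * P)%:E by rewrite /quad EP.
have rE : r = bas u + l2 * P by move: Er; rewrite /quad EP => -[].
have b0' : 0 < bas u + l1 * P by rewrite ltr_pwDl ?base_gt0// mulr_ge0.
have le1 : bas u + l1 * P <= r by rewrite rE lerD2l ler_wpM2r// ltW.
have H := level_lambda_le l10 hu nu E1 Br.
rewrite (energy_lambda (ltW l20) hu Er Br).
split=> [|Pn].
  apply: (le_trans H); rewrite lee_fin (le_trans (nehari_proj_le p1 b0' le1))//.
  by rewrite ler_pM2l ?nehari_coef_gt0.
apply: (le_lt_trans H); rewrite lte_fin (le_lt_trans (nehari_proj_le p1 b0' le1))//.
rewrite ltr_pM2l ?nehari_coef_gt0// rE ltrD2l ltr_pM2r//.
by rewrite lt_neqAle P0 andbT eq_sym; apply/eqP => P00; move: Pn; rewrite EP P00 eqxx.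
Qed.

Lemma level_lambda_ndecr l1 l2 : 0 <= l1 -> l1 < l2 ->
  (nehari_level (I l1) <= nehari_level (I l2))%E.
Proof.
move=> l10 l12; apply: le_ereal_inf_tmp => _ [u nu <-].
exact: (level_lambda_mono l10 l12 nu).1.
Qed.

Hypothesis a_loc : locinteg a.
Hypothesis a_lim : ae_vanishing_at_infinity a.

(* The mean of [potential (u (. + y))] over [y] in a set of large measure is small
   if [a] is integrable. *)
Lemma small_potential u (d : R) : (0 < N)%N -> sqinteg mu u -> 0 < d ->
  exists y, (pot (fun x => u (x + y)%R) <= d%:E)%E.
Proof.
move=> N0 su d0; have mu_ := su.1.
set S := (\int[mu]_x (u x ^+ 2))%R.
have S0 : 0 <= S by apply: Rint_ge0 => x; exact: sqr_ge0.
(* Outside a large cube [|a| <= eta], and this part costs at most [eta * S <= d / 2] for every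
   translate. The [+ 1] covers [S = 0]. *)
pose eta := d / (2 * (S + 1)).
have eta0 : 0 < eta by rewrite divr_gt0// mulr_gt0//; lra.
have etaS : eta * S <= d / 2.
  rewrite /eta invfM mulrA -mulrA ler_piMr ?divr_ge0 ?(ltW d0)//.
  by rewrite mulrC ler_pdivrMr; lra.
have [r ar] := a_lim eta0.
pose k := (Num.truncn `|r|).+1.
have rk : r <= k%:R by rewrite (le_trans (ler_norm r))// ltW// truncnS_gt.
pose a1 x := `|a x * \1_(@cube R N k%:R) x|.
have ia1 : integ mu a1.
  apply: integ_norm; apply: (@locinteg_mul _ _ a _ k 1) => //.
  - by apply: measurable_indic; exact: measurable_cube.
  - by move=> x; rewrite indicE; case: (_ \in _); rewrite ?normr1 ?normr0.
  - by move=> x nx; rewrite indicE memNset.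
have ma1 := integ_measurable ia1.
have a10 x : 0 <= a1 x by exact: normr_ge0.
have aa1 : \forall x \ae mu, `|a x| <= a1 x + eta.
  apply: filterS ar => x Hx; rewrite /a1 indicE.
  have [cx|cx] := boolP (x \in cube k%:R); first by rewrite mulr1 lerDl ltW.
  rewrite mulr0 normr0 add0r Hx// (le_trans rk)//.
  move: cx; rewrite notin_setE cube_norm// => /negP; rewrite -ltNge; exact: ltW.
pose G (z : V * V) : R := a1 z.1 * u (z.2 + z.1) ^+ 2.
have G0 z : 0 <= G z by rewrite mulr_ge0 ?sqr_ge0.
have mG : measurable_fun setT (EFin \o G).
  apply/measurable_EFinP; apply: measurable_funM.
    exact: (measurableT_comp ma1 measurable_fst).
  apply: measurable_funX; apply: (measurableT_comp mu_).
  apply: measurable_fun_coord_rV => j; under eq_fun do rewrite mxE.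
  apply: measurable_funD.
    exact: (measurableT_comp (measurable_coord_rV j) measurable_snd).
  exact: (measurableT_comp (measurable_coord_rV j) measurable_fst).
have G0E z : (0 <= (EFin \o G) z)%E by rewrite lee_fin; exact: G0.
have II : (\int[mu]_y \int[mu]_x (G (x, y))%:E < +oo)%E.
  rewrite [ltLHS](_ : _ = (\int[mu]_x (a1 x * S)%:E)%E).
    have i1 : integ mu (fun x => S * a1 x) := integZ S ia1.
    under eq_integral do rewrite mulrC.
    by rewrite (integ_fin i1) ltry.
  rewrite -[LHS](@fubini_tonelli _ _ _ _ R mu mu _ mG G0E).
  apply: eq_integral => x _.
  have ius : integ mu (fun y => a1 x * u (y + x) ^+ 2).
    by apply: integZ; exact: (sqinteg_shift x su).2.
  rewrite /= (integ_fin ius) RintZ; last exact: (sqinteg_shift x su).2.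
  congr (_ * _)%:E; rewrite (@Rint_shift R N x (fun x => u x ^+ 2))//.
  exact: measurable_funX.
have [y Hy] : exists y, (\int[mu]_x (G (x, y))%:E <= (d / 2)%:E)%E.
  (* If every [y] failed, the double integral, which is finite, would be at least [d / 2] times the
     infinite measure of the space. *)
  apply: contrapT => H; move: II; rewrite ltNge => /negP; apply.
  have {}H y : ((d / 2)%:E <= \int[mu]_x (G (x, y))%:E)%E.
    by rewrite leNgt; apply/negP => Hy; apply: H; exists y; exact: ltW.
  have <- : (\int[mu]_y (d / 2)%:E = +oo)%E.
    rewrite integral_cst// [X in (_ * X)%E](_ : _ = +oo%E); last exact: lebesgue_rVT.
    by rewrite gt0_muley// lte_fin divr_gt0.
  apply: ge0_le_integral.
  - exact: measurableT.
  - by move=> y _; rewrite lee_fin divr_ge0// ltW.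
  - exact: measurable_cst.
  - exact: (@measurable_fun_fubini_tonelli_G _ _ _ _ R mu _ mG G0E).
  - by move=> y _; exact: H.
exists y.
have suy := sqinteg_shift y su.
have iS : integ mu (fun x => eta * u (x + y) ^+ 2) := integZ eta suy.2.
have mGy : measurable_fun setT (fun x => (G (x, y))%:E).
  by apply: (measurableT_comp mG); exact: pair2_measurable.
apply: (@le_trans _ _ (\int[mu]_x ((G (x, y))%:E + (eta * u (x + y) ^+ 2)%:E))%E).
  apply: ae_ge0_le_integral => //.
  - by move=> x _; rewrite lee_fin mulr_ge0// sqr_ge0.
  - by apply/measurable_EFinP; apply: measurable_potential => //; exact: suy.1.
  - by move=> x _; rewrite -EFinD lee_fin addr_ge0 ?G0// mulr_ge0 ?sqr_ge0// ltW.
  - by apply: emeasurable_funD => //; apply/measurable_EFinP; exact: integ_measurable iS.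
  apply: filterS aa1 => x Hx _; rewrite -EFinD lee_fin /G /= [(y + x)%R]addrC -mulrDl.
  by rewrite ler_wpM2r// sqr_ge0.
rewrite ge0_integralD//; last first.
- by apply/measurable_EFinP; exact: integ_measurable iS.
- by move=> x _; rewrite lee_fin mulr_ge0 ?sqr_ge0// ltW.
- by move=> x _; rewrite lee_fin G0.
rewrite (integ_fin iS) RintZ; last exact: suy.2.
rewrite (@Rint_shift R N y (fun x => u x ^+ 2)); last exact: measurable_funX.
have -> : d = d / 2 + d / 2 by field.
by rewrite EFinD leeD// lee_fin.
Qed.

Lemma level_lambda_le_infty l : (0 < N)%N -> 0 <= l ->
  (nehari_level (I l) <= nehari_level Ioo)%E.
Proof.
move=> N0 l0; apply: le_ereal_inf_tmp => _ [u /nehari_inftyP[hu nu [r [[br] pr]]] <-].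
rewrite (energy_infty hu br pr).
have r0 : 0 < r by rewrite -br base_gt0.
have c0 := nehari_coef_gt0 p1.
apply/lee_addgt0Pr => d d0.
pose d' := d / (nehari_coef p * r).
have d'0 : 0 < d' by rewrite divr_gt0// mulr_gt0.
have [s s1 Hs] := nehari_proj_cvg p1 r0 d'0.
(* With this bound on the potential, [l * P <= r * (s - 1)], so the quadratic term of the translate
   is at most [r * s], while its nonlinear term is at least [r]. The denominator [l + 1] allows
   [l = 0]. *)
have e0 : 0 < r * (s - 1) / (l + 1) by rewrite divr_gt0 ?mulr_gt0 ?subr_gt0//; lra.
have [y Hy] := small_potential N0 (H1_sqinteg hu) e0.
set w := fun x => _ in Hy.
have hw : H1 w := H1_shift y hu.
have nw : ~ ae_zero w.
  move=> /(@ae_shift R N (- y)) Z; apply: nu; apply: filterS Z => x.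
  by rewrite /w subrK.
have mw := meas hw.
have [P [EP P0 Pe]] : exists P, [/\ pot w = P%:E, 0 <= P & P <= r * (s - 1) / (l + 1)].
  have := potential_ge0 a w; move: Hy; case: (pot w) => [P||] //.
  by rewrite !lee_fin => ? ?; exists P.
have pw : (bi%:E * pow w)%E = r%:E by rewrite /w power_shift//; exact: meas.
have [q q0 Eq] : exists2 q, 0 <= q & wpow w = q%:E.
  have pf : pow w \is a fin_num.
    have := power_ge0 p w; move: pw; case: (pow w) => //.
    by rewrite gt0_muley ?lte_fin.
  have wf : wpow w \is a fin_num.
    rewrite ge0_fin_numE ?wpower_ge0//; apply: le_lt_trans (wpower_le p C0 mb mw bC) _.
    by rewrite -(fineK pf) -EFinM ltry.
  by exists (fine (wpow w)); [rewrite fine_ge0// wpower_ge0|rewrite fineK].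
have Aw : quad l w = (r + l * P)%:E by rewrite /quad EP /w base_shift// br.
have Bw : nonlin w = (r + q)%:E by rewrite /nonlin pw Eq.
apply: (le_trans (level_lambda_le l0 hw nw Aw Bw)).
rewrite -EFinD lee_fin.
apply: (@le_trans _ _ (nehari_proj p (r * s) r)).
  apply: nehari_proj_mono => //.
  - by rewrite ltr_pwDl// mulr_ge0.
  - have : l * P <= (l + 1) * (r * (s - 1) / (l + 1)).
      apply: (@le_trans _ _ (l * (r * (s - 1) / (l + 1)))); first by rewrite ler_wpM2l.
      by rewrite ler_wpM2r ?(ltW e0)//; lra.
    have -> : (l + 1) * (r * (s - 1) / (l + 1)) = r * (s - 1).
      by field; rewrite gt_eqF//; lra.
    lra.
  - by rewrite lerDl.
apply: (le_trans Hs); rewrite mulrDr mulr1 mulrDr lerD2l /d' mulrA mulrC divfK//.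
by rewrite gt_eqF// mulr_gt0.
Qed.

End levels.

(** * Non-existence of minimizers *)

Lemma potential_eq0 (R : realType) N (a u : 'rV[R]_N -> R) :
  measurable_fun setT a -> measurable_fun setT u -> potential a u = 0%E ->
  \forall x \ae lebesgue_rV R N, `|a x| * u x ^+ 2 = 0.
Proof.
move=> ma mu pu.
have H : (\int[lebesgue_rV R N]_x `|(`|a x| * u x ^+ 2)%:E| = 0)%E.
  by rewrite -[RHS]pu; apply: eq_integral => x _; rewrite gee0_abs// lee_fin mulr_ge0 ?sqr_ge0.
have mE : measurable_fun setT (fun x => (`|a x| * u x ^+ 2)%:E).
  by apply/measurable_EFinP; exact: measurable_potential.
have /(ae_eq_integral_abs (lebesgue_rV R N) measurableT mE) := H.
by apply: filterS => x /(_ I) [].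
Qed.

(** * The competitor of a minimizer *)

Section competitor.
Context {R : realType} {N : nat}.
Local Notation mu := (lebesgue_rV R N).
Local Notation V := 'rV[R]_N.
Implicit Types (u v w phi : V -> R).
Variables (u phi : V -> R) (d t ai : R).
Hypotheses (hu : H1 u) (tp : test_function phi) (phi0 : forall x, 0 <= phi x).
Hypotheses (d0 : 0 < d) (t0 : 0 < t) (ai0 : 0 < ai).

Definition competitor x : R := smooth_abs d (u x) + t * phi x.

Let sd x := smooth_abs d (u x).
Let sg i x := smooth_sgn d (u x) * weak_partial i u x.

Let F_le r : `|smooth_abs d r| <= `|r|.
Proof. by rewrite ger0_norm ?smooth_abs_ge0// smooth_abs_le. Qed.

Lemma smooth_abs_sqinteg : sqinteg mu (fun x => smooth_abs d (u x)).
Proof. exact: (chain_sqinteg (smooth_abs_measurable d) F_le (H1_sqinteg hu)). Qed.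

Let ssd := smooth_abs_sqinteg.

Let ssg i : sqinteg mu (sg i).
Proof.
have [sw _] := weak_partial_spec i hu.
exact: (chain_partial_sqinteg (smooth_sgn_measurable d0) (smooth_sgn_le1 d0) (H1_sqinteg hu) sw).
Qed.

Let wsd i : weak_partial_of i sd (sg i).
Proof.
have [sw ww] := weak_partial_spec i hu.
have L0 : 0 <= 2 / d by rewrite divr_ge0// ltW.
exact: (weak_partial_of_comp (smooth_abs_measurable d) (smooth_sgn_measurable d0) L0 F_le
  (smooth_sgn_le1 d0) (smooth_abs_taylor d0) (smooth_sgn_lip d0) (H1_sqinteg hu) sw ww).
Qed.

Lemma H1_smooth_abs : H1 (fun x => smooth_abs d (u x)).
Proof. exact: H1I ssd ssg wsd. Qed.

Let sphi := test_sqinteg tp.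
Let sdphi i := test_sqinteg (test_partial i tp).

Let sw : sqinteg mu competitor.
Proof. exact: (sqintegD ssd (sqintegZ t sphi)). Qed.

Let g i x := sg i x + t * partial i phi x.

Let sgw i : sqinteg mu (g i).
Proof. exact: (sqintegD (ssg i) (sqintegZ t (sdphi i))). Qed.

Let wgw i : weak_partial_of i competitor (g i).
Proof.
apply: (weak_partial_ofD ssd (ssg i) (sqintegZ t sphi) (sqintegZ t (sdphi i)) (wsd i)).
exact: (weak_partial_ofZ t sphi (sdphi i) (weak_partial_of_test i tp)).
Qed.

Lemma H1_competitor : H1 competitor.
Proof. exact: H1I sw sgw wgw. Qed.

(** This is [base ai phi] with classical instead of weak partial derivatives. *)
Definition test_base : R := (\int[mu]_x (\sum_i partial i phi x ^+ 2 + ai * phi x ^+ 2))%R.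

Lemma test_base_ge0 : 0 <= test_base.
Proof.
apply: Rint_ge0 => x; rewrite addr_ge0 ?mulr_ge0 ?sqr_ge0// ?(ltW ai0)//.
by apply: sumr_ge0 => i _; exact: sqr_ge0.
Qed.

(** Testing the weak derivative of the regularised [|u|] with [partial i phi] moves a second
    derivative onto [phi]. *)
Let int_cross : (\int[mu]_x (\sum_i sg i x * partial i phi x + ai * (sd x * phi x)) =
  \int[mu]_x (sd x * (ai * phi x - laplacian phi x)))%R.
Proof.
have i1 i : integ mu (fun x => sg i x * partial i phi x) := sqintegM (ssg i) (sdphi i).
have i2 : integ mu (fun x => ai * (sd x * phi x)) by apply: integZ; exact: sqintegM.
have i3 i : integ mu (fun x => sd x * partial i (partial i phi) x).
  by apply: sqintegM => //; apply: test_sqinteg; do 2 apply: test_partial.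
have -> : (fun x => sd x * (ai * phi x - laplacian phi x)) =
    (fun x => ai * (sd x * phi x) - \sum_i sd x * partial i (partial i phi) x).
  by apply/funext => x; rewrite mulrBr mulr_sumr mulrCA.
rewrite RintD//; last exact: integ_sum.
rewrite RintB//; last exact: integ_sum.
rewrite addrC; congr (_ + _); rewrite !Rint_sum// -sumrN; apply: eq_bigr => i _.
have := (weak_partial_ofP i ssd (ssg i)).1 (wsd i) _ (test_partial i tp).
by move=> ->; rewrite opprK.
Qed.

(** Expansion of the squares in [t]: the constant part is at most that of [u], since
    [|smooth_sgn| <= 1] and [smooth_abs d r <= |r|], and the linear part is given by [int_cross]. *)
Lemma base_competitor_le : base ai competitor <=
  base ai u + 2 * t * (\int[mu]_x (smooth_abs d (u x) * (ai * phi x - laplacian phi x)))%R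
  + t ^+ 2 * test_base.
Proof.
rewrite -[in X in _ + X + _]int_cross.
pose Q x := \sum_i sg i x * partial i phi x + ai * (sd x * phi x).
pose T x := \sum_i partial i phi x ^+ 2 + ai * phi x ^+ 2.
have iQ : integ mu Q.
  apply: integD; first by apply: integ_sum => i; exact: sqintegM.
  by apply: integZ; exact: sqintegM.
have iT : integ mu T.
  apply: integD; first by apply: integ_sum => i; exact: (sdphi i).2.
  by apply: integZ; exact: sphi.2.
have iB := integ_base ai hu.
have iA : integ mu (fun x => \sum_i g i x ^+ 2 + ai * competitor x ^+ 2).
  apply: integD; first by apply: integ_sum => i; exact: (sgw i).2.
  by apply: integZ; exact: sw.2.
have -> : base ai competitor = (\int[mu]_x (\sum_i g i x ^+ 2 + ai * competitor x ^+ 2))%R.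
  apply: Rint_eq_ae.
  - exact: integ_measurable (integ_base ai H1_competitor).
  - exact: integ_measurable iA.
  - by apply: filterS (sqr_grad_ae H1_competitor sgw wgw) => x ->.
rewrite -RintZ// -RintZ// /base -RintD//; last exact: integZ.
rewrite -RintD//; [|by apply: integD => //; exact: integZ|exact: integZ].
apply: Rint_le => //; first by apply: integD; [apply: integD => //|]; exact: integZ.
move=> x; rewrite /Q /T /sqr_grad /competitor -/(sd x).
have H1 : \sum_i g i x ^+ 2 = \sum_i sg i x ^+ 2 + 2 * t * (\sum_i sg i x * partial i phi x)
    + t ^+ 2 * \sum_i partial i phi x ^+ 2.
  rewrite !mulr_sumr -!big_split/=; apply: eq_bigr => i _; rewrite /g; ring.
have H2 : \sum_i sg i x ^+ 2 <= \sum_(i < N) weak_partial i u x ^+ 2.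
  apply: ler_sum => i _; rewrite /sg exprMn ler_piMl ?sqr_ge0//.
  by rewrite -real_normK ?num_real// exprn_ile1// smooth_sgn_le1.
have H3 : sd x ^+ 2 <= u x ^+ 2.
  by rewrite -[leRHS]real_normK ?num_real// lerXn2r ?nnegrE ?smooth_abs_ge0// smooth_abs_le.
have H4 : ai * sd x ^+ 2 <= ai * u x ^+ 2 by rewrite ler_pM2l.
rewrite H1 sqrrD; lra.
Qed.

(** Almost everywhere [a] or [u] vanishes, and [smooth_abs d 0 = 0], so that only [t phi] meets
    [a]. *)
Lemma potential_competitor a : measurable_fun setT a -> potential a u = 0%E ->
  potential a competitor = ((t ^+ 2)%:E * potential a phi)%E.
Proof.
move=> ma pu; have mu_ := (H1_sqinteg hu).1; have mp := sphi.1.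
rewrite -potentialZ//.
have ae0 := potential_eq0 ma mu_ pu.
apply: ae_eq_integral => //.
- by apply/measurable_EFinP; apply: measurable_potential => //; exact: sw.1.
- by apply/measurable_EFinP; apply: measurable_potential => //; exact: measurable_funM.
apply: filterS ae0 => x /eqP; rewrite mulf_eq0 sqrf_eq0 normr_eq0 => /orP[/eqP ->|/eqP u0] _.
  by rewrite normr0 !mul0r.
rewrite /competitor u0; have -> : smooth_abs d 0 = 0.
  by apply/eqP; rewrite -normr_le0 (le_trans (F_le 0))// normr0.
by rewrite add0r.
Qed.

Lemma competitor_ge x : smooth_abs d (u x) <= competitor x.
Proof. by rewrite lerDl mulr_ge0// ltW. Qed.

Lemma competitor_neq0 : ~ ae_zero u -> ~ ae_zero competitor.
Proof.
move=> nu Z; apply: nu; apply: filterS Z => x w0.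
have := competitor_ge x; rewrite w0 => s0.
have : smooth_abs d (u x) = 0 by apply/eqP; rewrite eq_le s0 smooth_abs_ge0.
move=> /eqP; rewrite subr_eq0 => /eqP E.
have : u x ^+ 2 + d ^+ 2 = d ^+ 2 by rewrite -[RHS](congr1 (fun z => z ^+ 2) E) sqr_sqrtr// addr_ge0// sqr_ge0.
by move=> /eqP; rewrite -subr_eq0 addrK sqrf_eq0 => /eqP.
Qed.

End competitor.

(** * Monotonicity and finiteness of the nonlinear term *)

Section nonlinear_term.
Context {R : realType} {N : nat}.
Local Notation mu := (lebesgue_rV R N).
Local Notation V := 'rV[R]_N.
Implicit Types (u v w phi : V -> R).
Variables (p bi C : R) (b : V -> R).
Hypotheses (p1 : 1 < p) (bi0 : 0 < bi) (C0 : 0 <= C).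
Hypotheses (mb : measurable_fun setT b) (bC : \forall x \ae mu, `|b x| <= C).

Let p10 : 0 <= p + 1. Proof. by rewrite addr_ge0// ltW// (lt_trans ltr01). Qed.

Lemma nonlinE v : H1 v ->
  nonlin p bi b v = (\int[mu]_x ((bi + `|b x|) * `|v x| `^ (p + 1))%:E)%E.
Proof.
move=> hv; rewrite (@wpowerE R N p bi bi0 (fun x => `|b x|))//.
- congr (_ + _)%E; apply: eq_integral => x _; by rewrite normr_id.
- exact: measurableT_comp.
- by apply/nearW => x; exact: normr_ge0.
Qed.

Let measurable_nonlin v : measurable_fun setT v ->
  measurable_fun setT (fun x => (bi + `|b x|) * `|v x| `^ (p + 1)).
Proof.
move=> mv; apply: measurable_funM; last exact: measurable_power.
by apply: measurable_funD => //; exact: measurableT_comp.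
Qed.

Let nonlin_dens_ge0 v x : 0 <= (bi + `|b x|) * `|v x| `^ (p + 1).
Proof. by rewrite mulr_ge0 ?powR_ge0// addr_ge0// ltW. Qed.

Let nonlin_dens_le v w x : `|v x| <= `|w x| ->
  (bi + `|b x|) * `|v x| `^ (p + 1) <= (bi + `|b x|) * `|w x| `^ (p + 1).
Proof.
move=> vw; rewrite ler_wpM2l//; first by rewrite addr_ge0// ltW.
by rewrite ge0_ler_powR ?nnegrE.
Qed.

Lemma nonlin_le v w : H1 v -> H1 w -> (forall x, `|v x| <= `|w x|) ->
  (nonlin p bi b v <= nonlin p bi b w)%E.
Proof.
move=> hv hw vw; rewrite (nonlinE hv) (nonlinE hw); apply: ge0_le_integral_EFin.
- by apply: measurable_nonlin; exact: (H1_sqinteg hv).1.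
- by apply: measurable_nonlin; exact: (H1_sqinteg hw).1.
- by move=> x; rewrite nonlin_dens_ge0/=; exact: nonlin_dens_le.
Qed.

Lemma nonlin_lty v : measurable_fun setT v -> (power p v < +oo)%E -> (nonlin p bi b v < +oo)%E.
Proof.
move=> mv pv; have pf : power p v \is a fin_num by rewrite ge0_fin_numE ?power_ge0.
have wf := le_lt_trans (wpower_le p C0 mb mv bC).
rewrite /nonlin -(fineK pf); apply: lte_add_pinfty; first by rewrite -EFinM ltry.
by apply: wf; rewrite -(fineK pf) -EFinM ltry.
Qed.

Lemma power_lty v : (nonlin p bi b v < +oo)%E -> (power p v < +oo)%E.
Proof.
have := power_ge0 p v; have := wpower_ge0 p b v; rewrite /nonlin.
case: (power p v) => [z||] // w0 _; first by rewrite ltry.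
by rewrite gt0_muley ?lte_fin// addye// gt_eqF// (lt_le_trans _ w0)// ltNyr.
Qed.

(** From [|v + w| <= 2 max (|v|, |w|)]. It makes the nonlinear term of the competitor finite. *)
Lemma power_add_lty v w : measurable_fun setT v -> measurable_fun setT w ->
  (power p v < +oo)%E -> (power p w < +oo)%E -> (power p (fun x => v x + w x)%R < +oo)%E.
Proof.
move=> mv mw pv pw.
have q0 : 0 <= 2 `^ (p + 1) :> R by exact: powR_ge0.
apply: (@le_lt_trans _ _ (\int[mu]_x (2 `^ (p + 1) * (`|v x| `^ (p + 1) + `|w x| `^ (p + 1)))%:E)%E).
  apply: ge0_le_integral_EFin.
  - by apply: measurable_power; exact: measurable_funD.
  - by apply: measurable_funM => //; apply: measurable_funD; exact: measurable_power.
  move=> x; rewrite powR_ge0/=.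
  wlog vw : v w {mv mw pv pw} / `|v x| <= `|w x|.
    move=> H; have [vw|wv] := leP `|v x| `|w x|; first exact: H.
    by rewrite addrC [X in _ * X]addrC; apply: H; exact: ltW.
  apply: (@le_trans _ _ ((2 * `|w x|) `^ (p + 1))).
    rewrite ge0_ler_powR ?nnegrE ?mulr_ge0// (le_trans (ler_normD _ _))//; lra.
  by rewrite powRM// ler_wpM2l// lerDr powR_ge0.
rewrite ge0_integral_cstM//; last by apply: measurable_funD; exact: measurable_power.
have pvf : power p v \is a fin_num by rewrite ge0_fin_numE; [exact: pv|exact: power_ge0].
have pwf : power p w \is a fin_num by rewrite ge0_fin_numE; [exact: pw|exact: power_ge0].
under eq_integral do rewrite EFinD.
rewrite ge0_integralD//; last 2 first.
- by apply/measurable_EFinP; exact: measurable_power.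
- by apply/measurable_EFinP; exact: measurable_power.
rewrite -/(power p v) -/(power p w) -(fineK pvf) -(fineK pwf).
by rewrite -EFinD -EFinM ltry.
Qed.

Lemma power_test_lty phi : test_function phi -> (power p phi < +oo)%E.
Proof.
move=> tp; have [k pk] := test_cube tp; have [K pK] := test_bound tp.
have K0 : 0 <= K := le_trans (normr_ge0 _) (pK 0).
apply: (@le_lt_trans _ _ (\int[mu]_x (K `^ (p + 1) * \1_(@cube R N k%:R) x)%:E)%E).
  apply: ge0_le_integral_EFin.
  - by apply: measurable_power; exact: test_measurable.
  - apply: measurable_funM => //; apply: measurable_indic; exact: measurable_cube.
  move=> x; rewrite powR_ge0/= indicE; have [cx|cx] := boolP (x \in cube k%:R).
    by rewrite mulr1 ge0_ler_powR ?nnegrE.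
  rewrite pk; last by move: cx; rewrite notin_setE.
  by rewrite normr0 mulr0 powR0// gt_eqF// addr_gt0// (lt_trans ltr01).
rewrite ge0_integral_cstM ?powR_ge0//; last by apply: measurable_indic; exact: measurable_cube.
rewrite integral_indic//; last exact: measurable_cube.
apply: lte_mul_pinfty => //; first by rewrite lee_fin powR_ge0.
by rewrite setIT; exact: cube_finite.
Qed.

(* Dominated convergence, since [smooth_abs d] increases to the absolute value. *)
Lemma nonlin_smooth_abs u r s : H1 u -> nonlin p bi b u = r%:E -> s < r ->
  \forall n \near \oo, s < fine (nonlin p bi b (fun x => smooth_abs n.+1%:R^-1 (u x))).
Proof.
move=> hu Er sr.
have mu_ := (H1_sqinteg hu).1.
pose d n : R := n.+1%:R^-1.
have d0 n : 0 < d n by rewrite invr_gt0.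
have F_le n r' : `|smooth_abs (d n) r'| <= `|r'|.
  by rewrite ger0_norm ?smooth_abs_ge0// smooth_abs_le.
pose f n x := ((bi + `|b x|) * `|smooth_abs (d n) (u x)| `^ (p + 1))%:E.
pose f0 x := ((bi + `|b x|) * `|u x| `^ (p + 1))%:E.
have ms n : measurable_fun setT (fun x => smooth_abs (d n) (u x)).
  by apply: measurableT_comp mu_; exact: smooth_abs_measurable.
have mf n : measurable_fun setT (f n) by apply/measurable_EFinP; exact: measurable_nonlin.
have mf0 : measurable_fun setT f0 by apply/measurable_EFinP; exact: measurable_nonlin.
have if0 : mu.-integrable setT f0.
  apply: integ_ge0P; [exact: measurable_nonlin|by move=> x; exact: nonlin_dens_ge0|].
  by rewrite -nonlinE// Er ltry.
have cf x : f ^~ x @ \oo --> f0 x.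
  have cs : (fun n => `|smooth_abs (d n) (u x)|) @ \oo --> `|u x|.
    apply/cvgrPdist_le => e e0; near=> n.
    rewrite (ger0_norm (smooth_abs_ge0 (d0 n) _)) ger0_norm; last by rewrite subr_ge0 smooth_abs_le.
    apply: (@le_trans _ _ (d n)); first by have := smooth_abs_ge (d n) (u x); lra.
    by apply: ltW; near: n; exact: (near_infty_natSinv_lt (PosNum e0)).
  apply: cvg_EFin; first by apply: nearW.
  apply: cvgM; first exact: cvg_cst.
  (* At zeros of [u] the sequence is constant; elsewhere the limit [|u x|] is positive, where the
     power is differentiable. *)
  have [u0|u0] := eqVneq (u x) 0.
    rewrite u0; apply: cvg_near_cst; apply: nearW => n; congr (_ `^ _).
    by apply/eqP; rewrite eq_le F_le normr0 normr_ge0.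
  have ch : {for `|u x|, continuous (fun z : R => z `^ (p + 1))}.
    apply: differentiable_continuous; apply/derivable1_diffP.
    by apply: derivable_powR; rewrite in_itv/= andbT normr_gt0.
  exact: (continuous_cvg _ ch cs).
have cfa : \forall x \ae mu, setT x -> f ^~ x @ \oo --> f0 x by apply: aeW => x _; exact: cf.
have := @dominated_convergence _ _ _ mu setT measurableT f f0 f0 mf mf0 cfa if0.
case.
  apply: aeW => x n _; rewrite /f /f0 gee0_abs; last first.
    by rewrite lee_fin; exact: (nonlin_dens_ge0 (fun x => smooth_abs (d n) (u x))).
  rewrite lee_fin; exact: (@nonlin_dens_le (fun x => smooth_abs (d n) (u x))).
move=> _ _; rewrite -/f0 (_ : (\int[mu]_x f0 x)%E = r%:E); last by rewrite -Er nonlinE.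
move=> /fine_cvg H; apply: filterS (cvgr_gt _ H s sr) => n /=.
by rewrite (nonlinE (H1_smooth_abs hu (d0 n))).
Unshelve. all: by end_near. Qed.

End nonlinear_term.

(** * Minimizers with zero potential *)

Section not_achieved.
Context {R : realType} {N : nat}.
Local Notation mu := (lebesgue_rV R N).
Local Notation V := 'rV[R]_N.
Implicit Types (u v w phi : V -> R).
Variables (p ai bi C l : R) (a b : V -> R).
Hypotheses (p1 : 1 < p) (ai0 : 0 < ai) (bi0 : 0 < bi) (C0 : 0 <= C) (l0 : 0 <= l).
Hypotheses (ma : measurable_fun setT a) (mb : measurable_fun setT b).
Hypotheses (a0 : ae_nonneg a) (b0 : ae_nonneg b).
Hypotheses (bC : \forall x \ae mu, `|b x| <= C) (a_loc : locinteg a).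

Local Notation I := (I_lambda p ai bi a b l).

Lemma locinteg_cst (c : R) : locinteg (cst c : V -> R).
Proof.
split => // k; apply: measurable_bounded_integrable => //.
- exact: measurable_cube.
- exact: cube_finite.
- by exists `|c|; split; [exact: num_real|move=> y cy x _; exact: ltW].
Qed.

Lemma potential_test_fin phi : test_function phi -> exists2 P, 0 <= P & potential a phi = P%:E.
Proof.
move=> tp; have ia : integ mu (fun x => a x * phi x ^+ 2).
  have := test_integM a_loc tp.
  have [k pk] := test_cube tp; have [K pK] := test_bound tp.
  have K0 : 0 <= K := le_trans (normr_ge0 _) (pK 0).
  move=> _; apply: (@locinteg_mul _ _ a _ k (K ^+ 2)) => //.
  - by apply: measurable_funX; exact: test_measurable.
  - by move=> x; rewrite normrX lerXn2r ?nnegrE.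
  - by move=> x nx; rewrite pk// expr0n.
have := integ_norm ia; set h := (fun x => _) => ih.
exists (\int[mu]_x h x)%R; first by apply: Rint_ge0 => x; exact: normr_ge0.
rewrite -(integ_fin ih); apply: eq_integral => x _.
by rewrite /h normrM normrX real_normK ?num_real.
Qed.

(** If the pairing [X] were negative, the competitor would have a quadratic term at most
    [A1 = r + t X / 2] and a nonlinear term above [A1]. Its projection would then have energy below
    that of [u], a minimizer. *)
Lemma minimizer_superharmonic u : nehari I u -> I u = nehari_level I ->
  potential a u = 0%E -> superharmonic ai (fun x => `|u x|).
Proof.
move=> nu Iu pu phi tp phi0.
have [hu nzu [r [Er Br]]] := (nehari_lambdaP p1 ai0 bi0 ma mb a0 b0 u l0).1 nu.
have rE : r = base ai u by move: Er; rewrite /quad pu mule0 adde0 => -[].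
have su := H1_sqinteg hu.
set X := (\int[mu]_x _)%R; rewrite leNgt; apply/negP => X0.
have [P P0 EP] := potential_test_fin tp.
pose D := test_base phi ai + l * P.
have D0 : 0 <= D by rewrite addr_ge0 ?mulr_ge0 ?test_base_ge0.
(* The term [t^2 D] consumes at most half of the linear gain [- t X]. As neither [D] nor [X]
   involves [d], [t] is fixed before [d], which depends on [t] through [A1]. *)
pose t := - X / (2 * (D + 1)).
have t0 : 0 < t by rewrite divr_gt0 ?mulr_gt0//; lra.
have tD : t * D <= - X / 2.
  rewrite /t invfM mulrA -mulrA ler_piMr ?divr_ge0//; first lra.
  by rewrite mulrC ler_pdivrMr; lra.
pose psi x := ai * phi x - laplacian phi x.
have ipsi : integ mu (fun x => `|psi x|).
  have := integ_norm (integ_laplacian ai (locinteg_cst 1) tp).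
  by congr integ; apply/funext => x; rewrite mul1r.
set K := (\int[mu]_x `|psi x|)%R.
have K0 : 0 <= K by apply: Rint_ge0.
(* Replacing [|u|] by [smooth_abs d u] changes the pairing by at most [d K]; for [d] below this
   bound it is still at most [X / 2]. *)
have e0 : 0 < - X / (2 * (K + 1)) by rewrite divr_gt0 ?mulr_gt0//; lra.
pose A1 := r + t * X / 2.
have A1r : A1 < r by rewrite /A1 gtrDl pmulr_llt0// pmulr_rlt0.
have [n [n1 n2]] := filter_ex (filterI (near_infty_natSinv_lt (PosNum e0))
  (nonlin_smooth_abs p1 bi0 mb hu Br A1r)).
set d := n.+1%:R^-1 in n1 n2.
have d0 : 0 < d by rewrite invr_gt0.
have hsd := H1_smooth_abs hu d0.
have Xd : (\int[mu]_x (smooth_abs d (u x) * psi x) <= X / 2)%R.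
  have i1 : integ mu (fun x => smooth_abs d (u x) * psi x).
    exact: integ_laplacian (sqinteg_loc (H1_sqinteg hsd)) tp.
  have i2 : integ mu (fun x => `|u x| * psi x).
    exact: integ_laplacian (sqinteg_loc (sqinteg_norm su)) tp.
  have H : (\int[mu]_x (smooth_abs d (u x) * psi x) - X <= d * K)%R.
    rewrite /X -RintB// /K -RintZ//; apply: Rint_le; [exact: integB|exact: integZ|].
    move=> x; rewrite -mulrBl (le_trans (ler_norm _))// normrM ler_wpM2r//.
    have := smooth_abs_le d0 (u x); have := smooth_abs_ge d (u x) => H1 H2.
    by rewrite ler_norml; apply/andP; split; lra.
  have : d * K <= - X / 2.
    apply: (@le_trans _ _ (- X / (2 * (K + 1)) * K)); first by rewrite ler_wpM2r// ltW.
    rewrite invfM mulrA -mulrA ler_piMr ?divr_ge0//; first lra.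
    by rewrite mulrC ler_pdivrMr; lra.
  lra.
pose w := competitor u phi d t.
have hw : H1 w by exact: H1_competitor.
have nw : ~ ae_zero w by exact: competitor_neq0.
have Aw : quad ai a l w = (base ai w + l * (t ^+ 2 * P))%:E.
  have -> : quad ai a l w = ((base ai w)%:E + l%:E * ((t ^+ 2)%:E * potential a phi))%E.
    by rewrite /quad -(potential_competitor t hu tp d0 ma pu).
  by rewrite EP.
have bw0 : 0 < base ai w by exact: base_gt0.
have Aw1 : base ai w + l * (t ^+ 2 * P) <= A1.
  have := base_competitor_le t hu tp d0 ai0; rewrite -/w -/psi -rE => H.
  have H1 : 2 * t * (\int[mu]_x (smooth_abs d (u x) * psi x))%R <= 2 * t * (X / 2).
    by rewrite ler_wpM2l// mulr_ge0// ltW.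
  have H2 : t * (t * D) <= t * (- X / 2) by rewrite ler_wpM2l// ltW.
  rewrite /A1; move: H H1 H2; rewrite /D; lra.
have sw_le x : `|smooth_abs d (u x)| <= `|w x|.
  have H : smooth_abs d (u x) <= w x by exact: competitor_ge.
  by rewrite !ger0_norm ?smooth_abs_ge0//; apply: le_trans H; exact: smooth_abs_ge0.
have mw := (H1_sqinteg hw).1.
have pu_fin : (power p u < +oo)%E by apply: (power_lty (b := b) bi0); rewrite Br ltry.
have psd_fin : (power p (fun x => smooth_abs d (u x)) < +oo)%E.
  apply: (power_lty (b := b) bi0); apply: le_lt_trans (nonlin_le p1 bi0 mb hsd hu _) _.
    by move=> x; rewrite ger0_norm ?smooth_abs_ge0// smooth_abs_le.
  by rewrite Br ltry.
have ptphi : (power p (fun x => (t * phi x)%R) < +oo)%E.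
  rewrite powerZ ?(ltW t0)//; last exact: test_measurable.
  have := power_ge0 p phi; have := power_test_lty p1 tp.
  by case: (power p phi) => // z _ _; rewrite -EFinM ltry.
have pw_fin : (power p w < +oo)%E.
  apply: power_add_lty => //; first exact: (H1_sqinteg hsd).1.
  by apply: measurable_funM => //; exact: test_measurable.
have nw_fin : (nonlin p bi b w < +oo)%E by exact: (nonlin_lty bi C0 mb bC mw pw_fin).
have nle := nonlin_le p1 bi0 mb hsd hw sw_le.
have nsd0 : (0 <= nonlin p bi b (fun x => smooth_abs d (u x)))%E.
  by rewrite /nonlin adde_ge0 ?wpower_ge0// mule_ge0 ?power_ge0// lee_fin ltW.
have nwf : nonlin p bi b w \is a fin_num.
  by rewrite ge0_fin_numE; [exact: nw_fin|exact: le_trans nsd0 nle].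
have nsdf : nonlin p bi b (fun x => smooth_abs d (u x)) \is a fin_num.
  by rewrite ge0_fin_numE; [exact: le_lt_trans nle nw_fin|exact: nsd0].
have Bw1 : A1 < fine (nonlin p bi b w) := lt_le_trans n2 (fine_le nsdf nwf nle).
have Aw0 : 0 < base ai w + l * (t ^+ 2 * P).
  by rewrite ltr_pwDl// mulr_ge0// mulr_ge0// sqr_ge0.
have := level_lambda_le p1 ai0 bi0 ma mb a0 b0 l0 hw nw Aw (esym (fineK nwf)).
rewrite -Iu (energy_lambda ai0 bi0 ma mb a0 b0 l0 hu Er Br) leNgt => /negP; apply.
rewrite lte_fin; apply: le_lt_trans (nehari_proj_le p1 Aw0 (le_trans Aw1 (ltW Bw1))) _.
by rewrite ltr_pM2l; [exact: le_lt_trans Aw1 A1r|exact: nehari_coef_gt0].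
Qed.

Lemma minimizer_potential_neq0 u : nehari I u -> I u = nehari_level I ->
  ~ ae_zero a -> potential a u != 0%E.
Proof.
move=> nu Iu na; apply/eqP => pu.
have [hu nzu _] := (nehari_lambdaP p1 ai0 bi0 ma mb a0 b0 u l0).1 nu.
have su := H1_sqinteg hu; have mu_ := su.1.
have Hs := minimizer_superharmonic nu Iu pu.
have [K K0 HK] := shift_dist_le hu.
(* Intersecting with the zeros of [u] makes [u] vanish everywhere on [Z], as the maximum principle
   asks; since [a u^2 = 0] almost everywhere, only a null set is lost. *)
pose Z := [set x : V | a x != 0] `&` [set x | u x = 0].
have mZ : measurable Z.
  apply: measurableI.
    rewrite (_ : [set x | a x != 0] = setT `&` a @^-1` (~` [set 0])); last first.
      by rewrite setTI; apply/seteqP; split => x /= /eqP.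
    by apply: ma => //; exact: measurableC.
  rewrite (_ : [set x | u x = 0] = setT `&` u @^-1` [set 0]); last by rewrite setTI.
  exact: mu_.
have nZ : mu Z != 0%E.
  apply/eqP => Z0; apply: na.
  have ae0 := potential_eq0 ma mu_ pu.
  have aeZ : \forall x \ae mu, ~ Z x.
    have nZ : mu.-negligible Z by apply/negligibleP.
    by apply: negligibleS nZ => x /= /contrapT.
  apply: filterS (filterI ae0 aeZ) => x [/eqP].
  rewrite mulf_eq0 sqrf_eq0 normr_eq0 => /orP[/eqP//|/eqP ux nx].
  by apply/eqP/negPn/negP => ax; apply: nx.
apply: nzu.
have : ae_zero (fun x => `|u x|).
  apply: (strong_maximum_principle (ltW ai0) (sqinteg_norm su) _ K0 _ mZ nZ _ Hs) => //.
    move=> y; apply: le_trans (HK y); apply: Rint_le.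
    - exact: (sqintegB (sqinteg_shift y (sqinteg_norm su)) (sqinteg_norm su)).2.
    - exact: (sqintegB (sqinteg_shift y su) su).2.
    move=> x; rewrite -[leLHS]real_normK ?num_real// -[leRHS]real_normK ?num_real//.
    by rewrite lerXn2r ?nnegrE// ler_dist_dist.
  by move=> x [_ /= ->]; rewrite normr0.
by apply: filterS => x /eqP; rewrite normr_eq0 => /eqP.
Qed.

End not_achieved.

(** * Coefficients in Lebesgue spaces *)

Section Lfun_coefficients.
Context {R : realType} {N : nat}.
Local Notation mu := (lebesgue_rV R N).
Implicit Types a b : 'rV[R]_N -> R.

Lemma Lfun_measurable p a : a \in Lfun mu p -> measurable_fun setT a.
Proof. by rewrite inE => /andP[]; rewrite inE. Qed.

Lemma Lfun_pinfty_bounded b : (0 < N)%N -> b \in Lfun mu +oo%E ->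
  exists2 C, 0 <= C & \forall x \ae mu, `|b x| <= C.
Proof.
move=> N0; rewrite inE => /andP[_]; rewrite inE/= /finite_norm unlock.
rewrite (_ : (0 < mu [set: 'rV[R]_N])%E = true); last by rewrite lebesgue_rVT// ltry.
move=> H; have [M HM] : exists M, \forall x \ae mu, (Num.norm \o b) x <= M by exact: ess_sup_inf.ess_supr_bounded.
exists `|M| => //; apply: filterS HM => x; move/le_trans; apply; exact: ler_norm.
Qed.

(** [|a| <= 1 + |a|^q] for [1 <= q], and cubes have finite measure. *)
Lemma Lfun_locinteg a q : 1 <= q -> a \in Lfun mu q%:E -> locinteg a.
Proof.
move=> q1 la; have ma := Lfun_measurable la; split => // k.
have mk := @measurable_cube R N k%:R.
have c1 : mu.-integrable (@cube R N k%:R) (EFin \o cst 1) := (@locinteg_cst R N 1).2 k.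
have c2 : mu.-integrable (@cube R N k%:R) (fun x => (`|a x| `^ q)%:E).
  by apply: integrableS (Lfun_integrable q1 la).
apply: (le_integrable _ _ _ (integrableD mk c1 c2)) => //.
  by apply/measurable_EFinP; exact: measurable_funTS.
move=> x _; rewrite /= lee_fin [leRHS]ger0_norm ?addr_ge0 ?powR_ge0//.
have [a1|a1] := leP 1 `|a x|.
  by rewrite (le_trans (le1r_powR a1 q1))// lerDr.
by rewrite (le_trans (ltW a1))// lerDl powR_ge0.
Qed.

End Lfun_coefficients.

Theorem proposition3p3 (R : realType) (N : nat) (p a_infty b_infty : R)
    (a b : 'rV[R]_N -> R) (lambda_bar : R)
  (hN : (2 <= N)%N)
  (hp1 : 1 < p)
  (hp2 : (3 <= N)%N -> p < (N%:R + 2) / (N%:R - 2))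
  (ha_infty : 0 < a_infty)
  (hb_infty : 0 < b_infty)
  (ha : a \in Lfun (lebesgue_rV R N) (N%:R / 2)%:E)
  (ha_ge0 : ae_nonneg a)
  (ha_neq0 : ~ ae_zero a)
  (ha_lim : ae_vanishing_at_infinity a)
  (hb : b \in Lfun (lebesgue_rV R N) +oo%E)
  (hb_ge0 : ae_nonneg b)
  (hb_neq0 : ~ ae_zero b)
  (hb_lim : ae_vanishing_at_infinity b)
  (hlambda_bar : 0 <= lambda_bar)
  (hm : nehari_level (I_lambda p a_infty b_infty a b lambda_bar) =
        nehari_level (I_infty N p a_infty b_infty)) :
  forall lambda : R, lambda_bar < lambda ->
    nehari_level (I_lambda p a_infty b_infty a b lambda) =
      nehari_level (I_infty N p a_infty b_infty) /\
    ~ (exists u : 'rV[R]_N -> R,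
        nehari (I_lambda p a_infty b_infty a b lambda) u /\
        I_lambda p a_infty b_infty a b lambda u =
          nehari_level (I_lambda p a_infty b_infty a b lambda)).
Proof.
move=> lambda lt_lambda.
have l0 : 0 <= lambda := le_trans hlambda_bar (ltW lt_lambda).
have N0 : (0 < N)%N by exact: leq_trans hN.
have ma := Lfun_measurable ha; have mb := Lfun_measurable hb.
have [C C0 bC] := Lfun_pinfty_bounded N0 hb.
have a_loc : locinteg a.
  by apply: Lfun_locinteg ha; rewrite ler_pdivlMr// mul1r ler_nat.
have E : nehari_level (I_lambda p a_infty b_infty a b lambda) =
    nehari_level (I_infty N p a_infty b_infty).
  apply/eqP; rewrite eq_le; apply/andP; split.
    exact: (level_lambda_le_infty hp1 ha_infty hb_infty C0 ma mb ha_ge0 hb_ge0 bC a_loc ha_lim N0 l0).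
  rewrite -hm.
  exact: (level_lambda_ndecr hp1 ha_infty hb_infty ma mb ha_ge0 hb_ge0 hlambda_bar lt_lambda).
split => // -[u [nu Iu]].
have pu := minimizer_potential_neq0 hp1 ha_infty hb_infty C0 l0 ma mb ha_ge0 hb_ge0 bC a_loc nu Iu ha_neq0.
(* The level at [lambda_bar] would lie strictly below the energy of [u], although both equal the
   level at infinity. *)
have [_ /(_ pu)] := level_lambda_mono hp1 ha_infty hb_infty ma mb ha_ge0 hb_ge0 hlambda_bar lt_lambda nu.
by rewrite Iu hm E ltxx.
Qed.
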